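(* Let $\sigma>0$. The constant $d_2=\inf\{M_2(f):0\ne f\in\mathcal{B}_\sigma\}$ is equal to $\frac{2\pi}{\sigma}$.
   Context: The Fourier transform is $\widehat f(w)=\int_{\mathbb{R}} f(x)e^{-2\pi i w x}\,\mathrm{d}x$, extended to $L^2(\mathbb{R})$. For $\sigma>0$, $\mathcal{B}_\sigma=\{f\in L^2(\mathbb{R}):\operatorname{supp}\widehat f\subseteq[-\frac{\sigma}{2\pi},\frac{\sigma}{2\pi}]\}$; its elements are identified with entire functions of exponential type $\le\sigma$ that are square integrable on the real axis. For a non-zero entire function $f$, $M_2(f)$ is the supremum of $b-a$ over all open intervals $(a,b)\subseteq\mathbb{R}$ containing no point $x$ with $f(x)=f'(x)=0$. Thus $M_2(f)=\infty$ if the real points where $f$ and $f'$ both vanish are bounded on the left or on the right (or there are none); otherwise these points form a doubly infinite increasing sequence $(x_n)_{n\in\mathbb{Z}}$ and $M_2(f)=\sup_n(x_{n+1}-x_n)$. *)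

(* Defs.v *)
From mathcomp Require Import all_boot all_order all_algebra.
From mathcomp Require Import complex.
From mathcomp Require Import all_classical all_reals all_analysis.

Set Implicit Arguments.
Unset Strict Implicit.
Unset Printing Implicit Defensive.

Import Order.TTheory GRing.Theory Num.Theory.
Import numFieldNormedType.Exports.

Local Open Scope classical_set_scope.
Local Open Scope complex_scope.
Local Open Scope ring_scope.

Section Defs.
Context {R : realType}.
Notation mu := (@lebesgue_measure R).
Implicit Types (f g : R -> R[i]) (F : R[i]^o -> R[i]^o).

(* The real and imaginary parts are in the library's real L^p; as
   max(|Re f|, |Im f|) <= |f| <= |Re f| + |Im f|, this is complex L^p. *)
Definition cLfun (p : \bar R) f : Prop :=
  (fun x => complex.Re (f x)) \in Lfun mu p /\
  (fun x => complex.Im (f x)) \in Lfun mu p.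

Definition cintegral f : R[i] :=
  (\int[mu]_x complex.Re (f x))%R +i* (\int[mu]_x complex.Im (f x))%R.

Definition cexpi (t : R) : R[i] := cos t +i* sin t.

Definition fourier1 f (w : R) : R[i] :=
  cintegral (fun x => f x * cexpi (- (2 * pi * w * x))).

Definition cvgL2 (u : nat -> R -> R[i]) f : Prop :=
  (\int[mu]_x (ComplexField.Normc.normc (u n x - f x) ^+ 2)%:E)%E @[n --> \oo] --> 0%E.

(* g is a representative of the Fourier transform of f in L^2(R), that is of
   the value at f of the continuous extension to L^2 of the transform defined
   by the integral on the dense subspace of integrable, square integrable
   functions. By Plancherel's theorem such a g exists for every f in L^2 and is
   unique up to a null set. *)
Definition is_fourier2 f g : Prop :=
  [/\ cLfun 2%:E f, cLfun 2%:E g &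
    exists u : nat -> R -> R[i],
      [/\ forall n, cLfun 1%E (u n) /\ cLfun 2%:E (u n),
          cvgL2 u f &
          cvgL2 (fun n => fourier1 (u n)) g]].

(* The complement of the largest open set on which g vanishes almost
   everywhere; it only depends on the class of g modulo null sets. *)
Definition ess_support g : set R :=
  ~` [set x | exists2 U : set R, open U /\ U x &
                {ae mu, forall y, U y -> g y = 0}].

Definition entire F : Prop := forall z, derivable F z 1.

(* The entire functions whose restriction to the real axis lies in the
   Paley-Wiener space B_sigma. By the Paley-Wiener theorem every class in the
   L^2 space has exactly one such representative, of exponential type at most
   sigma. *)
Definition paley_wiener (sigma : R) : set (R[i]^o -> R[i]^o) :=
  [set F | entire F /\
     exists2 g : R -> R[i], is_fourier2 (fun x => F x%:C) g &
       ess_support g `<=` `[- (sigma / (2 * pi)), sigma / (2 * pi)]].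

Definition M2 F : \bar R :=
  ereal_sup [set l | exists a b : R,
    [/\ a < b,
        forall x, x \in `]a, b[ -> ~ (F x%:C = 0 /\ derive1 F x%:C = 0) &
        l = (b - a)%:E]].

Definition d2 (sigma : R) : \bar R :=
  ereal_inf [set M2 F | F in [set F | paley_wiener sigma F /\ F <> cst 0]].

End Defs.

(* Main.v *)
(* Lower bound. Let F be an entire representative of an element of B_sigma, and
   suppose that every interval of length D < 2 pi/sigma contains a double zero
   of F. Inverting the Fourier transform of F (by pairing it with a Fejer
   kernel) shows that the real and imaginary parts f of F on the real axis
   satisfy |f^(n)| <= C sigma^n. Between two successive double zeros f' vanishes
   at the end points and has mean zero, so Wirtinger's inequality bounds the
   integral of f''^2 below by w^2 times that of f'^2, for some w > sigma. The
   slowly varying weight 1/(1 + d^2 x^2) makes the energies of all derivatives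
   finite and the boundary terms small. Integration by parts makes the energies
   of successive derivatives almost log-convex, so the ratio w^2 of the first
   two persists: the energy of f^(n) grows faster than sigma^(2n), a
   contradiction unless f = 0. Then F vanishes on the real axis, hence
   everywhere.

   Upper bound. For a, b > 0 with 2a + 2b = sigma, sin(az)^2 (sin(bz)/(bz))^2
   is in B_sigma and has double zeros at the multiples of pi/a, and pi/a tends
   to 2 pi/sigma when b tends to 0. Its Fourier transform is a combination of
   translates of a triangle function, because the integral of
   (1 - cos(s x))/x^2 is proportional to |s| by scaling. *)
Require Import Defs.
From mathcomp Require Import all_boot all_order all_algebra.
From mathcomp Require Import complex.
From mathcomp Require Import all_classical all_reals all_analysis.
From mathcomp Require Import measurable_realfun lebesgue_integral_under ring lra.

Set Implicit Arguments.
Unset Strict Implicit.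
Unset Printing Implicit Defensive.

Import Order.TTheory GRing.Theory Num.Theory.
Import numFieldNormedType.Exports.
Local Open Scope classical_set_scope.
Local Open Scope ring_scope.

(** * Real functions with everywhere defined derivatives *)

Section RealDerivatives.
Context {R : realType}.
Implicit Types (f g h : R -> R) (x a b : R).

(** Mean zero doubles the admissible gap. For a function that merely vanishes at both ends,
    Wirtinger's inequality with ratio w^2 requires length at most pi/w; [f'] has mean zero as well,
    because [f] vanishes at both ends, and length at most 2 pi/w suffices. The bounds on [f^(n)] cap
    each weighted energy at a multiple of sigma^(2n)/d, so the excess of the first ratio must
    survive n steps. Each step costs a fixed multiple of the slope d of the weight, so d is of order
    1/n; the cap then gains only a factor n, which loses to an exponential. The order of choices is
    delicate: the lower bound for the first energy is taken with d = 1 so as not to depend on d,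
    then n and d are fixed together, and the end points of the interval come last, far enough out
    for all boundary terms at once. On the Fourier side the transform on L^2 is defined by limits.
    Pairing with a square integrable kernel is continuous under such limits, whereas evaluation at a
    point is not; evaluation is recovered only at the end, by letting the kernel concentrate. *)

Lemma is_derive_congr f x d d' : is_derive x 1 f d -> d = d' -> is_derive x 1 f d'.
Proof. by move=> H <-. Qed.

Lemma is_derive_addf f g x df dg : is_derive x 1 f df -> is_derive x 1 g dg ->
  is_derive x 1 (fun t => f t + g t) (df + dg).
Proof. by move=> hf hg; exact: is_deriveD. Qed.

Lemma is_derive_subf f g x df dg : is_derive x 1 f df -> is_derive x 1 g dg ->
  is_derive x 1 (fun t => f t - g t) (df - dg).
Proof. by move=> hf hg; exact: is_deriveB. Qed.

Lemma is_derive_mulf f g x df dg : is_derive x 1 f df -> is_derive x 1 g dg ->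
  is_derive x 1 (fun t => f t * g t) (f x * dg + g x * df).
Proof. by move=> hf hg; exact: is_deriveM. Qed.

Lemma is_derive_scalef (k : R) f x df : is_derive x 1 f df ->
  is_derive x 1 (fun t => k * f t) (k * df).
Proof.
move=> hf; have := @is_derive_mulf (cst k) f x 0 df (is_derive_cst _ _ _) hf.
by rewrite mulr0 addr0.
Qed.

Lemma is_derive_expf f n x df : is_derive x 1 f df ->
  is_derive x 1 (fun t => f t ^+ n.+1) (n.+1%:R * f x ^+ n * df).
Proof.
by move=> hf; have := is_deriveX n.+1 hf; rewrite exprfctE.
Qed.

Lemma is_derive_constf (k : R) x : is_derive x 1 (fun _ : R => k) 0.
Proof. exact: is_derive_cst. Qed.

Lemma is_derive_affine (k c : R) x : is_derive x 1 (fun t : R => k * (t - c)) k.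
Proof.
have := is_derive_scalef k (is_derive_subf (is_derive_id x 1) (is_derive_constf c x)).
by rewrite subr0 mulr1.
Qed.

Lemma is_derive_invf f x df : f x != 0 -> is_derive x 1 f df ->
  is_derive x 1 (fun t => (f t)^-1) (- (f x) ^- 2 * df).
Proof. by move=> fx hf; exact: is_deriveV. Qed.

Lemma is_derive_compf f g x df dg : is_derive (g x) 1 f df -> is_derive x 1 g dg ->
  is_derive x 1 (fun t => f (g t)) (df * dg).
Proof. by move=> hf hg; exact: is_derive1_comp. Qed.

Lemma is_derive_continuous_at f x df : is_derive x 1 f df -> {for x, continuous f}.
Proof.
by move=> [hf _]; apply: differentiable_continuous; exact/derivable1_diffP.
Qed.

Lemma is_derive_unique f x d d' : is_derive x 1 f d -> is_derive x 1 f d' -> d = d'.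
Proof. by move=> [_ <-] [_ <-]. Qed.

Lemma is_derive_within_continuous f df a b : (forall x, a <= x <= b -> is_derive x 1 f (df x)) ->
  {within `[a, b], continuous f}.
Proof.
move=> H; apply: derivable_within_continuous => x; rewrite in_itv /= => /H [].
by [].
Qed.

Lemma mean_value f df a b : a <= b ->
  (forall x, a <= x <= b -> is_derive x 1 f (df x)) ->
  exists2 c, a <= c <= b & f b - f a = df c * (b - a).
Proof.
move=> ab H; have [||c] := @MVT_segment R f df a b ab.
- by move=> x; rewrite in_itv /= => /andP[ax xb]; apply: H; rewrite !ltW.
- exact: is_derive_within_continuous H.
- by rewrite in_itv /= => cab e; exists c.
Qed.

Lemma is_derive_ge0_le f df a b : a <= b ->
  (forall x, a <= x <= b -> is_derive x 1 f (df x)) ->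
  (forall x, a <= x <= b -> 0 <= df x) -> f a <= f b.
Proof.
move=> ab H H0; have [c cab e] := mean_value ab H.
by rewrite -subr_ge0 e mulr_ge0 ?H0 // subr_ge0.
Qed.

Lemma continuous_addf f g : continuous f -> continuous g -> continuous (fun x => f x + g x).
Proof. by move=> cf cg x; exact: continuousD (cf x) (cg x). Qed.

Lemma continuous_subf f g : continuous f -> continuous g -> continuous (fun x => f x - g x).
Proof. by move=> cf cg x; exact: continuousB (cf x) (cg x). Qed.

Lemma continuous_mulf f g : continuous f -> continuous g -> continuous (fun x => f x * g x).
Proof. by move=> cf cg x; exact: continuousM (cf x) (cg x). Qed.

Lemma continuous_scalef (k : R) f : continuous f -> continuous (fun x => k * f x).
Proof. by move=> cf; apply: continuous_mulf => // x; exact: cvg_cst. Qed.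

Lemma continuous_expf n f : continuous f -> continuous (fun x => f x ^+ n).
Proof.
move=> cf; elim: n => [|n IH]; first by move=> x; exact: cvg_cst.
have -> : (fun x => f x ^+ n.+1) = (fun x => f x * f x ^+ n).
  by apply/funext => x; rewrite exprS.
exact: continuous_mulf.
Qed.

Lemma is_derive_continuous f df : (forall x, is_derive x 1 f (df x)) -> continuous f.
Proof. by move=> H x; exact: is_derive_continuous_at (H x). Qed.

(** The primitive vanishing at 0, written as a difference of two integrals from a common left end.
    That end moves with [x]; by additivity it can be frozen at [m] near a given point, where the
    fundamental theorem of calculus applies. *)
Lemma primitive_ex h : continuous h ->
  exists P, forall x, is_derive x 1 P (h x).
Proof.
move=> ch.
have ih (c d : R) : (@lebesgue_measure R).-integrable `[c, d] (EFin \o h).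
  apply: continuous_compact_integrable; first exact: segment_compact.
  exact: continuous_subspaceT.
pose I c d := (\int[lebesgue_measure]_(t in `[c, d]) h t)%R.
have Isplit c d e : c <= d -> d <= e -> I c e = I c d + I d e.
  move=> cd de; apply/eqP; rewrite addrC -subr_eq; apply/eqP.
  rewrite /I Rintegral_itvB ?bnd_simp //.
  rewrite Rintegral_itv_obnd_cbnd //.
  by apply: integrableS (ih d e) => //; apply: subset_itvr; rewrite bnd_simp.
pose P x := I (- `|x| - 1) x - I (- `|x| - 1) 0.
exists P => x; pose m := - `|x| - 2.
have PE y : `|y| < `|x| + 1 -> P y = I m y - I m 0.
  move=> yx; have my : m <= - `|y| - 1 by rewrite /m; lra.
  have y1 : - `|y| - 1 <= y by have := ler_norm (- y); rewrite normrN; lra.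
  have y0 : - `|y| - 1 <= 0 by have := normr_ge0 y; lra.
  rewrite (Isplit _ _ _ my y1) (Isplit _ _ _ my y0).
  by rewrite /P opprD addrACA subrr add0r.
have xu : x < x + 1 by lra.
have mx : m < x by rewrite /m; have := ler_norm (- x); rewrite normrN; lra.
have [dI dIE] := continuous_FTC1_closed xu (ih m (x + 1)) mx (@ch x).
have H : is_derive x 1 (fun y => I m y - I m 0) (h x).
  apply: is_derive_congr (is_derive_subf _ (is_derive_constf _ _)) _; last exact: subr0.
  apply: is_derive_congr (derivableP dI) _; rewrite -derive1E; exact: dIE.
apply: near_eq_is_derive H; near=> y; rewrite PE //.
have : `|x - y| < 1 by near: y; exact: (nbhsx_ballx x 1 ltr01).
by have := ler_distD x y 0; rewrite !subr0 distrC; lra.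
Unshelve. all: by end_near. Qed.
Lemma continuous_segment_bound (f : R -> R) a b : a <= b -> continuous f ->
  exists2 M, 0 < M & forall x, a <= x <= b -> `|f x| <= M.
Proof.
move=> ab cf.
have [|c _ H] := @EVT_max R (fun x => f x ^+ 2) a b ab.
  by apply: continuous_subspaceT; exact: continuous_expf.
exists (1 + f c ^+ 2); first by rewrite ltr_pwDl ?sqr_ge0.
move=> x xab; have := H x; rewrite in_itv /= => /(_ xab) h1.
have : `|f x| <= 1 + f x ^+ 2.
  rewrite -(real_normK (num_real (f x))); have := sqr_ge0 (`|f x| - 1).
  have -> : (`|f x| - 1) ^+ 2 = `|f x| ^+ 2 - 2 * `|f x| + 1 by ring.
  by have := normr_ge0 (f x); lra.
lra.
Qed.

End RealDerivatives.

(** * Wirtinger's inequality for clamped functions *)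

Section Wirtinger.
Context {R : realType}.
Implicit Types (v dv P : R -> R) (x a b c m w : R).

(* The identity [v'^2 - w^2 v^2 = (v' + w v T)^2 - (w v^2 T)'] with
   [T x = tan (w (x - m))]. *)
Lemma tan_square_completion v dv P w m a b : a <= b ->
  (forall x, is_derive x 1 v (dv x)) ->
  (forall x, is_derive x 1 P (dv x ^+ 2 - w ^+ 2 * v x ^+ 2)) ->
  (forall x, a <= x <= b -> - (pi / 2) < w * (x - m) < pi / 2) ->
  P a + w * v a ^+ 2 * tan (w * (a - m)) <=
  P b + w * v b ^+ 2 * tan (w * (b - m)).
Proof.
move=> ab Hv HP Hw.
pose Q x := P x + w * v x ^+ 2 * tan (w * (x - m)).
apply: (@is_derive_ge0_le _ Q
  (fun x => (dv x + w * v x * tan (w * (x - m))) ^+ 2) a b ab) => x /Hw xw; last first.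
  exact: sqr_ge0.
have c0 : cos (w * (x - m)) != 0 by rewrite gt_eqF // cos_gt0_pihalf.
have dT : is_derive x 1 (fun t => tan (w * (t - m)))
    ((1 + tan (w * (x - m)) ^+ 2) * w).
  rewrite -cos2_tan2 //.
  exact: (@is_derive_compf _ tan (fun t => w * (t - m)) _ _ _ (is_derive_tan c0)
    (is_derive_affine w m x)).
apply: is_derive_congr (is_derive_addf (HP x) (is_derive_mulf (is_derive_scalef w (is_derive_expf 1 (Hv x))) dT)) _.
by rewrite expr1; ring.
Qed.

(** Here and below energies appear as increments of primitives, so that an inequality between
    integrals follows from the sign of a derivative. *)
Lemma wirtinger_clamped (f0 f1 f2 : R -> R) P w a b : 0 < w -> a < b ->
  w * (b - a) < 2 * pi ->
  (forall x, is_derive x 1 f0 (f1 x)) -> (forall x, is_derive x 1 f1 (f2 x)) ->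
  (forall x, is_derive x 1 P (f2 x ^+ 2 - w ^+ 2 * f1 x ^+ 2)) ->
  f0 a = 0 -> f1 a = 0 -> f0 b = 0 -> f1 b = 0 -> P a <= P b.
Proof.
move=> w0 ab wab H0 H1 HP f0a f1a f0b f1b.
pose h := (b - a) / 2.
have h0 : 0 < h by rewrite /h; lra.
have bE : b = a + 2 * h by rewrite /h; field.
have wh : w * h < pi by rewrite /h; lra.
pose k x := f1 (x + h) - f1 x.
have Hs x : is_derive x 1 (fun t : R => t + h) 1.
  by apply: is_derive_congr (is_derive_addf (is_derive_id x 1) (is_derive_constf h x)) _; rewrite addr0.
(* [f1] takes the same value [c] at some [p] and [p + h]. Between the zeros [p]
   and [p + h] of [f1 - c], taken cyclically, the tangents have no pole, and as
   [f1] has mean zero, replacing [f1] by [f1 - c] only increases the integral of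
   its square. *)
have ck : {within `[a, a + h], continuous k}.
  apply: (@is_derive_within_continuous R k (fun x => f2 (x + h) * 1 - f2 x)).
have [||p] := @IVT R k a (a + h) 0 _ ck; first by rewrite lerDl; exact: ltW.
  rewrite /k (_ : a + h + h = b); last by rewrite bE; ring.
  rewrite f1a f1b subr0 sub0r ge_min le_max oppr_le0 oppr_ge0.
  by case: (leP 0 (f1 (a + h))) => [_|/ltW ->]; rewrite ?orbT.
rewrite in_itv /= => /andP[ap ph] /eqP; rewrite subr_eq0 => /eqP pE.
pose c := f1 p; pose v x := f1 x - c.
(* [Q] is [P] with [f1] replaced by [f1 - c]. As [f0] vanishes at both ends, the increment of [Q]
   over [[a, b]] is that of [P] minus [w^2 c^2 (b - a)]. *)
pose Q x := P x + w ^+ 2 * (2 * c * f0 x - c ^+ 2 * (x - 0)).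
have Hv x : is_derive x 1 v (f2 x).
  by apply: is_derive_congr (is_derive_subf (H1 x) (is_derive_constf c x)) _; rewrite subr0.
have HQ x : is_derive x 1 Q (f2 x ^+ 2 - w ^+ 2 * v x ^+ 2).
  apply: is_derive_congr (is_derive_addf (HP x)
    (is_derive_scalef _ (is_derive_subf (is_derive_scalef _ (H0 x)) (is_derive_affine (c ^+ 2) 0 x)))) _.
  by rewrite /v; ring.
have vp : v p = 0 by rewrite /v subrr.
have vph : v (p + h) = 0 by rewrite /v pE subrr.
have va : v a = - c by rewrite /v f1a sub0r.
have vb : v b = - c by rewrite /v f1b sub0r.
have bnd x m : m - h / 2 <= x <= m + h / 2 -> - (pi / 2) < w * (x - m) < pi / 2.
  move=> /andP[mx xm].
  have : w * (x - m) <= w * (h / 2) by rewrite ler_pM2l //; lra.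
  have : w * (- (h / 2)) <= w * (x - m) by rewrite ler_pM2l //; lra.
  by move=> *; apply/andP; split; lra.
have I1 : Q a + w * v a ^+ 2 * tan (w * (a - (p - h / 2))) <=
    Q p + w * v p ^+ 2 * tan (w * (p - (p - h / 2))).
  apply: tan_square_completion ap Hv HQ _ => x /andP[? ?]; apply: bnd.
  by apply/andP; split; lra.
have I2 : Q p + w * v p ^+ 2 * tan (w * (p - (p + h / 2))) <=
    Q (p + h) + w * v (p + h) ^+ 2 * tan (w * (p + h - (p + h / 2))).
  have pph : p <= p + h by lra.
  apply: tan_square_completion pph Hv HQ _ => x /andP[? ?]; apply: bnd.
  by apply/andP; split; lra.
have I3 : Q (p + h) + w * v (p + h) ^+ 2 * tan (w * (p + h - (p + 3 * h / 2))) <=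
    Q b + w * v b ^+ 2 * tan (w * (b - (p + 3 * h / 2))).
  have phb : p + h <= b by rewrite bE; lra.
  apply: tan_square_completion phb Hv HQ _ => x /andP[? ?]; apply: bnd.
  by apply/andP; split; lra.
(* The cyclic interval from [p + h] to [p] is cut at [b] and resumed at [a]. The two tangents agree
   there, and so do [v a] and [v b], so the terms at the cut cancel. *)
rewrite (_ : b - (p + 3 * h / 2) = a - (p - h / 2)) in I3; last first.
  by rewrite bE; field.
rewrite vp expr0n /= mulr0 mul0r addr0 in I1 I2.
rewrite vph expr0n /= mulr0 mul0r addr0 in I2 I3.
rewrite va in I1; rewrite vb in I3.
have : Q a <= Q b by lra.
rewrite /Q f0a f0b.
have : 0 <= w ^+ 2 * (c ^+ 2 * (b - a)).
  apply: mulr_ge0 (sqr_ge0 w) (mulr_ge0 (sqr_ge0 c) _).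
  by rewrite subr_ge0 ltW.
lra.
Qed.

End Wirtinger.

(** * Weighted energies of successive derivatives *)

Section WeightedEnergy.
Context {R : realType}.
Implicit Types (x a b : R) (f : nat -> R -> R).

(* With [b_j] the weighted energy of [u_j], integration by parts gives
   [b_1^2 <= b_0 b_2] up to a boundary term and a term due to [W'], which the
   loss of [4 d] in the ratio absorbs. *)
Lemma energy_step (u0 u1 u2 W dW G0 G1 G2 : R -> R) (d t a b : R) :
  (forall x, is_derive x 1 u0 (u1 x)) -> (forall x, is_derive x 1 u1 (u2 x)) ->
  (forall x, is_derive x 1 W (dW x)) ->
  (forall x, is_derive x 1 G0 (u0 x ^+ 2 * W x)) ->
  (forall x, is_derive x 1 G1 (u1 x ^+ 2 * W x)) ->
  (forall x, is_derive x 1 G2 (u2 x ^+ 2 * W x)) ->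
  (forall x, 0 <= W x) -> (forall x, `|dW x| <= d * W x) ->
  0 < d -> 4 * d <= t -> a <= b ->
  t ^+ 2 * (G0 b - G0 a) <= G1 b - G1 a ->
  u0 b * u1 b * W b - u0 a * u1 a * W a <= d / t * (G1 b - G1 a) ->
  (t - 4 * d) ^+ 2 * (G1 b - G1 a) <= G2 b - G2 a.
Proof.
move=> H0 H1 HW HG0 HG1 HG2 W0 dWW d0 dt ab IH bd.
have t0 : 0 < t by lra.
(* In the derivative of [Q] the terms in [u1^2 W] from the product and from [G1] cancel. What is
   left is half the sum of [(t u0 + u2/t)^2 W] and of [2 u0 u1 W' + d W (t u0^2 + u1^2/t)]; the
   latter is nonnegative because [|W'| <= d W]. *)
pose Q x := u0 x * u1 x * W x +
  (t ^+ 2 / 2 * G0 x + t ^- 2 / 2 * G2 x + (d * t / 2 * G0 x + d / t / 2 * G1 x))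
  - G1 x.
have QQ : Q a <= Q b.
  apply: (@is_derive_ge0_le _ Q (fun x => (u0 x * u1 x * dW x +
      W x * (u0 x * u2 x + u1 x * u1 x)) +
    (t ^+ 2 / 2 * (u0 x ^+ 2 * W x) + t ^- 2 / 2 * (u2 x ^+ 2 * W x) +
     (d * t / 2 * (u0 x ^+ 2 * W x) + d / t / 2 * (u1 x ^+ 2 * W x))) -
    u1 x ^+ 2 * W x) a b ab) => x _.
    exact: is_derive_subf (is_derive_addf (is_derive_mulf (is_derive_mulf (H0 x) (H1 x)) (HW x))
      (is_derive_addf (is_derive_addf (is_derive_scalef _ (HG0 x)) (is_derive_scalef _ (HG2 x)))
            (is_derive_addf (is_derive_scalef _ (HG0 x)) (is_derive_scalef _ (HG1 x))))) (HG1 x).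
  have e1 : 0 <= (t * u0 x + t^-1 * u2 x) ^+ 2 * W x.
    by rewrite mulr_ge0 ?sqr_ge0.
  have e2 : - (d * W x * (t * u0 x ^+ 2 + t^-1 * u1 x ^+ 2)) <=
      2 * (u0 x * u1 x * dW x).
    have : `|2 * (u0 x * u1 x * dW x)| <= d * W x * (t * u0 x ^+ 2 + t^-1 * u1 x ^+ 2).
      have -> : 2 * (u0 x * u1 x * dW x) = dW x * (2 * (u0 x * u1 x)) by ring.
      rewrite normrM; apply: ler_pM => //.
      have <- : `|u0 x| ^+ 2 = u0 x ^+ 2 by rewrite real_normK ?num_real.
      have <- : `|u1 x| ^+ 2 = u1 x ^+ 2 by rewrite real_normK ?num_real.
      rewrite !normrM ger0_norm // -subr_ge0.
      have -> : t * `|u0 x| ^+ 2 + t^-1 * `|u1 x| ^+ 2 - 2 * (`|u0 x| * `|u1 x|)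
          = t^-1 * (t * `|u0 x| - `|u1 x|) ^+ 2 by field; rewrite gt_eqF.
      by rewrite mulr_ge0 ?sqr_ge0 // invr_ge0 ltW.
    by rewrite ler_norml => /andP[].
  have -> : u0 x * u1 x * dW x + W x * (u0 x * u2 x + u1 x * u1 x) +
    (t ^+ 2 / 2 * (u0 x ^+ 2 * W x) + t ^- 2 / 2 * (u2 x ^+ 2 * W x) +
     (d * t / 2 * (u0 x ^+ 2 * W x) + d / t / 2 * (u1 x ^+ 2 * W x))) -
    u1 x ^+ 2 * W x = 2^-1 * ((t * u0 x + t^-1 * u2 x) ^+ 2 * W x +
     (2 * (u0 x * u1 x * dW x) +
       d * W x * (t * u0 x ^+ 2 + t^-1 * u1 x ^+ 2))) by field; rewrite gt_eqF.
  by rewrite mulr_ge0 //; lra.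
move: bd IH QQ; rewrite /Q.
set b0 := G0 b - G0 a; set b1 := G1 b - G1 a; set b2 := G2 b - G2 a.
set E := u0 b * u1 b * W b - u0 a * u1 a * W a => bd IH QQ.
have b1_0 : 0 <= b1.
  rewrite subr_ge0; apply: (is_derive_ge0_le ab) (fun x _ => HG1 x) _ => x _.
  by rewrite mulr_ge0 ?sqr_ge0.
have {}QQ : b1 <= E + (t ^+ 2 / 2 * b0 + t ^- 2 / 2 * b2 +
    (d * t / 2 * b0 + d / t / 2 * b1)) by rewrite /E /b0 /b1 /b2; lra.
(* The 4: the boundary term costs [d/t], the two terms due to [W'] cost [d/(2t)] each, and all is
   doubled when solving for [b2]. *)
have key : t ^+ 2 * (1 - 4 * d / t) * b1 <= b2.
  have h1 : d / t * (t ^+ 2 * b0) <= d / t * b1 by rewrite ler_wpM2l // divr_ge0 ?ltW.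
  have h2 : d * t / 2 * b0 = 2^-1 * (d / t * (t ^+ 2 * b0)) by field; rewrite gt_eqF.
  have h3 : (1 - 4 * d / t) * b1 <= t ^- 2 * b2.
    move: h1 h2 QQ bd; rewrite -!mulrA; lra.
  have -> : b2 = t ^+ 2 * (t ^- 2 * b2) by field; rewrite gt_eqF.
  by rewrite -mulrA ler_pM2l // exprn_gt0.
apply: le_trans key; apply: ler_wpM2r => //.
rewrite -subr_ge0.
have -> : t ^+ 2 * (1 - 4 * d / t) - (t - 4 * d) ^+ 2 = 4 * d * (t - 4 * d).
  by field; rewrite gt_eqF.
by rewrite mulr_ge0 // ?subr_ge0 //; lra.
Qed.

End WeightedEnergy.

(** * The Lorentzian weight and its slow variation *)

Section LorentzWeight.
Context {R : realType}.
Implicit Types (x y a b d : R) (f : nat -> R -> R).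

(** This weight has finite mass [pi/d], logarithmic derivative at most [d], and decay that makes
    boundary terms of bounded functions vanish at infinity. *)
Definition lorentz (d x : R) : R := (1 + (d * x) ^+ 2)^-1.
Definition dlorentz (d x : R) : R := - 2 * d * (d * x) * lorentz d x ^+ 2.

Lemma lorentz_den_gt0 d x : 0 < 1 + (d * x) ^+ 2.
Proof. by rewrite ltr_pwDl ?ltr01 ?sqr_ge0. Qed.

Lemma lorentz_gt0 d x : 0 < lorentz d x.
Proof. by rewrite invr_gt0 lorentz_den_gt0. Qed.

Lemma is_derive_lorentz d x : is_derive x 1 (lorentz d) (dlorentz d x).
Proof.
have n0 : 1 + (d * (x - 0)) ^+ 2 != 0 by rewrite subr0 gt_eqF // lorentz_den_gt0.
have H := @is_derive_invf _ (fun t => 1 + (d * (t - 0)) ^+ 2) x _ n0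
  (is_derive_addf (is_derive_constf 1 x) (is_derive_expf 1 (is_derive_affine d 0 x))).
have -> : lorentz d = fun t => (1 + (d * (t - 0)) ^+ 2)^-1.
  by apply/funext => t; rewrite /lorentz subr0.
apply: is_derive_congr H _; rewrite /dlorentz /lorentz subr0 exprVn expr1.
by rewrite add0r; ring.
Qed.

Lemma dlorentz_le d x : 0 < d -> `|dlorentz d x| <= d * lorentz d x.
Proof.
move=> d0; have l0 := lorentz_gt0 d x.
rewrite /dlorentz normrM (ger0_norm (sqr_ge0 _)) expr2 mulrA ler_pM2r //.
rewrite -ler_pdivlMr // /lorentz invrK !normrM normrN normr_nat (gtr0_norm d0).
have := sqr_ge0 (1 - d * `|x|).
have : `|x| ^+ 2 = x ^+ 2 by rewrite real_normK ?num_real.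
rewrite exprMn => <- ?.
rewrite -subr_ge0.
have -> : d * (1 + d ^+ 2 * `|x| ^+ 2) - 2 * d * (d * `|x|) =
  d * (1 - d * `|x|) ^+ 2 by ring.
by rewrite mulr_ge0 // ltW.
Qed.

(** With [u = d y], [h = d (x - y)] and [T = d D], the cross term [2 u h] of [(u + h)^2] is at most
    [(1 + u^2) T]. *)
Lemma lorentz_ratio d D x y : 0 < d -> `|x - y| <= D ->
  lorentz d y <= (1 + (d * D + (d * D) ^+ 2)) * lorentz d x.
Proof.
move=> d0 xyD; rewrite /lorentz ler_pdivlMr ?lorentz_den_gt0 //.
rewrite mulrC ler_pdivrMr ?lorentz_den_gt0 //.
have D0 : 0 <= D := le_trans (normr_ge0 _) xyD.
pose u := d * y; pose h := d * (x - y).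
have -> : d * x = u + h by rewrite /u /h; ring.
rewrite -/u; set T := d * D.
have hT : `|h| <= T by rewrite /h /T normrM gtr0_norm // ler_pM2l.
have T0 : 0 <= T := le_trans (normr_ge0 _) hT.
have h2 : h ^+ 2 <= T ^+ 2 by rewrite -(real_normK (num_real h)) ler_sqr ?nnegrE.
have uh : 2 * u * h <= (1 + u ^+ 2) * T.
  have : 2 * u * h <= 2 * `|u| * `|h|.
    by rewrite (le_trans (ler_norm _)) // !normrM normr_nat.
  move=> /le_trans; apply.
  apply: le_trans (_ : 2 * `|u| * T <= _); first by rewrite ler_wpM2l // mulr_ge0.
  rewrite ler_wpM2r //; have := sqr_ge0 (1 - `|u|).
  rewrite -(real_normK (num_real u)).
  have -> : (1 - `|u|) ^+ 2 = 1 - 2 * `|u| + `|u| ^+ 2 by ring.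
  lra.
have : 0 <= u ^+ 2 * T ^+ 2 by rewrite mulr_ge0 ?sqr_ge0.
have : 0 <= T * u ^+ 2 by rewrite mulr_ge0 ?sqr_ge0.
have -> : 1 + (u + h) ^+ 2 = 1 + u ^+ 2 + 2 * u * h + h ^+ 2 by ring.
have -> : (1 + (T + T ^+ 2)) * (1 + u ^+ 2) =
  (1 + u ^+ 2) * T + 1 + u ^+ 2 + T ^+ 2 + u ^+ 2 * T ^+ 2 by ring.
lra.
Qed.

(** The weight is frozen on the gap: it lies between [k] and [k th^2], where [k] is its value at [a]
    divided by [th]. Passing from the unweighted inequality to the weighted one therefore costs a
    factor [th] in the ratio, and [th] tends to 1 with [d]. *)
Lemma wirtinger_weighted (f0 f1 f2 : R -> R) P d w D a b :
  0 < w -> 0 < d -> a < b -> b - a <= D -> w * D < 2 * pi ->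
  continuous f2 ->
  (forall x, is_derive x 1 f0 (f1 x)) -> (forall x, is_derive x 1 f1 (f2 x)) ->
  let t := w / (1 + (d * D + (d * D) ^+ 2)) in
  (forall x, is_derive x 1 P ((f2 x ^+ 2 - t ^+ 2 * f1 x ^+ 2) * lorentz d x)) ->
  f0 a = 0 -> f1 a = 0 -> f0 b = 0 -> f1 b = 0 -> P a <= P b.
Proof.
move=> w0 d0 ab abD wD c2 H0 H1 t HP f0a f1a f0b f1b.
have D0 : 0 < D by rewrite (lt_le_trans _ abD) // subr_gt0.
set th := 1 + (d * D + (d * D) ^+ 2) in t HP *.
have th0 : 0 < th by rewrite addr_gt0 // addr_gt0 ?mulr_gt0 ?exprn_gt0 // mulr_gt0.
have c1 := is_derive_continuous H1.
have [|P0 HP0] := @primitive_ex _ (fun x => f2 x ^+ 2 - w ^+ 2 * f1 x ^+ 2).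
  by apply: continuous_subf; [exact: continuous_expf|apply: continuous_scalef; exact: continuous_expf].
have I0 : P0 a <= P0 b.
  apply: (@wirtinger_clamped _ f0 f1 f2 P0 w) => //.
  by rewrite (le_lt_trans _ wD) // ler_pM2l.
pose k := lorentz d a / th.
have k0 : 0 < k by rewrite divr_gt0 // lorentz_gt0.
pose Q x := P x - k * P0 x.
suff : Q a <= Q b.
  have : k * P0 a <= k * P0 b by rewrite ler_pM2l.
  by rewrite /Q; lra.
apply: (is_derive_ge0_le (ltW ab)
  (fun x _ => is_derive_subf (HP x) (is_derive_scalef k (HP0 x)))) => x /andP[ax xb].
have xaD : `|x - a| <= D by rewrite ger0_norm; lra.
have axD : `|a - x| <= D by rewrite distrC.
have L1 : k <= lorentz d x by rewrite /k ler_pdivrMr // mulrC lorentz_ratio.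
have L2 : lorentz d x <= k * th ^+ 2.
  by rewrite /k expr2 mulrA divfK ?gt_eqF // mulrC lorentz_ratio.
have s2 := sqr_ge0 (f2 x); have s1 := sqr_ge0 (t * f1 x).
have e2 : k * f2 x ^+ 2 <= lorentz d x * f2 x ^+ 2 by rewrite ler_wpM2r.
have e1 : lorentz d x * (t * f1 x) ^+ 2 <= k * th ^+ 2 * (t * f1 x) ^+ 2.
  by rewrite ler_wpM2r.
have -> : (f2 x ^+ 2 - t ^+ 2 * f1 x ^+ 2) * lorentz d x =
  lorentz d x * f2 x ^+ 2 - lorentz d x * (t * f1 x) ^+ 2 by ring.
have -> : k * (f2 x ^+ 2 - w ^+ 2 * f1 x ^+ 2) =
  k * f2 x ^+ 2 - k * th ^+ 2 * (t * f1 x) ^+ 2.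
  by rewrite /t; field; rewrite gt_eqF.
lra.
Qed.

End LorentzWeight.

(** * Vanishing of functions with frequent double zeros and geometrically bounded derivatives *)

Section ClampedVanishing.
Context {R : realType}.
Implicit Types (x y a b d : R) (f : nat -> R -> R).

(** [K] is nondecreasing; if its end values agreed it would be constant around [x0], where its
    derivative is not 0. *)
Lemma primitive_sqr_gt0 (u v : R -> R) x0 : continuous u ->
  (forall x, 0 < v x) -> u x0 != 0 ->
  forall K, (forall x, is_derive x 1 K (u x ^+ 2 * v x)) ->
  K (x0 - 1) < K (x0 + 1).
Proof.
move=> cu v0 ux0 K HK.
have mono a b : a <= b -> K a <= K b.
  move=> ab; apply: (is_derive_ge0_le ab (fun x _ => HK x)) => x _.
  by rewrite mulr_ge0 ?sqr_ge0 // ltW.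
rewrite lt_neqAle mono ?andbT; last by lra.
apply/eqP => KE.
have : u x0 ^+ 2 * v x0 = 0.
  apply: is_derive_unique (HK x0) _.
  apply: near_eq_is_derive (is_derive_constf (K (x0 - 1)) x0); near=> y.
  have : `|x0 - y| < 1 by near: y; exact: (nbhsx_ballx x0 1 ltr01).
  rewrite ltr_norml => /andP[? ?].
  by apply/eqP; rewrite eq_le mono ?KE ?mono //; lra.
move/eqP; rewrite mulf_eq0 expf_eq0 /= (negPf ux0) /= => /eqP v00.
by have := v0 x0; rewrite v00 ltxx.
Unshelve. all: by end_near. Qed.

(** Bernoulli's inequality [q^n >= n (q - 1)], squared, already gives quadratic growth. *)
Lemma expr_beats_linear (q M : R) : 1 < q -> 0 <= M ->
  exists n : nat, M * n.+1%:R < (q ^+ 2) ^+ n.+1.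
Proof.
move=> q1 M0; have q0 : 0 < q - 1 by rewrite subr_gt0.
have bern n : n%:R * (q - 1) <= q ^+ n.
  elim: n => [|n IH]; first by rewrite mul0r expr0 ler01.
  have qn1 : 1 <= q ^+ n by rewrite exprn_ege1 // ltW.
  rewrite exprS -natr1 mulrDl mul1r.
  have -> : q * q ^+ n = q ^+ n + (q - 1) * q ^+ n by ring.
  by apply: lerD => //; rewrite ler_peMr // ltW.
have [n nE] : exists n : nat, M / (q - 1) ^+ 2 < n%:R.
  exists (Num.bound (M / (q - 1) ^+ 2)).
  by rewrite archi_boundP // divr_ge0 ?sqr_ge0.
exists n; rewrite -exprM mulnC exprM.
have n1 : n%:R < n.+1%:R :> R by rewrite ltr_nat.
apply: lt_le_trans (_ : (n.+1%:R * (q - 1)) ^+ 2 <= _); last first.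
  by rewrite lerXn2r ?nnegrE ?mulr_ge0 ?exprn_ge0 ?bern ?(ltW q0) //; lra.
have -> : (n.+1%:R * (q - 1)) ^+ 2 = n.+1%:R * (q - 1) ^+ 2 * n.+1%:R by ring.
by rewrite ltr_pM2r ?ltr0n // -ltr_pdivrMr ?exprn_gt0 // (lt_trans nE).
Qed.

(** Comparison with the primitive [C/d atan (d x)] of the weight times [C], whose total increase is
    [C pi/d]. This caps every energy independently of the interval. *)
Lemma lorentz_mass (d C : R) (G : R -> R) (u : R -> R) a b : 0 < d -> 0 <= C ->
  a <= b -> (forall x, u x ^+ 2 <= C) ->
  (forall x, is_derive x 1 G (u x ^+ 2 * lorentz d x)) ->
  G b - G a <= C * (pi / d).
Proof.
move=> d0 C0 ab uC HG.
have HA x : is_derive x 1 (fun t => C / d * atan (d * (t - 0))) (C * lorentz d x).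
  have H := @is_derive_compf _ atan (fun t => d * (t - 0)) x _ _
    (is_derive1_atan _) (is_derive_affine d 0 x).
  apply: is_derive_congr (is_derive_scalef (C / d) H) _; rewrite /lorentz subr0.
  by field; rewrite !gt_eqF // lorentz_den_gt0.
have := is_derive_ge0_le ab (fun x _ => is_derive_subf (HA x) (HG x)).
move=> /(_ (fun x _ => ltac:(by rewrite -mulrBl mulr_ge0 ?subr_ge0 // ltW // lorentz_gt0))).
have := atan_gtNpi2 (d * (a - 0)); have := atan_ltpi2 (d * (b - 0)).
set A := atan _; set B := atan _ => h1 h2 h3.
have : C / d * (A - B) <= C / d * pi.
  by rewrite ler_wpM2l ?divr_ge0 ?(ltW d0) //; lra.
have -> : C * (pi / d) = C / d * pi by rewrite mulrA mulrAC.
lra.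
Qed.

Lemma lorentz_tail (d X y : R) : 0 < d -> X <= d * `|y| -> X * lorentz d y <= 1.
Proof.
move=> d0 XN; rewrite /lorentz ler_pdivrMr ?lorentz_den_gt0 // mul1r.
apply: le_trans XN _; rewrite -[(d * y) ^+ 2]real_normK ?num_real //.
rewrite normrM (gtr0_norm d0); set z := d * _.
have := sqr_ge0 (z - 1); have : 0 <= z by rewrite mulr_ge0 // ltW.
have -> : (z - 1) ^+ 2 = z ^+ 2 - 2 * z + 1 by ring.
by move=> *; nra.
Qed.

(** The product of the two derivatives is at most [C^2 s (s^2)^(k+1)], and the allowance grows like
    [(r^2)^(k+1)] with [r > s]. Hence the threshold on [|y|] is free of [k], and one pair of end
    points serves every step of the ladder. *)
Lemma lorentz_boundary f (C s r t d be : R) k y : 0 < s -> s < r -> 0 < t ->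
  0 < d -> 0 < be -> (forall n x, `|f n x| <= C * s ^+ n) ->
  2 * C ^+ 2 * s * t / (d * be) <= d * `|y| ->
  2 * `|f k.+1 y * f k.+2 y * lorentz d y| <= d / t * ((r ^+ 2) ^+ k.+1 * be).
Proof.
move=> s0 sr t0 d0 be0 fC Ny; have L0 := lorentz_gt0 d y.
rewrite !normrM (gtr0_norm L0).
apply: le_trans (_ : 2 * (C * s ^+ k.+1 * (C * s ^+ k.+2) * lorentz d y) <= _).
  by rewrite ler_pM2l // ler_wpM2r ?(ltW L0) // ler_pM.
have -> : 2 * (C * s ^+ k.+1 * (C * s ^+ k.+2) * lorentz d y) =
    (2 * C ^+ 2 * s * t / (d * be) * lorentz d y) * (d / t * ((s ^+ 2) ^+ k.+1 * be)).
  rewrite -exprM mulnC exprM !exprS; field.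
  by rewrite !gt_eqF.
apply: le_trans (_ : 1 * (d / t * ((s ^+ 2) ^+ k.+1 * be)) <= _).
  rewrite ler_wpM2r ?lorentz_tail // mulr_ge0 ?divr_ge0 ?mulr_ge0 //;
  by rewrite ?exprn_ge0 ?sqr_ge0 // ltW.
rewrite mul1r ler_pM2l ?divr_gt0 // ler_pM2r //.
rewrite lerXn2r ?nnegrE ?sqr_ge0 // lerXn2r ?nnegrE ?(ltW sr) ?(ltW s0) //.
exact: ltW (lt_trans s0 sr).
Qed.

(* The ratio [tk k = t - 4 d k] of consecutive energies loses [4 d] at each
   application of [energy_step] and stays at least [r] for [n + 1] steps. *)
Lemma energy_ladder f (G : nat -> R -> R) (r t d be : R) a b n :
  0 < r -> 0 < d -> 0 < be -> a <= b -> r + 4 * d * n.+1%:R <= t ->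
  (forall n x, is_derive x 1 (f n) (f n.+1 x)) ->
  (forall n x, is_derive x 1 (G n) (f n x ^+ 2 * lorentz d x)) ->
  (forall k y, y = a \/ y = b ->
     2 * `|f k.+1 y * f k.+2 y * lorentz d y| <= d / t * ((r ^+ 2) ^+ k.+1 * be)) ->
  be <= G 1%N b - G 1%N a ->
  t ^+ 2 * (G 1%N b - G 1%N a) <= G 2%N b - G 2%N a ->
  (r ^+ 2) ^+ n.+1 * be <= G n.+2 b - G n.+2 a.
Proof.
move=> r0 d0 be0 ab rt Hf HG bd B1 B2.
pose tk (k : nat) := t - 4 * d * k%:R.
have tkr k : (k <= n.+1)%N -> r <= tk k.
  move=> kn; have : 4 * d * k%:R <= 4 * d * n.+1%:R by rewrite ler_pM2l ?ler_nat // mulr_gt0.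
  by rewrite /tk; lra.
have tkt k : tk k <= t by rewrite lerBlDr lerDl !mulr_ge0 // ltW.
have tkS k : tk k.+1 = tk k - 4 * d by rewrite /tk -natr1; ring.
have tk0 : tk 0%N = t by rewrite /tk mulr0 subr0.
clearbody tk.
(* The lower bound on the energy is carried along with the ratio, since it is what dominates the
   boundary terms of the next step. *)
suff main k : (k <= n.+1)%N -> tk k ^+ 2 * (G k.+1 b - G k.+1 a) <= G k.+2 b - G k.+2 a /\
    (r ^+ 2) ^+ k * be <= G k.+1 b - G k.+1 a by have [] := main _ (leqnn _).
elim: k => [_|k IH kn]; first by rewrite expr0 mul1r tk0.
have [IH1 IH2] := IH (ltnW kn).
have rt0 := tkr _ (ltnW kn); have rt1 := tkr _ kn; have tt := tkt k.
have H2 : (r ^+ 2) ^+ k.+1 * be <= G k.+2 b - G k.+2 a.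
  apply: le_trans IH1; rewrite exprS -mulrA; apply: ler_pM => //.
  - exact: sqr_ge0.
  - by rewrite mulr_ge0 ?exprn_ge0 ?sqr_ge0 // ltW.
  - by rewrite ler_sqr ?nnegrE //; lra.
split=> //; rewrite tkS.
apply: (@energy_step _ (f k.+1) (f k.+2) (f k.+3) (lorentz d) (dlorentz d)
  (G k.+1) (G k.+2) (G k.+3) d (tk k) a b) => //.
- by move=> y; exact: is_derive_lorentz.
- by move=> y; rewrite ltW // lorentz_gt0.
- by move=> y; exact: dlorentz_le.
- by move: rt1; rewrite tkS; lra.
have {}bd y : y = a \/ y = b ->
    2 * `|f k.+1 y * f k.+2 y * lorentz d y| <= d / tk k * (G k.+2 b - G k.+2 a).
  move=> /(bd k) /le_trans; apply; apply: ler_pM => //.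
  - by rewrite divr_ge0 ?(ltW d0) //; lra.
  - by rewrite mulr_ge0 ?exprn_ge0 ?sqr_ge0 // ltW.
  - by rewrite ler_pM2l // lef_pV2 ?posrE //; lra.
have bA := bd a (or_introl erefl); have bB := bd b (or_intror erefl).
have := ler_norm (f k.+1 b * f k.+2 b * lorentz d b).
have := ler_norm (- (f k.+1 a * f k.+2 a * lorentz d a)); rewrite normrN.
lra.
Qed.

(** [d] is taken as a fixed [ka] divided by [n + 1]: the total loss [4 d (n + 1)] is then [4 ka] for
    every [n], while [M/d] is linear in [n] and is beaten by the powers of [r/s]. *)
Lemma ladder_parameters (s r w D M : R) : 0 < s -> s < r -> r < w -> 0 < D ->
  0 <= M -> exists (n : nat) (d : R), [/\ 0 < d, d <= 1,
    r + 4 * d * n.+1%:R <= w / (1 + (d * D + (d * D) ^+ 2)) &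
    M / d * (s ^+ 2) ^+ n.+1 < (r ^+ 2) ^+ n.+1].
Proof.
move=> s0 sr rw D0 M0.
(* With [e = d D + (d D)^2 <= ka q], the aim [(r + 4 ka) (1 + e) <= w] follows from
   [4 ka + ka w q <= w - r]. The coefficients 8 and [2 w q] ask for twice that, which also yields
   [r + 4 ka <= w]; the summand [rho] makes [ka <= 1]. *)
pose rho := w - r; pose q := D + D ^+ 2; pose den := rho + 8 + 2 * w * q.
have q0 : 0 < q by rewrite addr_gt0 // exprn_gt0.
have w0 : 0 < w by lra.
have rho0 : 0 < rho by rewrite subr_gt0.
have wq0 : 0 < w * q by rewrite mulr_gt0.
have den0 : 0 < den by rewrite /den; lra.
pose ka := rho / den.
have ka0 : 0 < ka by rewrite divr_gt0.
have kaden : ka * den = rho by rewrite divfK ?gt_eqF.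
have karho : ka * rho + 8 * ka + 2 * (ka * (w * q)) = rho by rewrite -{2}kaden /den; ring.
have ka8 : 8 * ka + 2 * (ka * (w * q)) <= w - r.
  by have := mulr_gt0 ka0 rho0; move: karho; rewrite {2}/rho; lra.
have kq0 : 0 < ka * (w * q) by rewrite mulr_gt0.
have ka1 : ka <= 1 by rewrite ler_pdivrMr // /den; lra.
have q1 : 1 < r / s by rewrite ltr_pdivlMr // mul1r.
have [n nM] := expr_beats_linear q1 (divr_ge0 M0 (ltW ka0)).
have n0 : 0 < n.+1%:R :> R by rewrite ltr0n.
have n1 : 1 <= n.+1%:R :> R by rewrite ler1n.
exists n, (ka / n.+1%:R); set d := ka / _.
have d0 : 0 < d by rewrite divr_gt0.
have dn : d * n.+1%:R = ka by rewrite divfK ?gt_eqF.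
have dka : d <= ka by rewrite ler_pdivrMr // ler_peMr // ltW.
have d1 : d <= 1 := le_trans dka ka1.
split=> //.
  set e := d * D + _.
  have e0 : 0 <= e by rewrite addr_ge0 ?sqr_ge0 // mulr_ge0 // ltW.
  have ekq : e <= ka * q.
    rewrite /e /q mulrDr; apply: lerD; first by rewrite ler_pM2r.
    rewrite exprMn ler_pM2r ?exprn_gt0 // expr2.
    by apply: le_trans dka; rewrite ger_pMl.
  have we : w * e <= ka * (w * q) by rewrite mulrCA ler_pM2l.
  rewrite -mulrA dn ler_pdivlMr; last by lra.
  have : (r + 4 * ka) * e <= w * e by rewrite ler_wpM2r //; clear -ka8 kq0 ka0; lra.
  by clear -ka8 we rw; lra.
have -> : M / d = M / ka * n.+1%:R by rewrite -dn; field; rewrite !gt_eqF.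
by rewrite -ltr_pdivlMr ?exprn_gt0 // -!exprM -expr_div_n exprM.
Qed.

Theorem clamped_vanish f (C s D e : R) : 0 < s -> 0 < e ->
  s * D < 2 * pi ->
  (forall n x, is_derive x 1 (f n) (f n.+1 x)) ->
  (forall n x, `|f n x| <= C * s ^+ n) ->
  (forall x, exists y, [/\ x + e < y, y < x + D, f 0%N y = 0 & f 1%N y = 0]) ->
  forall x, f 0%N x = 0.
Proof.
move=> s0 e0 sD Hf fC nodes.
suff f1 x : f 1%N x = 0.
  move=> x; have [y [_ _ fy _]] := nodes x.
  rewrite -fy; have K : forall x y, x <= y -> f 0%N x = f 0%N y.
    move=> a b ab; have [c _] := mean_value ab (fun x _ => Hf 0%N x).
    by rewrite f1 mul0r => /eqP; rewrite subr_eq0 => /eqP.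
  by case: (leP x y) => [/K //|/ltW /K ->].
apply/eqP/negPn/negP => fx.
have D0 : 0 < D by have [y [? ? _ _]] := nodes 0; lra.
have cf n : continuous (f n) := is_derive_continuous (Hf n).
have [w [sw wD]] : exists w, s < w /\ w * D < 2 * pi.
  exists ((s + 2 * pi / D) / 2); have : s < 2 * pi / D by rewrite ltr_pdivlMr.
  split; first by lra.
  by rewrite mulrAC ltr_pdivrMr // mulrDl divfK ?gt_eqF //; lra.
have [r [sr rw]] : exists r, s < r /\ r < w by exists ((s + w) / 2); split; lra.
have w0 := lt_trans s0 (lt_trans sr rw); have r0 := lt_trans s0 sr.
have cl d n : continuous (fun x => f n x ^+ 2 * lorentz d x).
  by apply: continuous_mulf; [exact: continuous_expf|exact: is_derive_continuous (is_derive_lorentz d)].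
(* The weight with parameter 1 lies below every weight with [d <= 1], so the mass [be] obtained here
   bounds the first energy from below before [d] is chosen. *)
have [K HK] := primitive_ex (cl 1 1%N).
have : K (x - 1) < K (x + 1) := primitive_sqr_gt0 (cf 1%N) (lorentz_gt0 1) fx HK.
rewrite -subr_gt0; move: {2}(K (x + 1) - K (x - 1)) (erefl (K (x + 1) - K (x - 1))) => be beE.
rewrite beE => be0.
(* This value of [M] turns [ladder_parameters] into a comparison of the cap [C^2 (s^2)^(n+2) pi/d]
   with the lower bound [(r^2)^(n+1) be] for the same energy. *)
have M0 : 0 <= C ^+ 2 * s ^+ 2 * pi / be.
  exact: divr_ge0 (mulr_ge0 (mulr_ge0 (sqr_ge0 C) (sqr_ge0 s)) (pi_ge0 R)) (ltW be0).
have [n [d [d0 d1]]] := ladder_parameters s0 sr rw D0 M0.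
move tE : (w / (1 + (d * D + (d * D) ^+ 2))) => t rt nM.
have t0 : 0 < t.
  by apply: lt_le_trans rt; rewrite addr_gt0 // !mulr_gt0.
have /choice [G HG] : forall k, exists G : R -> R,
    forall x, is_derive x 1 G (f k x ^+ 2 * lorentz d x).
  by move=> k; exact: primitive_ex.
(* Beyond [N] all boundary terms are small, and an interval reaching from [-N] to [N] contains
   [[x - 1, x + 1]], where [be] was measured. *)
have [N [Nx WN]] : exists N, `|x| + 1 <= N /\
    forall y, N <= `|y| -> 2 * C ^+ 2 * s * t / (d * be) <= d * `|y|.
  set X := 2 * C ^+ 2 * s * t / (d * be).
  have X0 : 0 <= X.
    apply: divr_ge0 (ltW (mulr_gt0 d0 be0)).
    exact: mulr_ge0 (mulr_ge0 (mulr_ge0 (ler0n _ 2) (sqr_ge0 C)) (ltW s0)) (ltW t0).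
  exists (X / d + `|x| + 1); split; first by rewrite -addrA lerDr divr_ge0 // ltW.
  move=> y Ny; rewrite mulrC -ler_pdivrMr //; apply: le_trans Ny.
  by rewrite -addrA lerDl addr_ge0.
have x0 := normr_ge0 x; have xl := ler_norm x; have xl' := ler_norm (- x).
rewrite normrN in xl'.
have N0 : 0 < N by clear -x0 Nx; lra.
have [A [_ AN fA0 fA1]] := nodes (- N - D).
have {}AN : A < - N by clear -AN; lra.
pose P (y : R) := G 2%N y - t ^+ 2 * G 1%N y.
have HP : forall z : R, is_derive z 1 P
    ((f 2%N z ^+ 2 - t ^+ 2 * f 1%N z ^+ 2) * lorentz d z).
  move=> z; apply: is_derive_congr (is_derive_subf (HG 2%N z) (is_derive_scalef (t ^+ 2) (HG 1%N z))) _.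
  by ring.
(* A walk from node to node: each move gains more than [e], so finitely many of them pass [N], and
   the inequalities on the gaps add up. *)
have chain k : exists y, [/\ A + k%:R * e <= y, f 0%N y = 0, f 1%N y = 0 & P A <= P y].
  elim: k => [|k [y [Ay fy0 fy1 Py]]]; first by exists A; rewrite mul0r addr0.
  have [z [yz zD fz0 fz1]] := nodes y.
  exists z; split=> //; first by rewrite -natr1 mulrDl mul1r; clear -Ay yz; lra.
  apply: le_trans Py _; rewrite -tE in HP.
  by apply: (@wirtinger_weighted _ (f 0%N) (f 1%N) (f 2%N) P d w D) => //;
    clear -yz zD e0; lra.
have [B [NB fB0 fB1 PAB]] : exists y, [/\ N <= y, f 0%N y = 0, f 1%N y = 0 & P A <= P y].
  have [y [Ay fy0 fy1 Py]] := chain (Num.bound ((N - A) / e)).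
  exists y; split=> //; apply: le_trans Ay.
  rewrite addrC -lerBlDr -ler_pdivrMr //; apply/ltW/archi_boundP.
  by rewrite divr_ge0 ?(ltW e0) //; clear -AN N0; lra.
have AleB : A <= B by clear -AN N0 NB; lra.
have B1be : be <= G 1%N B - G 1%N A.
  have mono a b : a <= b -> G 1%N a <= G 1%N b.
    move=> ab; apply: (is_derive_ge0_le ab (fun x _ => HG 1%N x)) => y _.
    by rewrite mulr_ge0 ?sqr_ge0 // ltW // lorentz_gt0.
  have xx : x - 1 <= x + 1 by clear; lra.
  have := is_derive_ge0_le xx (fun x _ => is_derive_subf (HG 1%N x) (HK x)).
  have dl y : 0 <= f 1%N y ^+ 2 * lorentz d y - f 1%N y ^+ 2 * lorentz 1 y.
    rewrite -mulrBr mulr_ge0 ?sqr_ge0 // subr_ge0 /lorentz.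
    rewrite lef_pV2 ?posrE ?lorentz_den_gt0 // lerD2l mul1r exprMn.
    by apply: ler_piMl; [exact: sqr_ge0|apply: exprn_ile1 => //; exact: ltW].
  move=> /(_ (fun y _ => dl y)).
  have Ax : G 1%N A <= G 1%N (x - 1) by apply: mono; clear -xl' Nx AN; lra.
  have Bx : G 1%N (x + 1) <= G 1%N B by apply: mono; clear -xl Nx NB; lra.
  by clear -Ax Bx beE; lra.
have Hlow : (r ^+ 2) ^+ n.+1 * be <= G n.+2 B - G n.+2 A.
  apply: (@energy_ladder f G r t d) => //; last by clear -PAB; rewrite /P in PAB; lra.
  move=> k y AB; apply: (lorentz_boundary k s0 sr t0 d0 be0 fC (WN y _)).
  case: AB => ->; first by rewrite ltr0_norm; clear -AN N0; lra.
  by rewrite ger0_norm //; clear -NB N0; lra.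
have Cf y : f n.+2 y ^+ 2 <= C ^+ 2 * (s ^+ 2) ^+ n.+2.
  rewrite -exprM mulnC exprM -exprMn -(real_normK (num_real (f n.+2 y))).
  by rewrite lerXn2r ?nnegrE // (le_trans _ (fC n.+2 y)).
have := le_trans Hlow (lorentz_mass d0
  (mulr_ge0 (sqr_ge0 C) (exprn_ge0 n.+2 (sqr_ge0 s))) AleB Cf (HG n.+2)).
apply/negP; rewrite -ltNge; move: nM; rewrite -(ltr_pM2r be0); congr (_ < _).
by rewrite (exprS (s ^+ 2) n.+1); field; rewrite !gt_eqF.
Qed.

End ClampedVanishing.

(** * Goursat's theorem on rectangles *)

Section Goursat.
Context {R : realType}.
Implicit Types (u v PU QV : R -> R -> R) (x y a b c d e : R).

(* Complex differentiability of [u + i v] at every point of the plane. *)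
Definition holo u v := forall x0 y0, exists al be : R, forall e, 0 < e ->
  exists2 d, 0 < d & forall x y, `|x - x0| < d -> `|y - y0| < d ->
    `|u x y - u x0 y0 - (al * (x - x0) - be * (y - y0))| <=
      e * (`|x - x0| + `|y - y0|) /\
    `|v x y - v x0 y0 - (be * (x - x0) + al * (y - y0))| <=
      e * (`|x - x0| + `|y - y0|).

(* The real part of the integral of [u + i v] along the boundary of
   [[a, b] x [c, d]], for [PU y] a primitive of [u _ y] and [QV x] one of
   [v x _]. *)
Definition contour PU QV a b c d :=
  (PU c b - PU c a) - (PU d b - PU d a) -
  ((QV b d - QV b c) - (QV a d - QV a c)).

Lemma primitive_bound (f df : R -> R) (k M a b : R) : a <= b ->
  (forall x, is_derive x 1 f (df x)) ->
  (forall x, a <= x <= b -> `|df x - k| <= M) ->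
  `|f b - f a - k * (b - a)| <= M * (b - a).
Proof.
move=> ab Hf HM; have [c cab e] := mean_value ab (fun x _ => Hf x).
have -> : f b - f a - k * (b - a) = (df c - k) * (b - a) by rewrite e; ring.
by rewrite normrM (ger0_norm (_ : 0 <= b - a)) ?subr_ge0 // ler_wpM2r ?subr_ge0 ?HM.
Qed.

Lemma nested_point (A l : nat -> R) : (forall n, 0 <= l n) ->
  (forall n, A n <= A n.+1 /\ A n.+1 + l n.+1 <= A n + l n) ->
  exists x0, forall n, A n <= x0 <= A n + l n.
Proof.
move=> l0 H.
have Am n k : A n <= A (n + k)%N.
  by elim: k => [|k IH]; rewrite ?addn0 // addnS (le_trans IH) // (H _).1.
have Bm n k : A (n + k)%N + l (n + k)%N <= A n + l n.
  by elim: k => [|k IH]; rewrite ?addn0 // addnS (le_trans (H _).2).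
have AB m n : A m <= A n + l n.
  case: (leqP m n) => [/subnKC <-|/ltnW /subnKC <-].
    by rewrite (le_trans (Am m (n - m)%N)) // lerDl.
  by rewrite (le_trans _ (Bm n (m - n)%N)) // lerDl.
have ub n : ubound (range A) (A n + l n) by move=> _ [m _ <-].
exists (sup (range A)) => n; apply/andP; split.
  apply: ub_le_sup; last by exists n.
  by exists (A 0%N + l 0%N); exact: ub.
by apply: ge_sup; [exists (A 0%N); exists 0%N|exact: ub].
Qed.

Section Rectangle.
Variables (u v PU QV : R -> R -> R).
Hypothesis uv : holo u v.
Hypothesis HU : forall y x, is_derive x 1 (PU y) (u x y).
Hypothesis HV : forall x y, is_derive y 1 (QV x) (v x y).

(** The affine part of [u + i v] contributes [be (b - a) (d - c)] both to the difference of the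
    horizontal sides and to that of the vertical ones, and these cancel. What remains is an error of
    size [e S] along sides of total length of order [S]. *)
Lemma contour_local x0 y0 e : 0 < e -> exists2 dl, 0 < dl &
  forall a b c d, a <= x0 <= b -> c <= y0 <= d -> b - a < dl -> d - c < dl ->
    `|contour PU QV a b c d| <= 4 * e * (b - a + (d - c)) ^+ 2.
Proof.
move=> e0; have [al [be /(_ e e0) [dl dl0 H]]] := uv x0 y0.
exists dl => // a b c d /andP[ax xb] /andP[cy yd] abd cdd.
have near1 x : a <= x <= b -> `|x - x0| < dl /\ `|x - x0| <= b - a.
  by move=> /andP[? ?]; split; [rewrite ltr_norml|rewrite ler_norml]; apply/andP; lra.
have near2 y : c <= y <= d -> `|y - y0| < dl /\ `|y - y0| <= d - c.
  by move=> /andP[? ?]; split; [rewrite ltr_norml|rewrite ler_norml]; apply/andP; lra.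
have ab : a <= b by lra.
have cd : c <= d by lra.
pose S := b - a + (d - c).
have bnd x y (k : R) : a <= x <= b -> c <= y <= d -> `|k| <= e * (`|x - x0| + `|y - y0|) ->
    - (e * S) <= k <= e * S.
  move=> /near1[_ h1] /near2[_ h2] hk; rewrite -ler_norml; apply: le_trans hk _.
  by rewrite ler_pM2l // /S; lra.
have c_in : c <= c <= d by rewrite lexx.
have d_in : c <= d <= d by rewrite lexx andbT.
have a_in : a <= a <= b by rewrite lexx.
have b_in : a <= b <= b by rewrite lexx andbT.
have B1 : `|(PU c b - PU d b) - (PU c a - PU d a) - be * (d - c) * (b - a)| <=
    2 * e * S * (b - a).
  apply: (@primitive_bound (fun x => PU c x - PU d x) (fun x => u x c - u x d)
    _ _ _ _ ab (fun x => is_derive_subf (HU c x) (HU d x))).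
  move=> x xab; have [x1 _] := near1 x xab.
  have [/(bnd _ _ _ xab c_in) + _] := H x c x1 (near2 c c_in).1.
  have [/(bnd _ _ _ xab d_in) + _] := H x d x1 (near2 d d_in).1.
  by move=> /andP[? ?] /andP[? ?]; rewrite ler_norml; apply/andP; lra.
have B2 : `|(QV b d - QV a d) - (QV b c - QV a c) - be * (b - a) * (d - c)| <=
    2 * e * S * (d - c).
  apply: (@primitive_bound (fun y => QV b y - QV a y) (fun y => v b y - v a y)
    _ _ _ _ cd (fun y => is_derive_subf (HV b y) (HV a y))).
  move=> y ycd; have [y1 _] := near2 y ycd.
  have [_ /(bnd _ _ _ b_in ycd) +] := H b y (near1 b b_in).1 y1.
  have [_ /(bnd _ _ _ a_in ycd) +] := H a y (near1 a a_in).1 y1.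
  by move=> /andP[? ?] /andP[? ?]; rewrite ler_norml; apply/andP; lra.
rewrite -/S.
have S0 : 0 <= e * S ^+ 2 by rewrite mulr_ge0 ?sqr_ge0 // ltW.
have SE : 2 * e * S * (b - a) + 2 * e * S * (d - c) = 2 * (e * S ^+ 2).
  by rewrite /S; ring.
move: B1 B2; rewrite !ler_norml /contour => /andP[? ?] /andP[? ?].
by apply/andP; lra.
Qed.

Lemma goursat a b c d : a < b -> c < d -> contour PU QV a b c d = 0.
Proof.
move=> ab cd; apply/eqP/negPn/negP => J0.
pose J a b c d := contour PU QV a b c d.
pose l1 (n : nat) := (b - a) / 2 ^+ n; pose l2 (n : nat) := (d - c) / 2 ^+ n.
have l1S n : l1 n = l1 n.+1 + l1 n.+1 by rewrite /l1 exprS; field; rewrite expf_neq0.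
have l2S n : l2 n = l2 n.+1 + l2 n.+1 by rewrite /l2 exprS; field; rewrite expf_neq0.
(* [s] holds a generation and a lower left corner. The integrals over the four quarters add up, as
   the inner sides cancel, so one quarter carries at least a quarter of the modulus. *)
have step (s : nat * (R * R)) : exists t : R * R,
  [/\ s.2.1 <= t.1 <= s.2.1 + l1 s.1.+1, s.2.2 <= t.2 <= s.2.2 + l2 s.1.+1 &
   `|J s.2.1 (s.2.1 + l1 s.1) s.2.2 (s.2.2 + l2 s.1)| <=
    4 * `|J t.1 (t.1 + l1 s.1.+1) t.2 (t.2 + l2 s.1.+1)|].
  case: s => n [x y] /=; set h := l1 n.+1; set k := l2 n.+1.
  have h0 : 0 <= h by rewrite divr_ge0 ?exprn_ge0 // subr_ge0 ltW.
  have k0 : 0 <= k by rewrite divr_ge0 ?exprn_ge0 // subr_ge0 ltW.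
  have -> : l1 n = h + h := l1S n.
  have -> : l2 n = k + k := l2S n.
  have JE : J x (x + (h + h)) y (y + (k + k)) =
     J x (x + h) y (y + k) + J (x + h) (x + h + h) y (y + k) +
     (J x (x + h) (y + k) (y + k + k) + J (x + h) (x + h + h) (y + k) (y + k + k)).
    by rewrite /J /contour !addrA; ring.
  set J0' := J x _ y _ in JE *.
  have xx : x <= x <= x + h by apply/andP; lra.
  have xh : x <= x + h <= x + h by apply/andP; lra.
  have yy : y <= y <= y + k by apply/andP; lra.
  have yk : y <= y + k <= y + k by apply/andP; lra.
  have [?|n1] := leP `|J0'| (4 * `|J x (x + h) y (y + k)|); first by exists (x, y).
  have [?|n2] := leP `|J0'| (4 * `|J (x + h) (x + h + h) y (y + k)|).
    by exists (x + h, y).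
  have [?|n3] := leP `|J0'| (4 * `|J x (x + h) (y + k) (y + k + k)|).
    by exists (x, y + k).
  have [?|n4] := leP `|J0'| (4 * `|J (x + h) (x + h + h) (y + k) (y + k + k)|).
    by exists (x + h, y + k).
  exfalso; have : `|J0'| <= `|J x (x + h) y (y + k)| + `|J (x + h) (x + h + h) y (y + k)| +
     (`|J x (x + h) (y + k) (y + k + k)| + `|J (x + h) (x + h + h) (y + k) (y + k + k)|).
    rewrite JE (le_trans (ler_normD _ _)) // lerD // ?(le_trans (ler_normD _ _)) //.
  lra.
have [g gP] := choice step.
pose st := fix st n := if n is m.+1 then g (m, st m) else (a, c).
have JM n : `|J a b c d| <=
    4 ^+ n * `|J (st n).1 ((st n).1 + l1 n) (st n).2 ((st n).2 + l2 n)|.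
  elim: n => [|n IH].
    by rewrite expr0 mul1r /l1 /l2 expr0 !divr1 /= !(addrC a, addrC c) !subrK.
  apply: le_trans IH _; rewrite exprSr -mulrA ler_pM2l ?exprn_gt0 //.
  by have [_ _] := gP (n, st n).
have l10 n : 0 <= l1 n by rewrite divr_ge0 ?exprn_ge0 // subr_ge0 ltW.
have l20 n : 0 <= l2 n by rewrite divr_ge0 ?exprn_ge0 // subr_ge0 ltW.
have [|x0 Hx] := @nested_point (fun n => (st n).1) l1 l10.
  move=> n; have [/= /andP[h1 h2] _ _] := gP (n, st n).
  by split => //=; rewrite (l1S n); lra.
have [|y0 Hy] := @nested_point (fun n => (st n).2) l2 l20.
  move=> n; have [/= _ /andP[h1 h2] _] := gP (n, st n).
  by split => //=; rewrite (l2S n); lra.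
pose S := b - a + (d - c); have S0 : 0 < S by rewrite /S; lra.
have Jpos : 0 < `|J a b c d| by rewrite normr_gt0.
(* The factor [4^n] cancels the square of [2^-n], so the local estimate will read [4 e S^2], which
   this [e] makes half of [|J|]. *)
pose e := `|J a b c d| / (8 * S ^+ 2).
have S2 : 0 < 8 * S ^+ 2 by rewrite mulr_gt0 // exprn_gt0.
have e0 : 0 < e by rewrite divr_gt0.
have [dl dl0 loc] := contour_local x0 y0 e0.
have [n nS] : exists n : nat, S / 2 ^+ n < dl.
  exists (Num.bound (S / dl)); rewrite ltr_pdivrMr ?exprn_gt0 //.
  rewrite mulrC -ltr_pdivrMr //; apply: lt_trans (archi_boundP _) _.
    by rewrite divr_ge0 // ltW.
  by rewrite -natrX ltr_nat ltn_expl.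
have S1 : l1 n + l2 n = S / 2 ^+ n by rewrite /l1 /l2 -mulrDl.
have := loc _ _ _ _ (Hx n) (Hy n).
have -> : forall p q : R, p + q - p = q by move=> *; ring.
have -> : forall p q : R, p + q - p = q by move=> *; ring.
have n1 := l10 n; have n2 := l20 n.
move=> /(_ ltac:(lra) ltac:(lra)); rewrite S1 -/(J _ _ _ _) => Jn.
have := JM n; rewrite leNgt => /negP; apply.
apply: le_lt_trans (_ : 4 ^+ n * (4 * e * (S / 2 ^+ n) ^+ 2) < _).
  by rewrite ler_pM2l // exprn_gt0.
have -> : 4 ^+ n * (4 * e * (S / 2 ^+ n) ^+ 2) = `|J a b c d| / 2.
  have -> : 4 ^+ n = (2 ^+ n) ^+ 2 :> R by rewrite -exprM mulnC exprM expr2 -natrM.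
  by rewrite /e; field; rewrite expf_neq0 //= gt_eqF.
lra.
Qed.
End Rectangle.
End Goursat.

(** * Integrals on the real line *)

Section Integrals.
Context {R : realType}.
Notation mu := (@lebesgue_measure R).
Notation itg f := (mu.-integrable setT (EFin \o f)).
Implicit Types (f g h : R -> R).

Lemma integrableT_measurable f : itg f -> measurable_fun setT f.
Proof. by move=> /integrableP[/measurable_EFinP]. Qed.

Lemma integrableT_add f g : itg f -> itg g -> itg (fun x => f x + g x).
Proof. by move=> If Ig; exact: integrableD If Ig. Qed.

Lemma integrableT_sub f g : itg f -> itg g -> itg (fun x => f x - g x).
Proof. by move=> If Ig; exact: integrableB If Ig. Qed.

Lemma integrableT_scale (k : R) f : itg f -> itg (fun x => k * f x).
Proof. by move=> If; exact: integrableZl If. Qed.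

Lemma integrableT_le f g : measurable_fun setT f -> (forall x, `|f x| <= g x) -> itg g -> itg f.
Proof.
move=> mf fg Ig; apply: le_integrable Ig => //; first exact/measurable_EFinP.
by move=> x _; rewrite lee_fin (le_trans (fg x)) // ler_norm.
Qed.

Lemma integrableT_mul_bounded f g (M : R) : measurable_fun setT g -> (forall x, `|g x| <= M) ->
  itg f -> itg (fun x => f x * g x).
Proof.
move=> mg gM If.
apply: (@integrableT_le _ (fun x => M * `|f x|)); last first.
  by apply: integrableT_scale; exact: integrable_norm.
  by move=> x; rewrite normrM mulrC ler_wpM2r.
by apply: measurable_funM => //; exact: integrableT_measurable.
Qed.

Lemma RintegralT_add f g : itg f -> itg g ->
  \int[mu]_x (f x + g x) = \int[mu]_x f x + \int[mu]_x g x.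
Proof. by move=> If Ig; rewrite RintegralD. Qed.

Lemma RintegralT_sub f g : itg f -> itg g ->
  \int[mu]_x (f x - g x) = \int[mu]_x f x - \int[mu]_x g x.
Proof. by move=> If Ig; rewrite RintegralB. Qed.

Lemma RintegralT_scale (k : R) f : itg f -> \int[mu]_x (k * f x) = k * \int[mu]_x f x.
Proof. by move=> If; rewrite RintegralZl. Qed.

Lemma RintegralT_le f g : itg f -> itg g -> (forall x, f x <= g x) ->
  \int[mu]_x f x <= \int[mu]_x g x.
Proof. by move=> If Ig fg; apply: le_Rintegral. Qed.

Lemma RintegralT_abs f : itg f -> `|\int[mu]_x f x| <= \int[mu]_x `|f x|.
Proof. by move=> If; apply: le_normr_Rintegral. Qed.

Lemma eq_RintegralT f g : f =1 g -> \int[mu]_x f x = \int[mu]_x g x.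
Proof. by move=> fg; apply: eq_Rintegral => x _; exact: fg. Qed.

Lemma RintegralT_EFin f : itg f -> (\int[mu]_x (f x)%:E)%E = (\int[mu]_x f x)%:E.
Proof. by move=> If; rewrite fineK //; exact: integrable_fin_num. Qed.

Lemma ge0_integral_affine (a b : R) f : 0 < a -> continuous f -> (forall x, 0 <= f x) ->
  (\int[mu]_x (f x)%:E = \int[mu]_x (f (a * x + b) * a)%:E)%E.
Proof.
move=> a0 cf f0; pose F x := a * x + b.
have HF (x : R) : is_derive x 1 F a.
  by apply: is_derive_congr (is_derive_addf (is_derive_scalef a (is_derive_id x 1)) (is_derive_constf b x)) _; rewrite mulr1 addr0.
have dF : derive1 F = cst a by apply/funext => x; rewrite derive1E; case: (HF x).
rewrite (@increasing_ge0_integration_by_substitutionT R F f) //.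
- by apply: eq_integral => x _; rewrite dF.
- by move=> x y xy; rewrite /F ltrD2r ltr_pM2l.
- by rewrite dF => x; exact: cvg_cst.
- by rewrite dF; exact: is_cvg_cst.
- by rewrite dF; exact: is_cvg_cst.
- apply/cvgrNyPle => A; near=> x.
  rewrite /F -lerBrDr mulrC -ler_pdivlMr //.
- apply/cvgryPge => A; near=> x.
  rewrite /F -lerBlDr mulrC -ler_pdivrMr //.
Unshelve. all: by end_near. Qed.

Lemma integrableT_abs f : measurable_fun setT f ->
  (\int[mu]_x `|f x|%:E < +oo)%E -> itg f.
Proof. by move=> mf H; apply/integrableP; split; [exact/measurable_EFinP|]. Qed.

Lemma continuous_measurable f : continuous f -> measurable_fun setT f.
Proof. exact: continuous_measurable_fun. Qed.

Lemma integrableT_affine (a b : R) f : 0 < a -> continuous f -> itg f ->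
  itg (fun x => f (a * x + b)) /\
  \int[mu]_x f x = a * \int[mu]_x f (a * x + b).
Proof.
move=> a0 cf If.
have ca : continuous (fun x => f (a * x + b)).
  move=> x; apply: (@continuous_comp _ _ _ (fun x => a * x + b) f); last exact: cf.
  exact: is_derive_continuous_at (is_derive_addf (is_derive_scalef a (is_derive_id x 1)) (is_derive_constf b x)).
have cn : continuous (fun x => `|f x|).
  by move=> x; apply: continuous_comp (cf x) _; exact: norm_continuous.
have Ia : itg (fun x => f (a * x + b)).
  apply: integrableT_abs; first exact: continuous_measurable.
  have /integrableP[_ /=] := If; rewrite (ge0_integral_affine b a0 cn) //.
  move=> h; have : (\int[mu]_x (a^-1 * (`|f (a * x + b)| * a))%:E < +oo)%E.
    under eq_integral do rewrite EFinM.
    rewrite ge0_integralZl //; first by rewrite lte_mul_pinfty ?lee_fin // invr_ge0 ltW.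
    - apply/measurable_EFinP; apply: measurable_funM => //; apply: continuous_measurable.
      by move=> x; apply: continuous_comp (ca x) _; exact: norm_continuous.
    - by move=> x _; rewrite lee_fin mulr_ge0 // ltW.
    - by rewrite lee_fin invr_ge0 ltW.
  by under eq_integral do rewrite mulrC mulfK ?gt_eqF //.
split=> //.
(* The substitution rule for nonnegative functions is applied to [|f| + f] and to [|f|], and the
   results are subtracted. *)
pose u x := `|f x| + f x.
have u0 x : 0 <= u x by rewrite /u; have := ler_norm (- f x); rewrite normrN; lra.
have cu : continuous u by exact: continuous_addf.
have In : itg (fun x => `|f x|) := integrable_norm If.
have Ina : itg (fun x => `|f (a * x + b)|) := integrable_norm Ia.
have Iu : itg u := integrableT_add In If.
have E1 := ge0_integral_affine b a0 cu u0.
have E2 := ge0_integral_affine b a0 cn (fun x => normr_ge0 (f x)).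
have R1 : \int[mu]_x u x = a * \int[mu]_x u (a * x + b).
  rewrite {1}/Rintegral E1 -RintegralT_scale; last exact: integrableT_add.
  by apply: eq_RintegralT => x; rewrite mulrC.
have R2 : \int[mu]_x `|f x| = a * \int[mu]_x `|f (a * x + b)|.
  rewrite {1}/Rintegral E2 -RintegralT_scale //.
  by apply: eq_RintegralT => x; rewrite mulrC.
move: R1; rewrite !RintegralT_add // R2 mulrDr.
by move/addrI.
Qed.

Lemma integrableT_reflection f : itg f -> itg (fun x => f (- x)) /\
  \int[mu]_x f (- x) = \int[mu]_x f x.
Proof.
move=> If; have mf := integrableT_measurable If.
have mN : measurable_fun [set: R] (-%R : R -> R) by exact: oppr_measurable.
have mfN : measurable_fun setT (fun x : R => f (- x)) by exact: measurableT_comp mf mN.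
have EN (g : R -> \bar R) : (\int[mu]_x g x =
    \int[pushforward mu (-%R : _ -> measurableTypeR R)]_x g x)%E.
  by apply: eq_measure_integral => A mA _; exact/esym/lebesgue_measureN.
have IfN : itg (fun x => f (- x)).
  apply: integrableT_abs => //; have /integrableP[_ /=] := If.
  rewrite EN ge0_integral_pushforward //.
  by apply/measurable_EFinP; apply: measurableT_comp.
split=> //; rewrite [in RHS]/Rintegral EN integral_pushforward //.
exact/measurable_EFinP.
Qed.

Lemma RintegralT_gt0 h x0 : continuous h -> (forall x, 0 <= h x) -> 0 < h x0 -> itg h ->
  0 < \int[mu]_x h x.
Proof.
move=> ch h0 hx Ih.
have [r r0 Hr] : exists2 r : R, 0 < r & forall x, `|x0 - x| < r -> h x0 / 2 <= h x.
  have h2 : 0 < h x0 / 2 by lra.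
  have [r r0 H] := @cvgr_dist_lt _ _ _ _ _ _ _ (ch x0) _ h2.
  exists r => // x xr; have := H x xr; rewrite ltr_norml => /andP[]; lra.
pose A : set R := [set` `]x0 - r, x0 + r[].
have IA : itg (fun x => h x0 / 2 * \1_A x) := integrableT_scale _ (integrable_indic_itv _ _ _ _).
have : \int[mu]_x (h x0 / 2 * \1_A x) <= \int[mu]_x h x.
  apply: RintegralT_le => // x; rewrite indicE; case: (boolP (x \in A)) => [|_]; last by rewrite mulr0.
  rewrite inE /A /= in_itv /= mulr1 => /andP[? ?]; apply: Hr.
  by rewrite ltr_norml; apply/andP; lra.
apply: lt_le_trans; rewrite RintegralT_scale; last exact: integrable_indic_itv.
rewrite mulr_gt0 //; first by lra.
have -> : \int[mu]_x \1_A x = 2 * r.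
  rewrite /Rintegral integral_indic; [|exact: measurableT|exact: measurable_itv].
  have muA : mu A = (2 * r)%:E.
    rewrite /A lebesgue_measure_itv /= lte_fin ifT; last by lra.
    by rewrite -EFinB /=; congr (_%:E); ring.
  by rewrite setIT; exact: (congr1 fine muA).
by rewrite mulr_gt0.
Qed.

End Integrals.

(** * The squared cardinal sine *)

Section Sinc.
Context {R : realType}.
Notation mu := (@lebesgue_measure R).
Notation itg f := (mu.-integrable setT (EFin \o f)).
Implicit Types (x y s t : R).

(** The mean value theorem. Iterated, it produces the Taylor remainders at 0 of the circular and
    hyperbolic functions, with one constant for all orders. *)
Lemma derive_bound0 (f df : R -> R) (K r : R) n :
  (forall x, is_derive x 1 f (df x)) -> f 0 = 0 ->
  (forall x, `|x| <= r -> `|df x| <= K * `|x| ^+ n) ->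
  forall x, `|x| <= r -> `|f x| <= K * `|x| ^+ n.+1.
Proof.
move=> Hf f0 HK x xr.
have [c [cx fx]] : exists c, `|c| <= `|x| /\ f x = df c * x.
  have [x0|x0] := leP 0 x.
    have [c /andP[c0 cx]] := mean_value x0 (fun y _ => Hf y).
    by rewrite f0 !subr0 => ->; exists c; rewrite !ger0_norm.
  have [c /andP[xc c0]] := mean_value (ltW x0) (fun y _ => Hf y).
  rewrite f0 !sub0r mulrN => /oppr_inj ->; exists c.
  by rewrite !ler0_norm ?lerN2 // ltW.
have K0 : 0 <= K * `|x| ^+ n by apply: le_trans (HK x xr).
rewrite fx normrM exprSr mulrA ler_wpM2r //.
apply: le_trans (HK c (le_trans cx xr)) _.
have [K00|K00] := leP 0 K; first by rewrite ler_wpM2l // lerXn2r ?nnegrE.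
(* A negative [K] is compatible with the hypothesis only where the power vanishes. *)
have xn0 : `|x| ^+ n = 0.
  by apply/eqP; rewrite eq_le exprn_ge0 // andbT -(nmulr_rge0 _ K00).
have : 0 <= K * `|c| ^+ n by apply: le_trans (HK c (le_trans cx xr)).
rewrite nmulr_rge0 // => cn0.
have -> : `|c| ^+ n = 0 by apply/eqP; rewrite eq_le exprn_ge0 // andbT.
by rewrite xn0.
Qed.

Lemma norm_sin_le x : `|sin x| <= `|x|.
Proof.
have H y : `|y| <= `|x| -> `|cos y| <= 1 * `|y| ^+ 0 by rewrite mulr1 cos_max.
have := derive_bound0 (@is_derive_sin R) (@sin0 R) H (lexx _).
by rewrite mul1r expr1.
Qed.

Lemma norm_cos1_le x : `|cos x - 1| <= x ^+ 2.
Proof.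
have D y : is_derive y 1 (fun y => cos y - 1) (- sin y - 0).
  exact: is_derive_subf (is_derive_cos y) (is_derive_constf 1 y).
have D0 : cos 0 - 1 = 0 :> R by rewrite cos0 subrr.
have H y : `|y| <= `|x| -> `|- sin y - 0| <= 1 * `|y| ^+ 1.
  by rewrite subr0 normrN mul1r expr1 norm_sin_le.
have := derive_bound0 D D0 H (lexx _).
by rewrite mul1r real_normK ?num_real.
Qed.

Lemma norm_sin_sub_le x : `|sin x - x| <= `|x| ^+ 3.
Proof.
have D y : is_derive y 1 (fun y => sin y - y) (cos y - 1).
  exact: is_derive_subf (is_derive_sin y) (is_derive_id y 1).
have D0 : sin 0 - 0 = 0 :> R by rewrite sin0 subrr.
have H y : `|y| <= `|x| -> `|cos y - 1| <= 1 * `|y| ^+ 2.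
  by rewrite mul1r real_normK ?num_real // norm_cos1_le.
by have := derive_bound0 D D0 H (lexx _); rewrite mul1r.
Qed.

Definition sinc x : R := if x == 0 then 1 else sin x / x.

Lemma sinc0 : sinc 0 = 1. Proof. by rewrite /sinc eqxx. Qed.

Lemma sincE x : x * sinc x = sin x.
Proof. by rewrite /sinc; case: eqP => [->|/eqP x0]; rewrite ?mul0r ?sin0 // mulrC divfK. Qed.

Lemma sincN x : sinc (- x) = sinc x.
Proof. by rewrite /sinc oppr_eq0 sinN invrN mulrNN. Qed.

Lemma norm_sinc_le1 x : `|sinc x| <= 1.
Proof.
rewrite /sinc; case: eqP => [_|/eqP x0]; first by rewrite normr1.
by rewrite normf_div ler_pdivrMr ?normr_gt0 // mul1r norm_sin_le.
Qed.

Lemma norm_sinc1_le x : `|sinc x - 1| <= x ^+ 2.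
Proof.
rewrite /sinc; case: eqP => [->|/eqP x0]; first by rewrite subrr normr0 expr0n.
have -> : sin x / x - 1 = (sin x - x) / x by field.
rewrite normf_div ler_pdivrMr ?normr_gt0 // -(real_normK (num_real x)) -exprSr.
exact: norm_sin_sub_le.
Qed.

Lemma continuous_sinc : continuous sinc.
Proof.
move=> x; have [->|x0] := eqVneq x 0; last first.
  have H := is_derive_mulf (is_derive_sin x) (is_derive_invf x0 (is_derive_id x 1)).
  apply: is_derive_continuous_at (near_eq_is_derive _ H); near=> y.
  rewrite /sinc ifF //; apply/negbTE.
  by near: y; apply: open_nbhs_nbhs; split; [exact: open_neq|].
apply/cvgrPdist_le => e e0; rewrite sinc0.
exists (Num.min 1 e); first by rewrite /= lt_min ltr01.
move=> y; rewrite /ball_ /= sub0r normrN lt_min => /andP[y1 ye].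
rewrite distrC (le_trans (norm_sinc1_le y)) // -(real_normK (num_real y)) expr2.
by rewrite (le_trans _ (ltW ye)) // ler_piMr // ltW.
Unshelve. all: by end_near. Qed.

Definition sincsq x : R := sinc x ^+ 2.

Lemma sincsq_ge0 x : 0 <= sincsq x. Proof. exact: sqr_ge0. Qed.

Lemma sincsq_le1 x : sincsq x <= 1.
Proof. by rewrite /sincsq -(real_normK (num_real _)) exprn_ile1 ?norm_sinc_le1. Qed.

Lemma sincsqN x : sincsq (- x) = sincsq x. Proof. by rewrite /sincsq sincN. Qed.

Lemma continuous_sincsq : continuous sincsq.
Proof. exact: continuous_expf continuous_sinc. Qed.

Lemma sincsq_le x : sincsq x <= 2 * (1 + x ^+ 2)^-1.
Proof.
rewrite ler_pdivlMr ?ltr_pwDl ?sqr_ge0 //.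
have -> : sincsq x * (1 + x ^+ 2) = sincsq x + sin x ^+ 2.
  by rewrite -(sincE x) /sincsq; ring.
have : sin x ^+ 2 <= 1 by rewrite -(real_normK (num_real _)) exprn_ile1 ?sin_max.
have := sincsq_le1 x; lra.
Qed.

Lemma integrableT_cauchy_density : itg (fun x => (1 + x ^+ 2)^-1).
Proof.
have c : continuous (fun x : R => (1 + x ^+ 2)^-1) := @continuous_oneDsqrV R.
apply: integrableT_abs; first exact: continuous_measurable.
have p x : 0 <= (1 + x ^+ 2)^-1 by rewrite invr_ge0 addr_ge0 ?sqr_ge0.
under eq_integral do rewrite ger0_norm //.
rewrite ge0_symfun_integralT //; last by move=> x /=; rewrite sqrrN.
by rewrite -set_itvcy integral0y_oneDsqr -EFinM ltry.
Qed.

Lemma integrable_sincsq : itg sincsq.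
Proof.
apply: (integrableT_le _ _ (integrableT_scale 2 integrableT_cauchy_density)); first exact: continuous_measurable continuous_sincsq.
by move=> x; rewrite ger0_norm ?sincsq_ge0 ?sincsq_le.
Qed.

Definition sinc_mass : R := (\int[mu]_x sincsq x)%R.

Lemma sinc_mass_gt0 : 0 < sinc_mass.
Proof.
apply: (@RintegralT_gt0 _ _ 0) => //; [exact: continuous_sincsq|exact: sincsq_ge0| |exact: integrable_sincsq].
by rewrite /sincsq sinc0 expr1n.
Qed.

(** This is [(1 - cos (s x))/x^2] with its value at 0 filled in. Written through [sincsq], its
    integral follows by scaling; the summand 0 fits the affine substitution. *)
Let E s x := s ^+ 2 / 2 * sincsq (s / 2 * x + 0).

Let cos_double x : cos (2 * x) = 1 - 2 * sin x ^+ 2.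
Proof. by rewrite mulr_natl cos_mulr2n cos2sin2 -mulr_natl; ring. Qed.

Let E_eq s x : x != 0 -> E s x = (1 - cos (s * x)) / x ^+ 2.
Proof.
move=> x0; have -> : s * x = 2 * (s / 2 * x + 0) by field.
rewrite cos_double -(sincE (s / 2 * x + 0)) /E /sincsq.
by field.
Qed.

Let itgE s : itg (E s) /\ \int[mu]_x E s x = `|s| * sinc_mass.
Proof.
have pos r : 0 < r -> itg (E r) /\ \int[mu]_x E r x = r * sinc_mass.
  move=> r0; have r2 : 0 < r / 2 by lra.
  have [I1 I2] := integrableT_affine 0 r2 continuous_sincsq integrable_sincsq.
  split; first exact: integrableT_scale I1.
  by rewrite RintegralT_scale // /sinc_mass I2; field.
have [s0|s0|<-] := ltgtP 0 s.
- by rewrite gtr0_norm //; exact: pos.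
- have -> : E s = E (- s).
    by apply/funext => x; rewrite /E sqrrN mulNr mulNr addr0 addr0 sincsqN.
  by rewrite ltr0_norm //; apply: pos; rewrite oppr_gt0.
have -> : E 0 = fun=> 0 by apply/funext => x; rewrite /E expr0n /= !mul0r.
split; first exact: integrable0.
by rewrite normr0 mul0r /Rintegral integral0.
Qed.

(* The triangle [max(0, 1 - |t| / 2)]. *)
Definition tri t : R := (`|t + 2| + `|t - 2| - 2 * `|t|) / 4.

(** By [sin^2 x = (1 - cos (2 x))/2] and the product formula the left side is a second difference in
    [t]; the transform of [sincsq] is thus a second difference of [|t|], a triangle. *)
Let sincsq_cos t x : sincsq x * cos (t * x) =
  4^-1 * (E (t + 2) x + E (t - 2) x - 2 * E t x).
Proof.
have [->|x0] := eqVneq x 0.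
  by rewrite /E !mulr0 addr0 /sincsq sinc0 cos0 expr1n; field.
have e2 : sincsq x = (1 - cos (2 * x)) / (2 * x ^+ 2).
  by rewrite cos_double -(sincE x) /sincsq; field.
have c1 : cos ((t + 2) * x) = cos (t * x) * cos (2 * x) - sin (t * x) * sin (2 * x).
  by rewrite mulrDl cosD.
have c2 : cos ((t - 2) * x) = cos (t * x) * cos (2 * x) + sin (t * x) * sin (2 * x).
  by rewrite mulrBl cosB.
rewrite !E_eq // e2 c1 c2.
by field.
Qed.

Lemma Rintegral_sincsq_cos t : \int[mu]_x (sincsq x * cos (t * x)) = sinc_mass * tri t.
Proof.
rewrite (eq_RintegralT (sincsq_cos t)) RintegralT_scale; last first.
  by apply: integrableT_sub; [apply: integrableT_add; exact: (itgE _).1|apply: integrableT_scale; exact: (itgE _).1].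
rewrite RintegralT_sub; [|by apply: integrableT_add; exact: (itgE _).1|by apply: integrableT_scale; exact: (itgE _).1].
rewrite RintegralT_add ?(itgE _).1 // RintegralT_scale ?(itgE _).1 // !(itgE _).2 /tri.
by field.
Qed.

Lemma Rintegral_sincsq_sin t : \int[mu]_x (sincsq x * sin (t * x)) = 0.
Proof.
have I : itg (fun x => sincsq x * sin (t * x)).
  apply: (@integrableT_mul_bounded _ _ _ 1) integrable_sincsq => [|x]; last exact: sin_max.
  apply: continuous_measurable => x.
  apply: (@continuous_comp _ _ _ (fun x => t * x) sin); last exact: continuous_sin.
  by apply: continuous_scalef; move=> y; exact: cvg_id.
have [_] := integrableT_reflection I.
have -> : \int[mu]_x (sincsq (- x) * sin (t * - x)) =
    \int[mu]_x (- 1 * (sincsq x * sin (t * x))).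
  by apply: eq_RintegralT => x; rewrite sincsqN mulrN sinN; ring.
by rewrite RintegralT_scale //; lra.
Qed.

Lemma tri_ge0 t : 0 <= tri t.
Proof.
rewrite /tri divr_ge0 // subr_ge0.
have -> : 2 * `|t| = `|(t + 2) + (t - 2)|.
  by rewrite (_ : t + 2 + (t - 2) = 2 * t) ?normrM ?normr_nat //; ring.
exact: ler_normD.
Qed.

Lemma tri_out t : 2 <= `|t| -> tri t = 0.
Proof.
rewrite /tri ler_normr => /orP[t2|t2].
  by rewrite !ger0_norm; lra.
by rewrite !ler0_norm; lra.
Qed.

Lemma tri_le1 t : tri t <= 1.
Proof.
rewrite /tri ler_pdivrMr //; have := ler_normD t 2; have := ler_normB t 2.
by rewrite normr_nat; lra.
Qed.

Lemma continuous_tri : continuous tri.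
Proof.
have cabs (c : R) : continuous (fun t : R => `|t + c|).
  have H : continuous (fun t : R => t + c).
    by apply: continuous_addf => y; [exact: cvg_id|exact: cvg_cst].
  by move=> t; apply: continuous_comp (H t) _; exact: norm_continuous.
have -> : tri = fun t => 4^-1 * (`|t + 2| + `|t + -2| - 2 * `|t + 0|).
  by apply/funext => t; rewrite /tri addr0 mulrC.
by apply: continuous_scalef; apply: continuous_subf; [apply: continuous_addf|apply: continuous_scalef]; exact: cabs.
Qed.

Lemma integrable_tri : itg tri.
Proof.
apply: (integrableT_le _ _ (integrableT_scale 5 integrableT_cauchy_density)); first exact: continuous_measurable continuous_tri.
move=> t; rewrite ger0_norm ?tri_ge0 // ler_pdivlMr ?ltr_pwDl ?sqr_ge0 //.
have [t2|/ltW t2] := leP 2 `|t|.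
  by rewrite tri_out // mul0r.
have h : t ^+ 2 <= 4.
  by rewrite -(real_normK (num_real t)) (_ : 4 = 2 ^+ 2 :> R) ?lerXn2r ?nnegrE //; ring.
apply: le_trans (_ : 1 * (1 + t ^+ 2) <= _); last by lra.
by rewrite ler_wpM2r ?tri_le1 // addr_ge0 ?sqr_ge0.
Qed.

Lemma tri_mass_gt0 : 0 < \int[mu]_x tri x.
Proof.
apply: (@RintegralT_gt0 _ _ 0) => //; [exact: continuous_tri|exact: tri_ge0| |exact: integrable_tri].
rewrite /tri add0r sub0r normrN normr0 mulr0 subr0 normr_nat; lra.
Qed.

End Sinc.

(** * Fourier inversion for band-limited functions *)

Section Multiplication.
Context {R : realType}.
Notation mu := (@lebesgue_measure R).
Notation itg f := (mu.-integrable setT (EFin \o f)).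
Implicit Types (x y e w : R) (p q : R -> R).

Lemma integrable_dilated_sincsq e : 0 < e -> itg (fun w => sincsq (e * w)).
Proof.
move=> e0; have [I _] := integrableT_affine 0 e0 continuous_sincsq integrable_sincsq.
by under eq_fun do rewrite -[e * _]addr0.
Qed.

Lemma continuous_mulcos (f : R -> R) t : continuous f -> continuous (fun w => f w * cos (t * w)).
Proof.
move=> cf; apply: continuous_mulf => // w; apply: (@continuous_comp _ _ _ (fun w => t * w) cos).
  by apply: continuous_scalef => z; exact: cvg_id.
exact: continuous_cos.
Qed.

Lemma continuous_mulsin (f : R -> R) t : continuous f -> continuous (fun w => f w * sin (t * w)).
Proof.
move=> cf; apply: continuous_mulf => // w; apply: (@continuous_comp _ _ _ (fun w => t * w) sin).
  by apply: continuous_scalef => z; exact: cvg_id.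
exact: continuous_sin.
Qed.

Lemma integrableT_mulcos (f : R -> R) t : itg f -> itg (fun w => f w * cos (t * w)).
Proof.
move=> If; apply: (@integrableT_mul_bounded _ _ _ 1) If => [|w]; last exact: cos_max.
apply: continuous_measurable => w; apply: (@continuous_comp _ _ _ (fun w => t * w) cos).
  by apply: continuous_scalef => z; exact: cvg_id.
exact: continuous_cos.
Qed.

Lemma integrableT_mulsin (f : R -> R) t : itg f -> itg (fun w => f w * sin (t * w)).
Proof.
move=> If; apply: (@integrableT_mul_bounded _ _ _ 1) If => [|w]; last exact: sin_max.
apply: continuous_measurable => w; apply: (@continuous_comp _ _ _ (fun w => t * w) sin).
  by apply: continuous_scalef => z; exact: cvg_id.
exact: continuous_sin.
Qed.

(* The Fourier transform of [w |-> sincsq (e * w)]. *)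
Definition fejer e x : R := e^-1 * (sinc_mass * tri (2 * pi / e * x)).

Lemma Rintegral_dilated_sincsq_cos e x : 0 < e ->
  \int[mu]_w (sincsq (e * w) * cos (2 * pi * x * w)) = fejer e x.
Proof.
move=> e0; rewrite /fejer -Rintegral_sincsq_cos.
have c := continuous_mulcos (t := 2 * pi / e * x) continuous_sincsq.
have [_ ->] := integrableT_affine 0 e0 c (integrableT_mulcos _ integrable_sincsq).
rewrite mulrA mulVf ?gt_eqF // mul1r; apply: eq_RintegralT => w /=; rewrite addr0.
by congr (_ * cos _); field; rewrite gt_eqF.
Qed.

Lemma Rintegral_dilated_sincsq_sin e x : 0 < e ->
  \int[mu]_w (sincsq (e * w) * sin (2 * pi * x * w)) = 0.
Proof.
move=> e0; have := Rintegral_sincsq_sin (2 * pi / e * x).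
have c := continuous_mulsin (t := 2 * pi / e * x) continuous_sincsq.
have [_ ->] := integrableT_affine 0 e0 c (integrableT_mulsin _ integrable_sincsq).
move=> /eqP; rewrite mulf_eq0 gt_eqF //= => /eqP <-.
apply: eq_RintegralT => w /=; rewrite addr0.
by congr (_ * sin _); field; rewrite gt_eqF.
Qed.

(* The real and imaginary parts of the Fourier transform of [p + i q]. *)
Definition coshat p q w : R :=
  \int[mu]_y (p y * cos (2 * pi * w * y) + q y * sin (2 * pi * w * y)).
Definition sinhat p q w : R :=
  \int[mu]_y (q y * cos (2 * pi * w * y) - p y * sin (2 * pi * w * y)).

(** Fubini's theorem for [Phi], the real part of [(p + i q)(y) exp (-2 pi i w (y - x))] times
    [sincsq (e w)]. Integrating in [w] first leaves the Fejer kernel centred at [x]; the term with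
    [q] is odd in [w] and disappears. *)
Lemma multiplication_formula p q e x : 0 < e -> itg p -> itg q ->
  itg (fun w => (coshat p q w * cos (2 * pi * w * x) -
      sinhat p q w * sin (2 * pi * w * x)) * sincsq (e * w)) /\
  \int[mu]_w ((coshat p q w * cos (2 * pi * w * x) -
      sinhat p q w * sin (2 * pi * w * x)) * sincsq (e * w)) =
  \int[mu]_y (p y * fejer e (y - x)).
Proof.
move=> e0 Ip Iq.
pose Phi (z : measurableTypeR R * measurableTypeR R) : R :=
  (p z.2 * cos (2 * pi * z.1 * (z.2 - x)) + q z.2 * sin (2 * pi * z.1 * (z.2 - x)))
  * sincsq (e * z.1).
have IS := integrable_dilated_sincsq e0.
have Iy w : itg (fun y => Phi (w, y)).
  rewrite /Phi /=; apply: (@integrableT_mul_bounded _ _ (fun=> sincsq (e * w)) 1) => //.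
    by move=> y; rewrite ger0_norm ?sincsq_ge0 ?sincsq_le1.
  have ca : continuous (fun y : R => 2 * pi * w * (y - x)).
    by apply: continuous_scalef; apply: continuous_subf => z; [exact: cvg_id|exact: cvg_cst].
  apply: integrableT_add; apply: (@integrableT_mul_bounded _ _ _ 1) => //.
  - by apply: continuous_measurable => y; apply: continuous_comp (ca y) _; exact: continuous_cos.
  - by move=> y; exact: cos_max.
  - by apply: continuous_measurable => y; apply: continuous_comp (ca y) _; exact: continuous_sin.
  - by move=> y; exact: sin_max.
have HPhi w : (coshat p q w * cos (2 * pi * w * x) -
      sinhat p q w * sin (2 * pi * w * x)) * sincsq (e * w) = \int[mu]_y Phi (w, y).
  have I1 := integrableT_mulcos (2 * pi * w) Ip. have I2 := integrableT_mulsin (2 * pi * w) Iq.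
  have I3 := integrableT_mulcos (2 * pi * w) Iq. have I4 := integrableT_mulsin (2 * pi * w) Ip.
  rewrite /coshat /sinhat.
  rewrite mulrC [X in _ * (X - _)]mulrC [X in _ * (_ - X)]mulrC.
  rewrite -RintegralT_scale; last exact: integrableT_add.
  rewrite -RintegralT_scale; last exact: integrableT_sub.
  rewrite -RintegralT_sub; [|by apply: integrableT_scale; exact: integrableT_add|by apply: integrableT_scale; exact: integrableT_sub].
  rewrite -RintegralT_scale; last by apply: integrableT_sub; apply: integrableT_scale; [exact: integrableT_add|exact: integrableT_sub].
  apply: eq_RintegralT => y; rewrite /Phi /= (mulrBr (2 * pi * w) y x) cosB sinB.
  by ring.
have Hw y : itg (fun w => Phi (w, y)) /\ \int[mu]_w Phi (w, y) = p y * fejer e (y - x).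
  have I1 := integrableT_mulcos (2 * pi * (y - x)) IS.
  have I2 := integrableT_mulsin (2 * pi * (y - x)) IS.
  have E : (fun w => Phi (w, y)) =
    fun w => p y * (sincsq (e * w) * cos (2 * pi * (y - x) * w)) +
             q y * (sincsq (e * w) * sin (2 * pi * (y - x) * w)).
    apply/funext => w; rewrite /Phi /= (_ : 2 * pi * w * (y - x) = 2 * pi * (y - x) * w).
      by ring.
    by ring.
  rewrite E; split; first by apply: integrableT_add; exact: integrableT_scale.
  rewrite RintegralT_add; [|exact: integrableT_scale|exact: integrableT_scale].
  by rewrite !RintegralT_scale // Rintegral_dilated_sincsq_cos // Rintegral_dilated_sincsq_sin // mulr0 addr0.
have mPhi : measurable_fun setT Phi.
  have mf1 (h : R -> R) : measurable_fun setT h ->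
      measurable_fun setT (fun z : measurableTypeR R * measurableTypeR R => h z.1).
    by move=> mh; apply: (measurableT_comp mh); exact: measurable_fst.
  have mf2 (h : R -> R) : measurable_fun setT h ->
      measurable_fun setT (fun z : measurableTypeR R * measurableTypeR R => h z.2).
    by move=> mh; apply: (measurableT_comp mh); exact: measurable_snd.
  have mid (c : R) : measurable_fun setT (fun y : R => y - c).
    by apply: continuous_measurable; apply: continuous_subf => z; [exact: cvg_id|exact: cvg_cst].
  have mth : measurable_fun setT (fun z : measurableTypeR R * measurableTypeR R =>
      2 * pi * z.1 * (z.2 - x)).
    apply: measurable_funM; last exact: mf2 (mid x).
    by apply: mf1; apply: continuous_measurable; apply: continuous_scalef => z; exact: cvg_id.
  have mcos := continuous_measurable (@continuous_cos R).
  have msin := continuous_measurable (@continuous_sin R).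
  apply: measurable_funM; last exact: mf1 (integrableT_measurable IS).
  apply: measurable_funD; apply: measurable_funM.
  - exact: mf2 (integrableT_measurable Ip).
  - exact: measurableT_comp mcos mth.
  - exact: mf2 (integrableT_measurable Iq).
  - exact: measurableT_comp msin mth.
have Ipq : itg (fun y => `|p y| + `|q y|) by apply: integrableT_add; exact: integrable_norm.
have IPhi : (mu \x mu)%E.-integrable setT (EFin \o Phi).
  apply/integrable12ltyP; first exact/measurable_EFinP.
  apply: (@le_lt_trans _ _ (\int[mu]_w ((\int[mu]_y (`|p y| + `|q y|)) *
      sincsq (e * w))%:E)%E); last first.
    exact: integrable_lty (integrableT_scale _ IS).
  have mAbs : measurable_fun setT (abse \o (EFin \o Phi)).
    by apply: measurableT_comp => //; exact/measurable_EFinP.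
  apply: ge0_le_integral => //.
  - by move=> w _; apply: integral_ge0.
  - exact: (measurable_fun_fubini_tonelli_F (m2 := mu) _ mAbs (fun=> abse_ge0 _)).
  - by apply/measurable_EFinP; exact: integrableT_measurable (integrableT_scale _ IS).
  move=> w _; rewrite mulrC -RintegralT_scale // -RintegralT_EFin; last exact: integrableT_scale.
  apply: ge0_le_integral => //.
  - by have /integrableP[+ _] := integrable_abse (Iy w).
  - by apply/measurable_EFinP; exact: integrableT_measurable (integrableT_scale _ Ipq).
  move=> y _; rewrite lee_fin /Phi /= normrM (ger0_norm (sincsq_ge0 _)) mulrC.
  rewrite ler_wpM2l ?sincsq_ge0 // (le_trans (ler_normD _ _)) // lerD // normrM.
    by rewrite ler_piMr // cos_max.
  by rewrite ler_piMr // sin_max.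
have HF := Fubini IPhi.
have E1 : (fun w => (\int[mu]_y (EFin \o Phi) (w, y))%E) =
    EFin \o (fun w => (coshat p q w * cos (2 * pi * w * x) -
      sinhat p q w * sin (2 * pi * w * x)) * sincsq (e * w)).
  by apply/funext => w; rewrite /= HPhi -RintegralT_EFin.
have E2 : (fun y => (\int[mu]_w (EFin \o Phi) (w, y))%E) =
    EFin \o (fun y => p y * fejer e (y - x)).
  by apply/funext => y; rewrite /= -(Hw y).2 -RintegralT_EFin //; exact: (Hw y).1.
split.
  by rewrite -E1; exact: (integrable_fubini_F IPhi).
by rewrite /Rintegral; congr fine; move: HF; rewrite E1 E2.
Qed.
End Multiplication.

(** * Passage to the limit in L^2 *)

Section L2Limit.
Context {R : realType}.
Notation mu := (@lebesgue_measure R).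
Notation itg f := (mu.-integrable setT (EFin \o f)).
Implicit Types (x y e w : R) (p q f g : R -> R).

Lemma integrableT_mul_sqr f g : measurable_fun setT f -> measurable_fun setT g ->
  itg (fun x => f x ^+ 2) -> itg (fun x => g x ^+ 2) -> itg (fun x => f x * g x).
Proof.
move=> mf mg If Ig; apply: (integrableT_le _ _ (integrableT_add If Ig)); first exact: measurable_funM.
move=> x; have h1 := sqr_ge0 (f x - g x); have h2 := sqr_ge0 (f x + g x).
have h3 := sqr_ge0 (f x); have h4 := sqr_ge0 (g x).
have e1 : (f x - g x) ^+ 2 = f x ^+ 2 + g x ^+ 2 - 2 * (f x * g x) by ring.
have e2 : (f x + g x) ^+ 2 = f x ^+ 2 + g x ^+ 2 + 2 * (f x * g x) by ring.
by rewrite ler_norml; apply/andP; lra.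
Qed.

(** Based on [|d K| <= t/2 d^2 + K^2/(2 t)], with [t] adapted to the prescribed error. *)
Lemma L2_weak_limit (d : nat -> R -> R) K :
  (forall n, measurable_fun setT (d n)) -> (forall n, itg (fun x => d n x * K x)) ->
  itg (fun x => K x ^+ 2) ->
  (\int[mu]_x (d n x ^+ 2)%:E)%E @[n --> \oo] --> 0%E ->
  \int[mu]_x (d n x * K x) @[n --> \oo] --> 0.
Proof.
move=> md IdK IK /fine_cvgP[dfin dcvg].
pose B := \int[mu]_x (K x ^+ 2).
have B0 : 0 <= B by apply: Rintegral_ge0 => x _; exact: sqr_ge0.
apply/cvgrPdist_le => e e0.
(* With this [t] each half is at most [e/2] as soon as the integral of [d^2] is below [e/t]; the
   summand 1 keeps [t] positive when [B = 0]. *)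
pose t := (B + 1) / e; have t0 : 0 < t by rewrite divr_gt0 //; lra.
have et : 0 < e / t by rewrite divr_gt0.
move/cvgrPdist_lt : dcvg => /(_ _ et) dcvg.
near=> n.
have dn : (\int[mu]_x (d n x ^+ 2)%:E \is a fin_num)%E by near: n.
have Id : itg (fun x => d n x ^+ 2).
  apply: integrableT_abs; first exact: measurable_funX.
  under eq_integral do rewrite ger0_norm ?sqr_ge0 //.
  by rewrite ltey_eq dn.
have An : \int[mu]_x (d n x ^+ 2) < e / t.
  have : `|0 - fine (\int[mu]_x (d n x ^+ 2)%:E)%E| < e / t by near: n.
  by rewrite sub0r normrN => /(le_lt_trans (ler_norm _)).
rewrite sub0r normrN (le_trans (RintegralT_abs (IdK n))) //.
apply: le_trans (_ : \int[mu]_x (t / 2 * d n x ^+ 2 + t^-1 / 2 * K x ^+ 2) <= _).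
  apply: RintegralT_le; first exact: integrable_norm.
    by apply: integrableT_add; exact: integrableT_scale.
  move=> x; have h1 := sqr_ge0 (t * `|d n x| - `|K x|).
  rewrite normrM -(real_normK (num_real (d n x))) -(real_normK (num_real (K x))).
  have : 0 <= t^-1 / 2 * (t * `|d n x| - `|K x|) ^+ 2.
    by rewrite mulr_ge0 // divr_ge0 // invr_ge0 ltW.
  have -> : t^-1 / 2 * (t * `|d n x| - `|K x|) ^+ 2 =
    t / 2 * `|d n x| ^+ 2 + t^-1 / 2 * `|K x| ^+ 2 - `|d n x| * `|K x|.
    by field; rewrite gt_eqF.
  by rewrite subr_ge0.
rewrite RintegralT_add; [|exact: integrableT_scale|exact: integrableT_scale]; rewrite !RintegralT_scale // -/B.
rewrite (splitr e) lerD //.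
  have -> : e / 2 = t / 2 * (e / t) by field; rewrite gt_eqF.
  by rewrite ler_wpM2l //; [rewrite ltW // divr_gt0|exact: ltW].
rewrite mulrAC ler_pM2r // /t invf_div mulrAC ler_pdivrMr; last by rewrite ltr_wpDl.
by rewrite ler_wpM2l ?lerDl // ltW.
Unshelve. all: by end_near. Qed.

Lemma coshat_bound p q w : itg p -> itg q ->
  `|coshat p q w| <= \int[mu]_y (`|p y| + `|q y|).
Proof.
move=> Ip Iq; have I1 := integrableT_mulcos (2 * pi * w) Ip; have I2 := integrableT_mulsin (2 * pi * w) Iq.
have I := integrableT_add I1 I2.
rewrite (le_trans (RintegralT_abs I)) //; apply: RintegralT_le; first exact: integrable_norm.
  by apply: integrableT_add; exact: integrable_norm.
move=> y; rewrite (le_trans (ler_normD _ _)) // lerD // normrM ler_piMr //.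
  exact: cos_max.
exact: sin_max.
Qed.

Lemma continuous_coshat p q : itg p -> itg q -> continuous (coshat p q).
Proof.
move=> Ip Iq w.
have H := @continuity_under_integral R _ _ mu
  (fun w y => p y * cos (2 * pi * w * y) + q y * sin (2 * pi * w * y)) setT
  measurableT (w - 1) (w + 1).
apply: (H _ _ (fun y => `|p y| + `|q y|)).
- by move=> v _; apply: integrableT_add; [exact: integrableT_mulcos|exact: integrableT_mulsin].
- apply/aeW => y _ v _.
  have E : (fun v => p y * cos (2 * pi * v * y) + q y * sin (2 * pi * v * y)) =
      (fun v => p y * cos (2 * pi * y * v) + q y * sin (2 * pi * y * v)).
    by apply/funext => v'; rewrite mulrAC.
  have cc (k : R) : continuous (fun _ : R => k) by move=> ?; exact: cvg_cst.
  rewrite E; apply: continuous_addf; [apply: continuous_mulcos|apply: continuous_mulsin];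
    exact: cc.
- by apply: integrableT_add; exact: integrable_norm.
- move=> v _; apply/aeW => y _.
  rewrite (le_trans (ler_normD _ _)) // lerD // normrM ler_piMr //.
    exact: cos_max.
  exact: sin_max.
- by rewrite inE /= in_itv /=; apply/andP; lra.
Qed.

(** Multiplying [p + i q] by [-i] turns the imaginary part of its transform into the real part, so
    facts about [coshat] carry over. *)
Lemma sinhat_coshat p q w : sinhat p q w = coshat q (fun y => - 1 * p y) w.
Proof. by apply: eq_RintegralT => y; rewrite mulN1r mulNr. Qed.

Lemma fejer_bounded e x : 0 < e -> 0 <= fejer e x <= e^-1 * sinc_mass.
Proof.
move=> e0; have m0 : 0 <= @sinc_mass R := ltW (sinc_mass_gt0).
have ei : 0 <= e^-1 by rewrite invr_ge0 ltW.
apply/andP; split; first exact: mulr_ge0 ei (mulr_ge0 m0 (tri_ge0 _)).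
by rewrite ler_wpM2l // ler_piMr // tri_le1.
Qed.

Lemma continuous_fejer e x : continuous (fun y => fejer e (y - x)).
Proof.
apply: continuous_scalef; apply: continuous_scalef => y.
have ca : continuous (fun y : R => 2 * pi / e * (y - x)).
  by apply: continuous_scalef; apply: continuous_subf => z; [exact: cvg_id|exact: cvg_cst].
by apply: continuous_comp (ca y) _; exact: continuous_tri.
Qed.

Lemma integrable_fejer e x : 0 < e -> itg (fun y => fejer e (y - x)).
Proof.
move=> e0; apply: integrableT_scale; apply: integrableT_scale.
have a0 : 0 < 2 * pi / e by rewrite divr_gt0 // mulr_gt0 // pi_gt0.
have [I _] := integrableT_affine (- (2 * pi / e * x)) a0 continuous_tri integrable_tri.
by under eq_fun do rewrite mulrBr.
Qed.

Lemma integrable_fejer_sqr e x : 0 < e -> itg (fun y => fejer e (y - x) ^+ 2).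
Proof.
move=> e0; apply: (@integrableT_mul_bounded _ (fun y => fejer e (y - x))
    (fun y => fejer e (y - x)) (e^-1 * sinc_mass) _ _ (integrable_fejer x e0)).
  exact: continuous_measurable (@continuous_fejer _ _).
by move=> y; have /andP[h0 h1] := fejer_bounded (y - x) e0; rewrite ger0_norm.
Qed.

Lemma integrable_trig_sincsq_sqr (c : R -> R) e : 0 < e -> measurable_fun setT c ->
  (forall w, `|c w| <= 1) -> itg (fun w => (c w * sincsq (e * w)) ^+ 2).
Proof.
move=> e0 mc c1; have IS := integrable_dilated_sincsq e0.
apply: (integrableT_le _ _ IS).
  by apply: measurable_funX; apply: measurable_funM => //; exact: integrableT_measurable IS.
move=> w; set s := sincsq _; rewrite (ger0_norm (sqr_ge0 _)) exprMn -(real_normK (num_real (c w))).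
have s0 : 0 <= s := sincsq_ge0 _; have s1 : s <= 1 := sincsq_le1 _.
apply: le_trans (_ : 1 * s ^+ 2 <= _).
  by rewrite ler_wpM2r ?sqr_ge0 // exprn_ile1.
by rewrite mul1r expr2 ler_piMr.
Qed.

Lemma null_combination (a b c : nat -> R) (k : R) :
  a @ \oo --> (0 : R) -> b @ \oo --> (0 : R) -> c @ \oo --> (0 : R) ->
  (forall n, a n - (b n - c n) = k) -> k = 0.
Proof.
move=> Ha Hb Hc H.
have : a - (b - c) @ \oo --> (0 - (0 - 0) : R) by apply: cvgB => //; exact: cvgB.
have E : a - (b - c) = cst k by apply/funext => n; exact: H.
rewrite E !subr0 => H0.
by rewrite -(cvg_lim (@Rhausdorff R) H0) lim_cst.
Qed.

(** Both sides of the multiplication formula pair an L^2 convergent sequence with a fixed square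
    integrable kernel, so the formula survives the limit, although [f] itself may have no transform
    given by an integral. *)
Lemma plancherel_pairing (p q : nat -> R -> R) (f g1 g2 : R -> R) e x : 0 < e ->
  (forall n, itg (p n)) -> (forall n, itg (q n)) ->
  measurable_fun setT f -> measurable_fun setT g1 -> measurable_fun setT g2 ->
  itg (fun y => f y ^+ 2) -> itg (fun w => g1 w ^+ 2) -> itg (fun w => g2 w ^+ 2) ->
  (\int[mu]_y ((p n y - f y) ^+ 2)%:E)%E @[n --> \oo] --> 0%E ->
  (\int[mu]_w ((coshat (p n) (q n) w - g1 w) ^+ 2)%:E)%E @[n --> \oo] --> 0%E ->
  (\int[mu]_w ((sinhat (p n) (q n) w - g2 w) ^+ 2)%:E)%E @[n --> \oo] --> 0%E ->
  \int[mu]_w ((g1 w * cos (2 * pi * x * w) - g2 w * sin (2 * pi * x * w)) *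
    sincsq (e * w)) = \int[mu]_y (f y * fejer e (y - x)).
Proof.
move=> e0 Ip Iq mf mg1 mg2 If Ig1 Ig2 Lf L1 L2.
have IS := integrable_dilated_sincsq e0.
pose t := 2 * pi * x.
have mS := integrableT_measurable IS.
have mC : measurable_fun setT (fun w => cos (t * w)).
  apply: continuous_measurable => w; apply: continuous_comp; last exact: continuous_cos.
  by apply: continuous_scalef => z; exact: cvg_id.
have mSn : measurable_fun setT (fun w => sin (t * w)).
  apply: continuous_measurable => w; apply: continuous_comp; last exact: continuous_sin.
  by apply: continuous_scalef => z; exact: cvg_id.
pose KC w := cos (t * w) * sincsq (e * w).
pose KS w := sin (t * w) * sincsq (e * w).
have mKC : measurable_fun setT KC by exact: measurable_funM.
have mKS : measurable_fun setT KS by exact: measurable_funM.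
have IKC2 : itg (fun w => KC w ^+ 2).
  by apply: integrable_trig_sincsq_sqr => // w; exact: cos_max.
have IKS2 : itg (fun w => KS w ^+ 2).
  by apply: integrable_trig_sincsq_sqr => // w; exact: sin_max.
have IKC : itg KC.
  by apply: (integrableT_le mKC _ IS) => w; rewrite normrM (ger0_norm (sincsq_ge0 _)) ler_piMl ?sincsq_ge0 ?cos_max.
have IKS : itg KS.
  by apply: (integrableT_le mKS _ IS) => w; rewrite normrM (ger0_norm (sincsq_ge0 _)) ler_piMl ?sincsq_ge0 ?sin_max.
have IF := integrableT_mul_sqr mf (continuous_measurable (@continuous_fejer e x)) If (integrable_fejer_sqr x e0).
have IG1 : itg (fun w => g1 w * KC w) by exact: integrableT_mul_sqr.
have IG2 : itg (fun w => g2 w * KS w) by exact: integrableT_mul_sqr.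
have Iq' n : itg (fun y => - 1 * p n y) by exact: integrableT_scale.
have cC n := continuous_coshat (Ip n) (Iq n).
have cS n : continuous (sinhat (p n) (q n)).
  have -> : sinhat (p n) (q n) = coshat (q n) (fun y => - 1 * p n y).
    by apply/funext => w; exact: sinhat_coshat.
  exact: continuous_coshat.
have IC n : itg (fun w => coshat (p n) (q n) w * KC w).
  have := @integrableT_mul_bounded _ KC (coshat (p n) (q n)) _ (continuous_measurable (cC n))
    (fun w => coshat_bound w (Ip n) (Iq n)) IKC.
  by under eq_fun do rewrite mulrC.
have ISn n : itg (fun w => sinhat (p n) (q n) w * KS w).
  have B w : `|sinhat (p n) (q n) w| <= \int[mu]_y (`|q n y| + `|- 1 * p n y|).
    by rewrite sinhat_coshat; exact: coshat_bound.
  have := @integrableT_mul_bounded _ KS (sinhat (p n) (q n)) _ (continuous_measurable (cS n)) B IKS.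
  by under eq_fun do rewrite mulrC.
have IP n : itg (fun y => p n y * fejer e (y - x)).
  apply: (@integrableT_mul_bounded _ _ (fun y => fejer e (y - x)) (e^-1 * sinc_mass) _ _ (Ip n)).
    exact: continuous_measurable (@continuous_fejer _ _).
  by move=> y; have /andP[h0 h1] := fejer_bounded (y - x) e0; rewrite ger0_norm.
have T1 : \int[mu]_y ((p n y - f y) * fejer e (y - x)) @[n --> \oo] --> 0.
  apply: L2_weak_limit Lf => [n|n|].
  - by apply: measurable_funB => //; exact: integrableT_measurable (Ip n).
  - by under eq_fun do rewrite mulrBl; exact: integrableT_sub.
  - exact: integrable_fejer_sqr.
have T2 : \int[mu]_w ((coshat (p n) (q n) w - g1 w) * KC w) @[n --> \oo] --> 0.
  apply: L2_weak_limit L1 => [n|n|//].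
  - by apply: measurable_funB => //; exact: continuous_measurable (cC n).
  - by under eq_fun do rewrite mulrBl; exact: integrableT_sub.
have T3 : \int[mu]_w ((sinhat (p n) (q n) w - g2 w) * KS w) @[n --> \oo] --> 0.
  apply: L2_weak_limit L2 => [n|n|//].
  - by apply: measurable_funB => //; exact: continuous_measurable (cS n).
  - by under eq_fun do rewrite mulrBl; exact: integrableT_sub.
set LHS := (X in X = _); set RHS := (X in _ = X).
(* By the multiplication formula the terms in [n] cancel, so this combination of three null
   sequences is constant. *)
have key n : \int[mu]_y ((p n y - f y) * fejer e (y - x)) -
    (\int[mu]_w ((coshat (p n) (q n) w - g1 w) * KC w) -
     \int[mu]_w ((sinhat (p n) (q n) w - g2 w) * KS w)) = LHS - RHS.
  have [_ M] := multiplication_formula x e0 (Ip n) (Iq n).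
  have -> : LHS = \int[mu]_w (g1 w * KC w) - \int[mu]_w (g2 w * KS w).
    by rewrite -RintegralT_sub //; apply: eq_RintegralT => w; rewrite /KC /KS /t; ring.
  have -> : \int[mu]_y ((p n y - f y) * fejer e (y - x)) =
      \int[mu]_y (p n y * fejer e (y - x)) - RHS.
    by rewrite -RintegralT_sub //; apply: eq_RintegralT => y; rewrite mulrBl.
  have -> : \int[mu]_w ((coshat (p n) (q n) w - g1 w) * KC w) =
      \int[mu]_w (coshat (p n) (q n) w * KC w) - \int[mu]_w (g1 w * KC w).
    by rewrite -RintegralT_sub //; apply: eq_RintegralT => y; rewrite mulrBl.
  have -> : \int[mu]_w ((sinhat (p n) (q n) w - g2 w) * KS w) =
      \int[mu]_w (sinhat (p n) (q n) w * KS w) - \int[mu]_w (g2 w * KS w).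
    by rewrite -RintegralT_sub //; apply: eq_RintegralT => y; rewrite mulrBl.
  rewrite -M (_ : \int[mu]_w ((coshat (p n) (q n) w * cos (2 * pi * w * x) -
      sinhat (p n) (q n) w * sin (2 * pi * w * x)) * sincsq (e * w)) =
      \int[mu]_w (coshat (p n) (q n) w * KC w) -
      \int[mu]_w (sinhat (p n) (q n) w * KS w)).
    by ring.
  rewrite -RintegralT_sub //; apply: eq_RintegralT => w; rewrite /KC /KS /t.
  by rewrite (_ : 2 * pi * w * x = 2 * pi * x * w); ring.
have : LHS - RHS = 0.
  exact: null_combination T1 T2 T3 key.
by move/eqP; rewrite subr_eq0 => /eqP.
Qed.

End L2Limit.

(** * The inversion formula at a point *)

Section Inversion.
Context {R : realType}.
Notation mu := (@lebesgue_measure R).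
Notation itg f := (mu.-integrable setT (EFin \o f)).
Implicit Types (x y e w : R) (p q f g : R -> R).

(** The inversion formula will be read off at [e = 0] from an identity for [e > 0] between functions
    continuous at 0. *)
Lemma eq_at0_of_pos (G H : R -> R) : {for 0, continuous G} -> {for 0, continuous H} ->
  (forall e, 0 < e -> G e = H e) -> G 0 = H 0.
Proof.
move=> cG cH GH; apply/eqP; rewrite -subr_eq0; apply/negPn/negP => k0.
have k0' : 0 < `|G 0 - H 0| by rewrite normr_gt0.
have cK : {for 0, continuous (fun e => G e - H e)} by exact: continuousB cG cH.
have [d /= d0 Hd] := @cvgr_dist_lt _ _ _ _ _ _ _ cK _ k0'.
have d2 : 0 < d / 2 by lra.
have h : `|0 - d / 2| < d by rewrite sub0r normrN gtr0_norm //; lra.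
by have := Hd _ h; rewrite /= (GH _ d2) subrr subr0 ltxx.
Qed.

(** The substitution [y = x + e v/(2 pi)] moves [e] from the kernel into the argument of [f], where
    [e = 0] makes sense. *)
Lemma fejer_rescaled f e x : 0 < e -> continuous f ->
  itg (fun y => f y * fejer e (y - x)) ->
  \int[mu]_y (f y * fejer e (y - x)) =
  sinc_mass / (2 * pi) * \int[mu]_v (f (e / (2 * pi) * v + x) * tri v) /\
  itg (fun v => f (e / (2 * pi) * v + x) * tri v).
Proof.
move=> e0 cf If; have pi0 : 0 < pi :> R := pi_gt0 R.
have a0 : 0 < e / (2 * pi) by rewrite divr_gt0 // mulr_gt0.
have ch : continuous (fun y => f y * fejer e (y - x)).
  by apply: continuous_mulf => //; exact: continuous_fejer.
have [I ->] := integrableT_affine x a0 ch If.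
have aux1 (P V : R) : P != 0 -> 2 * P / e * (e / (2 * P) * V) = V.
  by move=> P0; field; rewrite P0 gt_eqF.
have E : (fun v => f (e / (2 * pi) * v + x) * fejer e (e / (2 * pi) * v + x - x)) =
    fun v => e^-1 * sinc_mass * (f (e / (2 * pi) * v + x) * tri v).
  apply/funext => v; rewrite /fejer addrK.
  have -> : 2 * pi / e * (e / (2 * pi) * v) = v.
    by rewrite aux1 ?gt_eqF.
  by ring.
have m0 : 0 < @sinc_mass R := sinc_mass_gt0.
have aux2 (P m J : R) : 0 < P -> e / (2 * P) * (e^-1 * m * J) = m / (2 * P) * J.
  by move=> P0; field; rewrite !gt_eqF.
have aux3 (m : R) : 0 < m -> e / m * (e^-1 * m) = 1.
  by move=> m1; field; rewrite !gt_eqF.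
have I' : itg (fun v => f (e / (2 * pi) * v + x) * tri v).
  have E' v : e / sinc_mass * (f (e / (2 * pi) * v + x) *
      fejer e (e / (2 * pi) * v + x - x)) = f (e / (2 * pi) * v + x) * tri v.
    by rewrite (congr1 (fun h => h v) E) /= mulrA aux3 // mul1r.
  by have := integrableT_scale (e / sinc_mass) I; under eq_fun do rewrite E'.
split=> //; rewrite (eq_RintegralT (fun v => congr1 (fun h => h v) E)) RintegralT_scale //.
exact: aux2.
Qed.

Lemma inversion f g1 g2 x : continuous f -> itg g1 -> itg g2 ->
  (forall e, 0 < e -> itg (fun y => f y * fejer e (y - x))) ->
  (forall e, 0 < e ->
    \int[mu]_w ((g1 w * cos (2 * pi * x * w) - g2 w * sin (2 * pi * x * w)) *
      sincsq (e * w)) = \int[mu]_y (f y * fejer e (y - x))) ->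
  sinc_mass / (2 * pi) * (\int[mu]_v tri v) * f x =
  \int[mu]_w (g1 w * cos (2 * pi * x * w) - g2 w * sin (2 * pi * x * w)).
Proof.
move=> cf I1 I2 If H.
have pi0 : 0 < pi :> R := pi_gt0 R.
pose k w := g1 w * cos (2 * pi * x * w) - g2 w * sin (2 * pi * x * w).
have Ik : itg k by apply: integrableT_sub; [exact: integrableT_mulcos|exact: integrableT_mulsin].
(* [G 0] is the inversion integral, because [sincsq 0 = 1], and [F 0] is [f x] times the mass of the
   triangle. *)
pose G e := \int[mu]_w (k w * sincsq (e * w)).
pose F e := \int[mu]_v (f (e / (2 * pi) * v + x) * tri v).
have lin (c d : R) : continuous (fun e : R => e * c + d).
  by apply: continuous_addf => z; [apply: cvgM; [exact: cvg_id|exact: cvg_cst]|exact: cvg_cst].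
have cG : {for 0, continuous G}.
  have HG := @continuity_under_integral R _ _ mu
    (fun e w => k w * sincsq (e * w)) setT measurableT (-1) 1.
  apply: (HG _ _ (fun w => `|k w|)).
  - move=> e _; apply: (@integrableT_mul_bounded _ k (fun w => sincsq (e * w)) 1 _ _ Ik).
      apply: continuous_measurable => w.
      apply: (@continuous_comp _ _ _ (fun w => e * w) sincsq); last exact: continuous_sincsq.
      by apply: continuous_scalef => z; exact: cvg_id.
    by move=> w; rewrite ger0_norm ?sincsq_ge0 ?sincsq_le1.
  - apply/aeW => w _ v _; apply: continuous_scalef => z.
    apply: (@continuous_comp _ _ _ (fun e => e * w) sincsq); last exact: continuous_sincsq.
    by apply: cvgM; [exact: cvg_id|exact: cvg_cst].
  - exact: integrable_norm.
  - move=> e _; apply/aeW => w _; rewrite normrM ler_piMr //.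
    by rewrite ger0_norm ?sincsq_ge0 ?sincsq_le1.
  - by rewrite inE /= in_itv /= ltrN10 ltr01.
have xx : x - 1 <= x + 1 by lra.
have [M M0 HM] := continuous_segment_bound xx cf.
(* The triangle lives on [|v| <= 2]; there [|e v/(2 pi)| <= 1] since [pi >= 2], so [f] is evaluated
   only where [M] bounds it. *)
have dom e v : -1 < e < 1 -> `|f (e / (2 * pi) * v + x) * tri v| <= M * tri v.
  move=> e1; rewrite normrM (ger0_norm (tri_ge0 v)).
  have [v2|/ltW v2] := leP 2 `|v|; first by rewrite tri_out // !mulr0.
  rewrite ler_wpM2r ?tri_ge0 //; apply: HM.
  have : `|e / (2 * pi) * v| <= 1.
    rewrite !normrM normfV normrM normr_nat (gtr0_norm pi0).
    have e1' : `|e| <= 1 by rewrite ler_norml; move: e1 => /andP[? ?]; apply/andP; lra.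
    have p2 : 2 <= pi :> R by exact: pi_ge2.
    rewrite mulrAC ler_pdivrMr ?mulr_gt0 // mul1r.
    apply: le_trans (_ : 1 * 2 <= _); first exact: ler_pM.
    lra.
  by rewrite ler_norml => /andP[? ?]; apply/andP; lra.
have cF : {for 0, continuous F}.
  have HF := @continuity_under_integral R _ _ mu
    (fun e v => f (e / (2 * pi) * v + x) * tri v) setT measurableT (-1) 1.
  have cfa (a : R) : continuous (fun v => f (a * v + x)).
    move=> v; apply: (@continuous_comp _ _ _ (fun v => a * v + x) f); last exact: cf.
    by apply: continuous_addf => z; [apply: continuous_scalef => z'; exact: cvg_id|exact: cvg_cst].
  apply: (HF _ _ (fun v => M * tri v)).
  - move=> e; rewrite /= in_itv /= => e1.
    apply: (integrableT_le _ (fun v => dom e v e1)); last by apply: integrableT_scale; exact: integrable_tri.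
    by apply: continuous_measurable; apply: continuous_mulf; [exact: cfa|exact: continuous_tri].
  - apply/aeW => v _ e _.
    have E : (fun e => f (e / (2 * pi) * v + x) * tri v) =
        (fun e => tri v * f (e * (v / (2 * pi)) + x)).
      by apply/funext => e'; rewrite mulrC; congr (_ * f _); rewrite mulrAC mulrA.
    rewrite E; apply: continuous_scalef => z.
    by apply: (@continuous_comp _ _ _ (fun e => e * (v / (2 * pi)) + x) f); [exact: lin|exact: cf].
  - by apply: integrableT_scale; exact: integrable_tri.
  - by move=> e; rewrite /= in_itv /= => e1; apply/aeW => v _; exact: dom.
  - by rewrite inE /= in_itv /= ltrN10 ltr01.
have E0 : G 0 = sinc_mass / (2 * pi) * F 0.
  apply: (@eq_at0_of_pos G (fun e => sinc_mass / (2 * pi) * F e)) => //.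
    by apply: continuousM => //; exact: cvg_cst.
  by move=> e e0; rewrite /G (H e e0) (fejer_rescaled e0 cf (If e e0)).1.
have -> : \int[mu]_w (g1 w * cos (2 * pi * x * w) - g2 w * sin (2 * pi * x * w)) = G 0.
  by apply: eq_RintegralT => w; rewrite mul0r /sincsq sinc0 expr1n mulr1.
rewrite E0 -mulrA; congr (_ * _).
rewrite mulrC -RintegralT_scale; last exact: integrable_tri.
by apply: eq_RintegralT => v; rewrite mul0r mul0r add0r.
Qed.

End Inversion.

(** * Derivative bounds from bounded frequency support *)

Section Bandlimited.
Context {R : realType}.
Notation mu := (@lebesgue_measure R).
Notation itg f := (mu.-integrable setT (EFin \o f)).
Implicit Types (x y e w : R) (p q f g : R -> R).

Lemma is_derive_coshat p q x : itg p -> itg q ->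
  itg (fun y => 2 * pi * y * p y) -> itg (fun y => 2 * pi * y * q y) ->
  is_derive x 1 (coshat p q)
    (coshat (fun y => 2 * pi * y * q y) (fun y => - (2 * pi * y * p y)) x).
Proof.
move=> Ip Iq Ip1 Iq1.
pose f w y := p y * cos (2 * pi * w * y) + q y * sin (2 * pi * w * y).
pose f1 w y := 2 * pi * y * q y * cos (2 * pi * w * y) +
  - (2 * pi * y * p y) * sin (2 * pi * w * y).
have Hf w y : is_derive w 1 (fun w => f w y) (f1 w y).
  have L : is_derive w 1 (fun w : R => 2 * pi * w * y) (2 * pi * y).
    have E : (fun w : R => 2 * pi * w * y) = fun w => 2 * pi * y * (w - 0).
      by apply/funext => v; rewrite subr0 mulrAC.
    by rewrite E; exact: is_derive_affine.
  have Hc := @is_derive_compf _ cos (fun w => 2 * pi * w * y) w _ _ (is_derive_cos _) L.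
  have Hs := @is_derive_compf _ sin (fun w => 2 * pi * w * y) w _ _ (is_derive_sin _) L.
  by apply: is_derive_congr (is_derive_addf (is_derive_scalef (p y) Hc) (is_derive_scalef (q y) Hs)) _; rewrite /f1; ring.
have df1 w y : partial1of2 f w y = f1 w y by rewrite partial1of2E; case: (Hf w y).
pose G y := `|2 * pi * y * q y| + `|2 * pi * y * p y|.
have Ia : [set` `]x - 1, x + 1[] x by rewrite /= in_itv /=; apply/andP; lra.
have intf w : [set` `]x - 1, x + 1[] w -> itg (f w).
  by move=> _; apply: integrableT_add; [exact: integrableT_mulcos|exact: integrableT_mulsin].
have derf w y : [set` `]x - 1, x + 1[] w -> setT y -> derivable (f ^~ y) w 1.
  by move=> _ _; case: (Hf w y).
have G0 y : 0 <= G y by rewrite addr_ge0.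
have IG : itg G by apply: integrableT_add; exact: integrable_norm.
have Gub w y : [set` `]x - 1, x + 1[] w -> setT y -> `|partial1of2 f w y| <= G y.
  move=> _ _; rewrite df1 (le_trans (ler_normD _ _)) // lerD // normrM ?normrN ler_piMr //.
    exact: cos_max.
  exact: sin_max.
have D := @derivable_under_integral R _ _ mu f setT measurableT x (x - 1) (x + 1)
  Ia intf derf G G0 IG Gub.
have E := @differentiation_under_integral R _ _ mu f setT measurableT x (x - 1) (x + 1)
  Ia intf derf G G0 IG Gub.
apply: is_derive_congr (derivableP D) _; rewrite -derive1E E.
by apply: eq_RintegralT => y; rewrite df1.
Qed.

(** Bernstein's bounds. Differentiating the transform multiplies the density [p + i q] by
    [-2 pi i y], which is [step] in the proof and has modulus at most [2 pi s] on the support. *)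
Lemma bandlimited_smooth p q s k : 0 <= s -> itg p -> itg q ->
  (forall y, s < `|y| -> p y = 0 /\ q y = 0) ->
  exists phi : nat -> R -> R,
  [/\ forall x, phi 0%N x = k * coshat p q x,
      forall n x, is_derive x 1 (phi n) (phi n.+1 x) &
      exists C, forall n x, `|phi n x| <= C * (2 * pi * s) ^+ n].
Proof.
move=> s0 Ip Iq supp.
pose step (r : (R -> R) * (R -> R)) : (R -> R) * (R -> R) :=
  (fun y => 2 * pi * y * r.2 y, fun y => - (2 * pi * y * r.1 y)).
pose r n := iter n step (p, q).
have rs n y : s < `|y| -> (r n).1 y = 0 /\ (r n).2 y = 0.
  move=> ys; elim: n => [|n [IH1 IH2]]; first exact: supp.
  by rewrite /r iterS /= -/(r n) IH1 IH2 !mulr0 oppr0.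
have pi0 : 0 <= 2 * pi :> R by rewrite mulr_ge0 // ltW // pi_gt0.
have rb n y : `|(r n).1 y| + `|(r n).2 y| <= (2 * pi * s) ^+ n * (`|p y| + `|q y|).
  elim: n => [|n IH]; first by rewrite mul1r.
  have -> : `|(r n.+1).1 y| + `|(r n.+1).2 y| =
      2 * pi * `|y| * (`|(r n).1 y| + `|(r n).2 y|).
    rewrite /r iterS /= -/(r n) normrN !(normrM (2 * pi * y)) !(normrM (2 * pi)) (ger0_norm pi0).
    by rewrite addrC -mulrDr.
  rewrite exprS -(mulrA (2 * pi * s)).
  have [ys|ys] := ltP s `|y|.
    have [-> ->] := rs n y ys; have [-> ->] := supp y ys.
    by rewrite normr0 addr0 !mulr0.
  apply: ler_pM (IH); [exact: mulr_ge0|exact: addr_ge0|exact: ler_wpM2l].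
have mb (h : R -> R) n : itg h -> (forall y, `|h y| <= (2 * pi * s) ^+ n * (`|p y| + `|q y|)) ->
    itg (fun y => 2 * pi * y * h y).
  move=> Ih hb; apply: (@integrableT_le _ _ (fun y => (2 * pi * s) ^+ n.+1 * (`|p y| + `|q y|))).
  - apply: measurable_funM; last exact: integrableT_measurable.
    by apply: continuous_measurable; apply: continuous_scalef => z; exact: cvg_id.
  - move=> y; rewrite !(normrM (2 * pi * y)) !(normrM (2 * pi)) (ger0_norm pi0).
    rewrite exprS -(mulrA (2 * pi * s)).
    have [ys|ys] := ltP s `|y|.
      have := hb y; have [-> ->] := supp y ys.
      rewrite normr0 addr0 !mulr0 normr_le0 => /eqP ->.
      by rewrite normr0 mulr0.
    apply: ler_pM (hb y); [exact: mulr_ge0|exact: normr_ge0|exact: ler_wpM2l].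
  - by apply: integrableT_scale; apply: integrableT_add; exact: integrable_norm.
have rint n : itg (r n).1 /\ itg (r n).2.
  elim: n => [//|n [I1 I2]]; rewrite /r iterS /= -/(r n).
  have J1 : itg (fun y => 2 * pi * y * (r n).2 y).
    by apply: (mb _ n) => // y; apply: le_trans (rb n y); rewrite lerDr.
  have J2 : itg (fun y => 2 * pi * y * (r n).1 y).
    by apply: (mb _ n) => // y; apply: le_trans (rb n y); rewrite lerDl.
  split=> //; have := integrableT_scale (-1) J2.
  by under eq_fun do rewrite mulN1r.
exists (fun n x => k * coshat (r n).1 (r n).2 x); split=> //.
  move=> n x; apply: is_derive_scalef.
  have [I1 I2] := rint n; apply: is_derive_coshat => //.
    by apply: (mb _ n) => // y; apply: le_trans (rb n y); rewrite lerDl.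
  by apply: (mb _ n) => // y; apply: le_trans (rb n y); rewrite lerDr.
exists (`|k| * \int[mu]_y (`|p y| + `|q y|)) => n x.
have [I1 I2] := rint n; rewrite normrM -(mulrA `|k|) ler_wpM2l //.
apply: le_trans (coshat_bound _ I1 I2) _.
have Ipq : itg (fun y => `|p y| + `|q y|) by apply: integrableT_add; exact: integrable_norm.
rewrite mulrC -RintegralT_scale //; apply: RintegralT_le => //.
  by apply: integrableT_add; exact: integrable_norm.
exact: integrableT_scale.
Qed.

End Bandlimited.

Local Open Scope complex_scope.
Local Notation normc := ComplexField.Normc.normc.
Local Notation Re := complex.Re.
Local Notation Im := complex.Im.

(** * Entire functions *)

Section ComplexDerivative.
Context {R : realType}.
Implicit Types (F : R[i]^o -> R[i]^o) (z h l : R[i]).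

Lemma norm_normc z : `|z| = (normc z)%:C.
Proof. by rewrite normc_def; case: z. Qed.

Lemma normc_ge0 z : 0 <= normc z.
Proof. by case: z => a b; rewrite sqrtr_ge0. Qed.

Lemma complex_gt0P z : 0 < z -> exists2 e : R, 0 < e & z = e%:C.
Proof.
case: z => a b; rewrite ltcE /= => /andP[/eqP -> a0].
by exists a.
Qed.

(** A form without quotients and with real [e] and [d], from which the estimates for real and
    imaginary parts are read off; [h = 0] is no exception. *)
Definition cderiv F z l := forall e : R, 0 < e -> exists2 d : R, 0 < d &
  forall h, normc h < d -> normc (F (z + h) - F z - l * h) <= e * normc h.

Lemma is_derive_cderiv F z l : is_derive (z : R[i]^o) 1 F l <-> cderiv F z l.
Proof.
split.
  move=> [dF dE] e e0.
  have H0 : (fun h : R[i]^o => h^-1 *: ((F \o shift (z : R[i]^o)) (h *: (1 : R[i]^o))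
      - F z)) @ (0 : R[i]^o)^' --> (l : R[i]^o).
    by rewrite -dE; exact: dF.
  have eC : 0 < e%:C :> R[i] by rewrite ltcR.
  move/cvgrPdist_le : H0 => /(_ _ eC) [/= d0 d00 H].
  have [d d1 dE'] := complex_gt0P d00.
  exists d => // h hd; have [->|h0] := eqVneq h 0.
    by rewrite addr0 mulr0 !subrr ComplexField.Normc.normc0 mulr0.
  have := H h; rewrite /ball_ /= sub0r normrN norm_normc dE' ltcR => /(_ hd h0).
  rewrite norm_normc lecR => {}H.
  have -> : F (z + h) - F z - l * h =
      - (l - h^-1 *: (F (h%:A + z) - F z)) * h.
    rewrite opprB mulrBl /GRing.scale /= mulr1 (mulrC h^-1) divfK //.
    by rewrite (addrC h).
  rewrite ComplexField.Normc.normcM normcN ler_wpM2r ?normc_ge0 //.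
move=> H.
have H0 : (fun h : R[i]^o => h^-1 *: ((F \o shift (z : R[i]^o)) (h *: (1 : R[i]^o))
      - F z)) @ (0 : R[i]^o)^' --> (l : R[i]^o).
  apply/cvgrPdist_le => e /complex_gt0P[e' e0 ->].
  have [d d0 {}H] := H _ e0.
  exists d%:C; first by rewrite /= ltcR.
  move=> h; rewrite /ball_ /= sub0r normrN norm_normc ltcR => hd h0.
  rewrite norm_normc lecR.
  have -> : l - h^-1 *: (F (h%:A + z) - F z) =
     - (F (z + h) - F z - l * h) * h^-1.
    rewrite mulNr mulrBl mulfK // opprB /GRing.scale /= mulr1.
    by rewrite (addrC h) (mulrC h^-1).
  rewrite ComplexField.Normc.normcM normcN ComplexField.Normc.normcV.
  rewrite ler_pdivrMr; first exact: H.
  rewrite lt_neqAle normc_ge0 andbT eq_sym; apply: contra h0 => /eqP.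
  by move/ComplexField.Normc.eq0_normc ->.
by split; [apply/cvg_ex; exists l|apply/cvg_lim].
Qed.
End ComplexDerivative.

Section EntireFunctions.
Context {R : realType}.
Implicit Types (F : R[i]^o -> R[i]^o) (z h l : R[i]) (x y : R).

Lemma is_derive_le (f : R -> R) (x l : R) :
  (forall e : R, 0 < e -> exists2 d : R, 0 < d & forall h : R, `|h| < d ->
     `|f (x + h) - f x - l * h| <= e * `|h|) -> is_derive x 1 f l.
Proof.
move=> H.
have H0 : (fun h : R => h^-1 *: ((f \o shift x) (h *: (1 : R)) - f x)) @ 0^' --> l.
  apply/cvgrPdist_le => e e0; have [d d0 {}H] := H _ e0.
  exists d => // h; rewrite /ball_ /= sub0r normrN => hd h0.
  have -> : l - h^-1 *: (f (h%:A + x) - f x) = - (f (x + h) - f x - l * h) * h^-1.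
    rewrite mulNr mulrBl mulfK // opprB /GRing.scale /= mulr1.
    by rewrite (addrC h) (mulrC h^-1).
  by rewrite normrM normrN normfV ler_pdivrMr ?normr_gt0 // H.
by split; [apply/cvg_ex; exists l|apply/cvg_lim].
Qed.

Lemma normc_le z : normc z <= `|Re z| + `|Im z|.
Proof.
case: z => a b /=; rewrite -[leRHS]ger0_norm ?addr_ge0 //.
rewrite -sqrtr_sqr ler_wsqrtr // sqrrD !real_normK ?num_real //.
by rewrite addrAC lerDl mulrn_wge0 // mulr_ge0.
Qed.

Lemma Re_le_normc z : `|Re z| <= normc z.
Proof. by case: z => a b /=; rewrite -sqrtr_sqr ler_wsqrtr // lerDl sqr_ge0. Qed.

Lemma Im_le_normc z : `|Im z| <= normc z.
Proof. by case: z => a b /=; rewrite -sqrtr_sqr ler_wsqrtr // lerDr sqr_ge0. Qed.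

Lemma cderiv_Re_Im F x0 y0 l : cderiv F (x0 +i* y0) l ->
  forall e : R, 0 < e -> exists2 d : R, 0 < d & forall x y, `|x - x0| < d -> `|y - y0| < d ->
    `|Re (F (x +i* y)) - Re (F (x0 +i* y0)) -
      (Re l * (x - x0) - Im l * (y - y0))| <=
        e * (`|x - x0| + `|y - y0|) /\
    `|Im (F (x +i* y)) - Im (F (x0 +i* y0)) -
      (Im l * (x - x0) + Re l * (y - y0))| <=
        e * (`|x - x0| + `|y - y0|).
Proof.
move=> H e e0; have [d d0 {}H] := H e e0; exists (d / 2); first by rewrite divr_gt0.
move=> x y xd yd; pose h : R[i] := (x - x0) +i* (y - y0).
have hn : normc h <= `|x - x0| + `|y - y0| by exact: normc_le.
have hd : normc h < d by apply: le_lt_trans hn _; lra.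
have := H h hd.
have -> : (x0 +i* y0) + h = x +i* y by rewrite /h; simpc; rewrite !subrKC.
move=> Fh; have {}Fh : normc (F (x +i* y) - F (x0 +i* y0) - l * h) <=
    e * (`|x - x0| + `|y - y0|) by apply: le_trans Fh _; rewrite ler_pM2l.
split; [apply: le_trans Fh; apply: le_trans (Re_le_normc _)
       |apply: le_trans Fh; apply: le_trans (Im_le_normc _)];
  rewrite /h; case: (F _) => a b; case: (F _) => a' b'; case: l {H} => c c' //=.
by rewrite [c * _ + _]addrC.
Qed.

Lemma entire_holo F : entire F ->
  holo (fun x y => Re (F (x +i* y))) (fun x y => Im (F (x +i* y))).
Proof.
move=> HF x0 y0.
have /derivableP/is_derive_cderiv/cderiv_Re_Im H := HF (x0 +i* y0).
by exists (Re ('D_1 F (x0 +i* y0))), (Im ('D_1 F (x0 +i* y0))).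
Qed.

Lemma holo_derive_x u v x0 y0 : @holo R u v -> exists l : R, is_derive x0 1 (fun x => u x y0) l.
Proof.
move=> /(_ x0 y0)[al [be H]]; exists al; apply: is_derive_le => e /H[d d0 {}H].
exists d => // h hd; have [] := H (x0 + h) y0.
- by rewrite [x0 + h]addrC addrK.
- by rewrite subrr normr0.
have -> : x0 + h - x0 = h by rewrite addrC addKr.
by rewrite subrr mulr0 subr0 normr0 addr0.
Qed.

Lemma holo_derive_y u v x0 y0 : @holo R u v -> exists l : R, is_derive y0 1 (fun y => v x0 y) l.
Proof.
move=> /(_ x0 y0)[al [be H]]; exists al; apply: is_derive_le => e /H[d d0 {}H].
exists d => // h hd; have [] := H x0 (y0 + h).
- by rewrite subrr normr0.
- by rewrite [y0 + h]addrC addrK.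
have -> : y0 + h - y0 = h by rewrite addrC addKr.
by move=> _; rewrite subrr mulr0 add0r normr0 add0r.
Qed.

Lemma holo_Re_continuous_x u v y : @holo R u v -> continuous (fun x => u x y).
Proof. by move=> H x; have [l] := holo_derive_x x y H; exact: is_derive_continuous_at. Qed.

Lemma holo_Im_continuous_y u v x : @holo R u v -> continuous (fun y => v x y).
Proof. by move=> H y; have [l] := holo_derive_y x y H; exact: is_derive_continuous_at. Qed.

End EntireFunctions.

(** * Entire functions vanishing on the real axis *)

Section Identity.
Context {R : realType}.
Implicit Types (F G : R[i]^o -> R[i]^o) (z h l : R[i]) (x y : R).

Lemma entire_cst (c : R[i]) : @entire R (fun=> c).
Proof. by move=> z; exact: derivable_cst. Qed.

Lemma entire_id : @entire R id.
Proof. by move=> z; exact: derivable_id. Qed.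

Lemma entireD F G : entire F -> entire G -> entire (fun z => F z + G z).
Proof. by move=> HF HG z; exact: derivableD. Qed.

Lemma entireB F G : entire F -> entire G -> entire (fun z => F z - G z).
Proof. by move=> HF HG z; exact: derivableB. Qed.

Lemma entireM F G : entire F -> entire G -> entire (fun z => F z * G z).
Proof. by move=> HF HG z; exact: derivableM. Qed.

Lemma entireX F n : entire F -> entire (fun z => F z ^+ n).
Proof.
move=> HF; elim: n => [|n IH]; first exact: entire_cst.
have -> : (fun z => F z ^+ n.+1) = (fun z => F z * F z ^+ n).
  by apply/funext => z; rewrite exprS.
exact: entireM.
Qed.

Lemma entire_comp F G : entire F -> entire G -> entire (fun z => F (G z)).
Proof.
move=> HF HG z; apply/derivable1_diffP.
by apply: differentiable_comp; apply/derivable1_diffP; [exact: HG|exact: HF].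
Qed.

Lemma primitive_ge (f df : R -> R) k a b : a <= b ->
  (forall x, is_derive x 1 f (df x)) ->
  (forall x, a <= x <= b -> k <= df x) -> k * (b - a) <= f b - f a.
Proof.
move=> ab Hf Hk; have [c cab ->] := mean_value ab (fun x _ => Hf x).
by rewrite ler_wpM2r ?subr_ge0 // Hk.
Qed.

(** A crude Laplace method. For [|x| < r] the function [h] is at least 1/2; the bump is at least
    [p^n] for [|x| <= r/2] and at most [q^n] for [r <= |x| <= 2]. The bound [9/10 <= q] lets [q^n]
    also dominate the vertical sides of the rectangle to come. *)
Lemma peak_integral (h : R -> R) M : continuous h -> h 0 = 1 -> 0 < M ->
  (forall x, -2 <= x <= 2 -> `|h x| <= M) ->
  exists th p q : R, [/\ 0 < th, 9 / 10 <= q, q < p &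
    forall n (G : R -> R),
      (forall x, is_derive x 1 G (h x * (1 - x ^+ 2 / 25) ^+ n)) ->
      th * p ^+ n - 4 * M * q ^+ n <= G 2 - G (-2)].
Proof.
move=> ch h0 M0 hM.
have [rho rho0 Hrho] : exists2 rho, 0 < rho & forall x, `|x| < rho -> 2^-1 <= h x.
  have := @cvgr_dist_lt _ _ _ _ _ _ _ (ch 0) 2^-1 ltac:(by []).
  move=> [rho rho0 H]; exists rho => // x xr; have := H x.
  by rewrite /ball_ /= sub0r normrN h0 => /(_ xr); rewrite ltr_norml => /andP[]; lra.
pose r := Num.min rho 1; have r0 : 0 < r by rewrite lt_min rho0 ltr01.
have r1 : r <= 1 by rewrite ge_min lexx orbT.
have rrho : r <= rho by rewrite ge_min lexx.
have r2 : r ^+ 2 <= 1 by rewrite exprn_ile1 // ltW.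
have r20 : 0 < r ^+ 2 by rewrite exprn_gt0.
exists (r / 2), (1 - (r / 2) ^+ 2 / 25), (1 - r ^+ 2 / 25); split.
- by rewrite divr_gt0.
- lra.
- by rewrite expr_div_n; lra.
move=> n G HG; set p := 1 - _; set q := 1 - r ^+ 2 / 25.
have q0 : 0 <= q by rewrite /q; lra.
have p0 : 0 <= p by rewrite /p expr_div_n; lra.
have P0 x : -2 <= x <= 2 -> 0 <= 1 - x ^+ 2 / 25.
  move=> /andP[? ?]; have : x ^+ 2 <= 4 by nra.
  lra.
have Mq0 : 0 <= M * q ^+ n by rewrite mulr_ge0 ?exprn_ge0 // ltW.
have low x : -2 <= x <= 2 -> - (M * q ^+ n) <= h x * (1 - x ^+ 2 / 25) ^+ n.
  move=> x2; have Px := P0 x x2; have [xr|rx] := ltP `|x| r.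
    rewrite (le_trans (_ : _ <= 0)) ?oppr_le0 // mulr_ge0 ?exprn_ge0 //.
    by apply: le_trans (Hrho x _); [rewrite invr_ge0|exact: lt_le_trans xr rrho].
  have : `|h x * (1 - x ^+ 2 / 25) ^+ n| <= M * q ^+ n.
    rewrite normrM (ger0_norm (exprn_ge0 _ Px)); apply: ler_pM => //.
    - by rewrite exprn_ge0.
    - exact: hM.
    rewrite lerXn2r ?nnegrE // /q.
    have : r ^+ 2 <= x ^+ 2.
      by rewrite -(real_normK (num_real x)) ler_sqr ?nnegrE // ltW.
    lra.
  by rewrite ler_norml => /andP[].
have high x : - (r / 2) <= x <= r / 2 -> 2^-1 * p ^+ n <= h x * (1 - x ^+ 2 / 25) ^+ n.
  rewrite -ler_norml => xr; apply: ler_pM => //; rewrite ?exprn_ge0 ?invr_ge0 //.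
    by apply: Hrho; apply: le_lt_trans xr _; lra.
  have : x ^+ 2 <= (r / 2) ^+ 2.
    by rewrite -(real_normK (num_real x)) ler_sqr ?nnegrE // divr_ge0 // ltW.
  by move=> x2; rewrite lerXn2r ?nnegrE // /p; lra.
have s1 : -2 <= - (r / 2) by lra.
have s2 : - (r / 2) <= r / 2 by lra.
have s3 : r / 2 <= 2 by lra.
have I1 : - (M * q ^+ n) * (- (r / 2) - -2) <= G (- (r / 2)) - G (-2).
  by apply: primitive_ge s1 HG _ => x /andP[? ?]; apply: low; apply/andP; lra.
have I2 := primitive_ge s2 HG high.
have I3 : - (M * q ^+ n) * (2 - r / 2) <= G 2 - G (r / 2).
  by apply: primitive_ge s3 HG _ => x /andP[? ?]; apply: low; apply/andP; lra.
have : 0 <= M * q ^+ n * r by rewrite mulr_ge0 // ltW.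
lra.
Qed.

Lemma holo_continuous_conjugate u v : @holo R u v ->
  (forall y, continuous (fun x => v x y)) /\ (forall x, continuous (fun y => u x y)).
Proof.
move=> H; split=> [y x|x y]; have [al [be {}H]] := H x y.
  apply: (@is_derive_continuous_at _ _ _ be); apply: is_derive_le => e /H[d d0 {}H].
  exists d => // h hd; have [] := H (x + h) y.
  - by rewrite [x + h]addrC addrK.
  - by rewrite subrr normr0.
  have -> : x + h - x = h by rewrite addrC addKr.
  by move=> _; rewrite subrr mulr0 addr0 normr0 addr0.
apply: (@is_derive_continuous_at _ _ _ (- be)); apply: is_derive_le => e /H[d d0 {}H].
exists d => // h hd; have [] := H x (y + h).
- by rewrite subrr normr0.
- by rewrite [y + h]addrC addrK.
have -> : y + h - y = h by rewrite addrC addKr.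
by rewrite subrr mulr0 normr0 !add0r mulNr.
Qed.

(* Cauchy's theorem for [F * (1 - z^2/25)^n] on [[-2, 2] x [-1, 0]]: the
   polynomial is at most [0.9] in modulus on the vertical sides, so if [F]
   vanished on the bottom side the mass accumulating at [0] on the top side
   could not be compensated. *)
Lemma entire_normalized_nonvanishing F : entire F ->
  (forall x, F (x +i* (-1)) = 0) -> F 0 = 1 -> False.
Proof.
move=> HF Fbot F0.
pose P (z : R[i]^o) : R[i]^o := 1 - (25^-1)%:C * (z * z).
have HP : entire P.
  exact: (entireB (@entire_cst 1)
    (entireM (@entire_cst (25^-1)%:C) (entireM entire_id entire_id))).
pose K n z := F z * P z ^+ n.
have HK n : entire (K n) by exact: entireM HF (@entireX P n HP).
have holF := entire_holo HF.
have [cIx cRy] := holo_continuous_conjugate holF.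
have cRx y : continuous (fun x => Re (F (x +i* y))) := holo_Re_continuous_x holF.
have cIy x : continuous (fun y => Im (F (x +i* y))) := holo_Im_continuous_y holF.
have le10 : (-1 : R) <= 0 by lra.
have le22 : (-2 : R) <= 2 by lra.
have [M1 M10 HM1] := continuous_segment_bound le10 (cRy 2).
have [M2 M20 HM2] := continuous_segment_bound le10 (cIy 2).
have [M3 M30 HM3] := continuous_segment_bound le10 (cRy (-2)).
have [M4 M40 HM4] := continuous_segment_bound le10 (cIy (-2)).
have [M5 M50 HM5] := continuous_segment_bound le22 (cRx 0).
pose M := M1 + M2 + M3 + M4 + M5; have M0 : 0 < M by rewrite /M; lra.
have F00 : Re (F (0 +i* 0)) = 1 by rewrite [0 +i* 0](_ : _ = 0) // F0.
have [|th [p [q [th0 q9 qp main]]]] := peak_integral (cRx 0) F00 M0.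
  by move=> x /HM5; rewrite /M; lra.
have side x y n : x = 2 \/ x = -2 -> -1 <= y <= 0 ->
    `|Im (K n (x +i* y))| <= M * q ^+ n.
  move=> x2 y1; apply: le_trans (Im_le_normc _) _.
  rewrite /K ComplexField.Normc.normcM; apply: ler_pM; rewrite ?normc_ge0 //.
    apply: le_trans (normc_le _) _.
    case: x2 => ->.
      by have := HM1 _ y1; have := HM2 _ y1; rewrite /M; lra.
    by have := HM3 _ y1; have := HM4 _ y1; rewrite /M; lra.
  have -> : normc (P (x +i* y) ^+ n) = normc (P (x +i* y)) ^+ n.
    elim: n => [|n IH]; first by rewrite !expr0 ComplexField.Normc.normc1.
    by rewrite !exprS ComplexField.Normc.normcM IH.
  rewrite lerXn2r ?nnegrE ?normc_ge0 //; first by lra.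
  apply: le_trans q9.
  have -> : P (x +i* y) = (1 - (x ^+ 2 - y ^+ 2) / 25) +i* (- (2 * x * y / 25)).
    by rewrite /P; simpc; congr (_ +i* _); field.
  rewrite /= -[leRHS]ger0_norm // -sqrtr_sqr ler_wsqrtr //.
  (* For [y^2 <= 1] this square of the modulus is at most 500/625 = 0.8, below 0.81. *)
  have -> : (1 - (x ^+ 2 - y ^+ 2) / 25) ^+ 2 + (- (2 * x * y / 25)) ^+ 2 =
      ((y ^+ 2) ^+ 2 + 58 * y ^+ 2 + 441) / 625.
    by case: x2 => ->; field.
  have s0 := sqr_ge0 y.
  have s1 : y ^+ 2 <= 1 by rewrite -sqrrN exprn_ile1 //; lra.
  have : (y ^+ 2) ^+ 2 <= y ^+ 2 by rewrite expr2 ler_piMr.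
  lra.
have top x n : Re (K n (x +i* 0)) =
    Re (F (x +i* 0)) * (1 - x ^+ 2 / 25) ^+ n.
  have -> : K n (x +i* 0) = F (x +i* 0) * ((1 - x ^+ 2 / 25) ^+ n)%:C.
    rewrite /K rmorphXn; congr (_ * _ ^+ n).
    by rewrite /P; simpc; congr (_ +i* _); field.
  by case: (F _) => a b /=; rewrite mulr0 subr0.
(* The 6 is 4 from the top side, where the peak is not counted, plus 1 from each vertical side. *)
have ineq n : th * p ^+ n <= 6 * M * q ^+ n.
  have hol := entire_holo (HK n).
  have /choice[PU HU] : forall y, exists G : R -> R, forall x,
      is_derive x 1 G (Re (K n (x +i* y))).
    by move=> y; apply: primitive_ex; exact: holo_Re_continuous_x hol.
  have /choice[QV HV] : forall x, exists G : R -> R, forall y,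
      is_derive y 1 G (Im (K n (x +i* y))).
    by move=> x; apply: primitive_ex; exact: holo_Im_continuous_y hol.
  have : contour PU QV (-2) 2 (-1) 0 = 0.
    by apply: (goursat hol HU HV); lra.
  rewrite /contour.
  have [c _] := mean_value le22 (fun x _ => HU (-1) x).
  rewrite /K Fbot mul0r /= mul0r => ->.
  have S2 := @primitive_bound _ (QV 2) _ 0 (M * q ^+ n) _ _ le10 (HV 2) _.
  have S3 := @primitive_bound _ (QV (-2)) _ 0 (M * q ^+ n) _ _ le10 (HV (-2)) _.
  have {}S2 := S2 (fun y hy => ltac:(rewrite subr0; apply: side hy; by left)).
  have {}S3 := S3 (fun y hy => ltac:(rewrite subr0; apply: side hy; by right)).
  have := main n (PU 0) _.
  move=> /(_ (fun x => is_derive_congr (HU 0 x) (top x n))).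
  move: S2 S3; rewrite !mul0r !subr0 !ler_norml => /andP[? ?] /andP[? ?].
  lra.
have q0 : 0 < q by lra.
have pq : 1 < p / q by rewrite ltr_pdivlMr // mul1r.
have C0 : 0 <= 6 * M / th by rewrite divr_ge0 ?mulr_ge0 // ltW.
have [n] := expr_beats_linear pq C0.
rewrite -exprM; set m := (2 * n.+1)%N => H.
have := ineq m; rewrite leNgt => /negP; apply.
have : 6 * M / th < (p / q) ^+ m.
  by apply: le_lt_trans H; rewrite ler_peMr // ler1n.
rewrite expr_div_n ltr_pdivlMr ?exprn_gt0 // mulrAC ltr_pdivrMr //.
by rewrite (mulrC th).
Qed.

Theorem entire_identity F : entire F -> (forall x, F x%:C = 0) -> F = cst 0.
Proof.
move=> HF F0; apply/funext => -[a b]; apply/eqP/negPn/negP => Fz.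
have [b0|b0] := eqVneq b 0; first by move: Fz; rewrite b0 F0 eqxx.
(* The affine map sends 0 to [a + i b] and the line of imaginary part -1 into the real axis, so [H]
   has the normalized form. *)
pose H (z : R[i]^o) : R[i]^o := (F (a +i* b))^-1 * F ((a +i* b) + b%:C * z).
apply: (@entire_normalized_nonvanishing H).
- exact: (entireM (@entire_cst (F (a +i* b))^-1) (entire_comp HF
    (entireD (@entire_cst (a +i* b)) (entireM (@entire_cst b%:C) entire_id)))).
- move=> x; rewrite /H.
  have -> : (a +i* b) + b%:C * (x +i* (-1)) = (a + b * x)%:C.
    by simpc; congr (_ +i* _); ring.
  by rewrite F0 mulr0.
- by rewrite /H mulr0 addr0 mulVf.
Qed.

End Identity.

(** * The lower bound *)

Section PaleyWiener.
Context {R : realType}.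
Notation mu := (@lebesgue_measure R).
Notation itg f := (mu.-integrable setT (EFin \o f)).
Implicit Types (x y w : R) (F : R[i]^o -> R[i]^o) (f g u : R -> R[i]).

Lemma normc_sqr (z : R[i]) : normc z ^+ 2 = Re z ^+ 2 + Im z ^+ 2.
Proof. by case: z => a b /=; rewrite sqr_sqrtr // addr_ge0 ?sqr_ge0. Qed.

Lemma fourier1E u w :
  fourier1 u w = coshat (fun y => Re (u y)) (fun y => Im (u y)) w +i*
                 sinhat (fun y => Re (u y)) (fun y => Im (u y)) w.
Proof.
rewrite /fourier1 /cintegral; congr (_ +i* _); apply: eq_RintegralT => y;
  rewrite /cexpi; case: (u y) => a b /=; rewrite cosN sinN.
  by rewrite mulrN opprK.
by rewrite mulrN addrC.
Qed.

Lemma cLfun2P f : cLfun 2%:E f ->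
  [/\ measurable_fun setT (fun x => Re (f x)), measurable_fun setT (fun x => Im (f x)),
      itg (fun x => Re (f x) ^+ 2) & itg (fun x => Im (f x) ^+ 2)].
Proof.
move=> [H1 H2]; split.
- by have := sub_Lfun_mfun H1; rewrite inE.
- by have := sub_Lfun_mfun H2; rewrite inE.
- exact: Lfun2_integrable_sqr H1.
- exact: Lfun2_integrable_sqr H2.
Qed.

Lemma cLfun1P f : cLfun 1%E f ->
  itg (fun x => Re (f x)) /\ itg (fun x => Im (f x)).
Proof. by move=> [H1 H2]; split; apply/Lfun1_integrable. Qed.

Lemma cvgL2_Re_Im (u : nat -> R -> R[i]) f :
  (forall n, measurable_fun setT (fun x => Re (u n x))) ->
  (forall n, measurable_fun setT (fun x => Im (u n x))) ->
  measurable_fun setT (fun x => Re (f x)) -> measurable_fun setT (fun x => Im (f x)) ->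
  cvgL2 u f ->
  (\int[mu]_x ((Re (u n x) - Re (f x)) ^+ 2)%:E)%E @[n --> \oo] --> 0%E /\
  (\int[mu]_x ((Im (u n x) - Im (f x)) ^+ 2)%:E)%E @[n --> \oo] --> 0%E.
Proof.
move=> mr mi mfr mfi H.
have E n x : normc (u n x - f x) ^+ 2 =
    (Re (u n x) - Re (f x)) ^+ 2 + (Im (u n x) - Im (f x)) ^+ 2.
  by rewrite normc_sqr; case: (u n x) => a b; case: (f x) => c d.
have mR n : measurable_fun setT (fun x => (Re (u n x) - Re (f x)) ^+ 2).
  by apply: measurable_funX; exact: measurable_funB.
have mI n : measurable_fun setT (fun x => (Im (u n x) - Im (f x)) ^+ 2).
  by apply: measurable_funX; exact: measurable_funB.
have mN n : measurable_fun setT (fun x => (normc (u n x - f x) ^+ 2)%:E).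
  by apply/measurable_EFinP; under eq_fun do rewrite E; exact: measurable_funD.
have S (h : nat -> R -> R) : (forall n, measurable_fun setT (h n)) ->
    (forall n x, 0 <= h n x <= normc (u n x - f x) ^+ 2) ->
    (\int[mu]_x (h n x)%:E)%E @[n --> \oo] --> 0%E.
  move=> mh hb; apply: (squeeze_cvge _ (cvg_cst 0%E) H); apply: nearW => n.
  have h0 x : (0 <= (h n x)%:E)%E by rewrite lee_fin; have /andP[] := hb n x.
  rewrite integral_ge0 //=; apply: ge0_le_integral => //.
  - by apply/measurable_EFinP; exact: mh.
  - exact: mN.
  by move=> x _; rewrite lee_fin; have /andP[] := hb n x.
by split; apply: S => // n x; rewrite E sqr_ge0 /= ?lerDl ?lerDr sqr_ge0.
Qed.

Lemma ae_mono (P Q : R -> Prop) : (forall x, P x -> Q x) ->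
  {ae mu, forall x, P x} -> {ae mu, forall x, Q x}.
Proof. by move=> PQ; exact: (@filterS _ _ (ae_filter_ringOfSetsType mu)). Qed.

(** A Lindelof argument: each point off the support lies in an interval with rational ends on which
    [g] is almost everywhere 0, and such intervals are countably many. *)
Lemma ess_support_ae g (s : R) : ess_support g `<=` `[- s, s] ->
  {ae mu, forall y, s < `|y| -> g y = 0}.
Proof.
move=> sub.
pose I (k : rat * rat) : set R := [set` `](ratr k.1), (ratr k.2)[].
(* For an interval on which [g] is not almost everywhere 0 the claim is vacuous, so it holds for
   every index and the null sets can be united. *)
have H n : {ae mu, forall y, forall k : rat * rat, unpickle n = Some k ->
    {ae mu, forall z, I k z -> g z = 0} -> I k y -> g y = 0}.
  case E : (unpickle n) => [k|]; last by apply/aeW.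
  have [P|nP] := pselect {ae mu, forall z, I k z -> g z = 0}.
    by apply: ae_mono P => y Py k' [<-].
  by apply/aeW => y k' [<-].
have {}H := ae_foralln H.
apply: ae_mono H => y Hy sy.
have : ~ ess_support g y.
  move=> /sub; rewrite /= in_itv /= -ler_norml => ys.
  by move: sy; rewrite ltNge ys.
rewrite /ess_support /setC /= => /contrapT [U [oU Uy] aeU].
have /nbhs_ballP[e /= e0 eU] : nbhs y U by exact: open_nbhs_nbhs.
have ye1 : y - e < y by lra.
have ye2 : y < y + e by lra.
have [a] := rat_in_itvoo ye1; rewrite in_itv /= => /andP[a1 a2].
have [b] := rat_in_itvoo ye2; rewrite in_itv /= => /andP[b1 b2].
apply: (Hy (pickle (a, b)) (a, b)); first exact: pickleK.
  apply: ae_mono aeU => z Uz; rewrite /I /= in_itv /= => /andP[z1 z2].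
  by apply/Uz/eU; rewrite /ball /= ltr_norml; apply/andP; lra.
by rewrite /I /= in_itv /= a2 b1.
Qed.

(** Bounded support makes the square integrable [g1] and [g2] integrable, so that the inversion
    formula and [bandlimited_smooth] apply to them. *)
Lemma real_inversion (p q : nat -> R -> R) (f g1 g2 : R -> R) (s : R) : 0 <= s ->
  (forall n, itg (p n)) -> (forall n, itg (q n)) -> continuous f ->
  measurable_fun setT g1 -> measurable_fun setT g2 ->
  itg (fun y => f y ^+ 2) -> itg (fun w => g1 w ^+ 2) -> itg (fun w => g2 w ^+ 2) ->
  (forall w, s < `|w| -> g1 w = 0 /\ g2 w = 0) ->
  (\int[mu]_y ((p n y - f y) ^+ 2)%:E)%E @[n --> \oo] --> 0%E ->
  (\int[mu]_w ((coshat (p n) (q n) w - g1 w) ^+ 2)%:E)%E @[n --> \oo] --> 0%E ->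
  (\int[mu]_w ((sinhat (p n) (q n) w - g2 w) ^+ 2)%:E)%E @[n --> \oo] --> 0%E ->
  exists phi : nat -> R -> R,
  [/\ forall x, phi 0%N x = f x,
      forall n x, is_derive x 1 (phi n) (phi n.+1 x) &
      exists C, forall n x, `|phi n x| <= C * (2 * pi * s) ^+ n].
Proof.
move=> s0 Ip Iq cf mg1 mg2 If Ig1 Ig2 supp Lf L1 L2.
have compact_itg (h : R -> R) : measurable_fun setT h -> itg (fun w => h w ^+ 2) ->
    (forall w, s < `|w| -> h w = 0) -> itg h.
  move=> mh Ih hs; pose A : set R := [set` `[- s, s]].
  have IA : itg (\1_A : R -> R) := integrable_indic_itv _ _ _ _.
  have IA2 : itg (fun w => (\1_A w : R) ^+ 2).
    apply: (integrableT_le _ _ IA); first by apply: measurable_funX; exact: integrableT_measurable IA.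
    by move=> w; rewrite indicE; case: (w \in A); rewrite ?expr1n ?expr0n ?normr1 ?normr0.
  have := integrableT_mul_sqr mh (integrableT_measurable IA) Ih IA2.
  have E w : h w * \1_A w = h w.
    rewrite indicE; case: (boolP (w \in A)) => [_|]; first by rewrite mulr1.
    rewrite notin_setE /A /= in_itv /= -ler_norml => /negP; rewrite -ltNge => ws.
    by rewrite hs // mul0r.
  by under eq_fun do rewrite E.
have I1 : itg g1 by apply: compact_itg => // w /supp[].
have I2 : itg g2 by apply: compact_itg => // w /supp[].
have mf := continuous_measurable cf.
have IF e x : 0 < e -> itg (fun y => f y * fejer e (y - x)).
  move=> e0; apply: integrableT_mul_sqr => //; last exact: integrable_fejer_sqr.
  exact: continuous_measurable (@continuous_fejer _ e x).
have inv x := inversion cf I1 I2 (fun e => IF e x) (fun e e0 =>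
  plancherel_pairing x e0 Ip Iq mf mg1 mg2 If Ig1 Ig2 Lf L1 L2).
(* The normalizing constant of the inversion formula stays a symbol; being positive, it can be
   divided out. *)
pose k := sinc_mass / (2 * pi) * (\int[mu]_v (tri v : R)).
have k0 : 0 < k.
  apply: mulr_gt0 tri_mass_gt0; apply: divr_gt0 (@sinc_mass_gt0 R) _.
  by rewrite mulr_gt0 // pi_gt0.
(* In its real part, the inverse transform of [g1 + i g2] is the forward transform of the conjugate
   [g1 - i g2]. *)
have I2N : itg (fun w => - 1 * g2 w) by exact: integrableT_scale.
have [|phi [phi0 Hphi HC]] := bandlimited_smooth k^-1 s0 I1 I2N.
  by move=> y /supp[-> ->]; rewrite mulr0.
exists phi; split=> // x; rewrite phi0.
apply: (mulfI (lt0r_neq0 k0)); rewrite mulrA mulfV ?gt_eqF // mul1r inv.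
by apply: eq_RintegralT => w; rewrite mulN1r mulNr.
Qed.

Lemma continuous_restriction F : entire F ->
  continuous (fun x : R => Re (F x%:C)) /\ continuous (fun x : R => Im (F x%:C)).
Proof.
move=> /entire_holo H; split; first exact: (@holo_Re_continuous_x _ _ _ 0 H).
by have [c _] := holo_continuous_conjugate H; exact: (c 0).
Qed.

Lemma paley_wiener_smooth (sigma : R) F : 0 < sigma -> paley_wiener sigma F ->
  exists phi psi : nat -> R -> R,
  [/\ forall x, phi 0%N x = Re (F x%:C), forall x, psi 0%N x = Im (F x%:C),
      forall n x, is_derive x 1 (phi n) (phi n.+1 x),
      forall n x, is_derive x 1 (psi n) (psi n.+1 x) &
      exists C, forall n x, `|phi n x| <= C * sigma ^+ n /\ `|psi n x| <= C * sigma ^+ n].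
Proof.
move=> sg0 [HF [g [Lf Lg [u [Hu uf ug]]] supp]].
have [cR cI] := continuous_restriction HF.
have [mfR mfI IfR IfI] := cLfun2P Lf.
have [mgR mgI IgR IgI] := cLfun2P Lg.
pose s := sigma / (2 * pi).
have pi0 : 0 < 2 * pi :> R by rewrite mulr_gt0 // pi_gt0.
have s0 : 0 <= s by rewrite divr_ge0 // ltW.
have sE : 2 * pi * s = sigma by rewrite /s mulrC divfK ?gt_eqF.
pose p n y := Re (u n y); pose q n y := Im (u n y).
have Ip n : itg (p n) := (cLfun1P (Hu n).1).1.
have Iq n : itg (q n) := (cLfun1P (Hu n).1).2.
have [LR LI] := cvgL2_Re_Im (fun n => integrableT_measurable (Ip n))
  (fun n => integrableT_measurable (Iq n)) mfR mfI uf.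
have E1 n w : Re (fourier1 (u n) w) = coshat (p n) (q n) w by rewrite fourier1E.
have E2 n w : Im (fourier1 (u n) w) = sinhat (p n) (q n) w by rewrite fourier1E.
have IqN n : itg (fun y => - 1 * p n y) by exact: integrableT_scale.
have mc n : measurable_fun setT (coshat (p n) (q n)).
  by apply: continuous_measurable; exact: continuous_coshat.
have ms n : measurable_fun setT (sinhat (p n) (q n)).
  rewrite (_ : sinhat _ _ = coshat (q n) (fun y => - 1 * p n y)).
    by apply: continuous_measurable; exact: continuous_coshat.
  by apply/funext => w; exact: sinhat_coshat.
have mfr n : measurable_fun setT (fun w => Re (fourier1 (u n) w)).
  by rewrite (funext (E1 n)).
have mfi n : measurable_fun setT (fun w => Im (fourier1 (u n) w)).
  by rewrite (funext (E2 n)).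
have [GR GI] := cvgL2_Re_Im mfr mfi mgR mgI ug.
have aeg := ess_support_ae supp.
pose A : set R := [set` `[- s, s]].
have mA : measurable A by exact: measurable_itv.
(* [g] vanishes off [[-s, s]] only almost everywhere; its truncation does so everywhere and leaves
   the L^2 distances unchanged. *)
pose g1 w := Re (g w) * \1_A w; pose g2 w := Im (g w) * \1_A w.
have mi : measurable_fun setT (\1_A : R -> R) by exact: measurable_indic.
have mg1 : measurable_fun setT g1 by exact: measurable_funM.
have mg2 : measurable_fun setT g2 by exact: measurable_funM.
have trunc (h : R -> R) : measurable_fun setT h -> itg (fun w => h w ^+ 2) ->
    itg (fun w => (h w * \1_A w) ^+ 2).
  move=> mh Ih; apply: (integrableT_le _ _ Ih); first by apply: measurable_funX; exact: measurable_funM.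
  move=> w; rewrite ger0_norm ?sqr_ge0 // indicE.
  by case: (w \in A); rewrite ?mulr1 // mulr0 expr0n sqr_ge0.
have Ig1 : itg (fun w => g1 w ^+ 2) := trunc _ mgR IgR.
have Ig2 : itg (fun w => g2 w ^+ 2) := trunc _ mgI IgI.
have out w : s < `|w| -> \1_A w = 0 :> R.
  move=> ws; rewrite indicE; case: (boolP (w \in A)) => //.
  by rewrite inE /A /= in_itv /= -ler_norml leNgt ws.
have supp' w : s < `|w| -> g1 w = 0 /\ g2 w = 0.
  by move=> /out w0; rewrite /g1 /g2 w0 !mulr0.
have aeE (h : R -> R) (c : R -> R) : measurable_fun setT h -> measurable_fun setT c ->
   (forall w, g w = 0 -> h w = 0) ->
   (\int[mu]_w ((c w - h w) ^+ 2)%:E = \int[mu]_w ((c w - h w * \1_A w) ^+ 2)%:E)%E.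
  move=> mh mc' h0; apply: ae_eq_integral => //.
  - by apply/measurable_EFinP; apply: measurable_funX; exact: measurable_funB.
  - apply/measurable_EFinP; apply: measurable_funX; apply: measurable_funB => //.
    exact: measurable_funM.
  apply: ae_mono aeg => w gw _; congr (_ %:E); congr ((_ - _) ^+ 2).
  have [ws|ws] := ltP s `|w|; first by rewrite h0 ?mul0r // gw.
  by rewrite indicE mem_set ?mulr1 // /A /= in_itv /= -ler_norml.
have gR0 w : g w = 0 -> Re (g w) = 0 by move=> ->.
have gI0 w : g w = 0 -> Im (g w) = 0 by move=> ->.
have L1 : (\int[mu]_w ((coshat (p n) (q n) w - g1 w) ^+ 2)%:E)%E @[n --> \oo] --> 0%E.
  have E n : (\int[mu]_w ((coshat (p n) (q n) w - g1 w) ^+ 2)%:E =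
      \int[mu]_w ((Re (fourier1 (u n) w) - Re (g w)) ^+ 2)%:E)%E.
    by rewrite -(aeE _ _ mgR (mc n) gR0); apply: eq_integral => w _; rewrite E1.
  by rewrite (funext E).
have L2 : (\int[mu]_w ((sinhat (p n) (q n) w - g2 w) ^+ 2)%:E)%E @[n --> \oo] --> 0%E.
  have E n : (\int[mu]_w ((sinhat (p n) (q n) w - g2 w) ^+ 2)%:E =
      \int[mu]_w ((Im (fourier1 (u n) w) - Im (g w)) ^+ 2)%:E)%E.
    by rewrite -(aeE _ _ mgI (ms n) gI0); apply: eq_integral => w _; rewrite E2.
  by rewrite (funext E).
have [phi [phi0 Hphi [C1 HC1]]] :=
  real_inversion s0 Ip Iq cR mg1 mg2 IfR Ig1 Ig2 supp' LR L1 L2.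
(* The imaginary part of [F] is the real part of [-i F], whose approximants are [q n - i p n] and
   whose transform is [g2 - i g1]. *)
have swap n w : sinhat (q n) (fun y => - 1 * p n y) w = - 1 * coshat (p n) (q n) w.
  rewrite -RintegralT_scale; last by apply: integrableT_add; [exact: integrableT_mulcos|exact: integrableT_mulsin].
  by apply: eq_RintegralT => y; ring.
have mg1N : measurable_fun setT (fun w => - 1 * g1 w).
  by apply: measurable_funM => //; exact: measurable_cst.
have Ig1N : itg (fun w => (- 1 * g1 w) ^+ 2).
  by under eq_fun do rewrite mulN1r sqrrN.
have suppN w : s < `|w| -> g2 w = 0 /\ - 1 * g1 w = 0.
  by move=> /supp'[-> ->]; rewrite mulr0.
have L1N : (\int[mu]_w ((coshat (q n) (fun y => - 1 * p n y) w - g2 w) ^+ 2)%:E)%E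
    @[n --> \oo] --> 0%E.
  have E n : (\int[mu]_w ((coshat (q n) (fun y => - 1 * p n y) w - g2 w) ^+ 2)%:E =
      \int[mu]_w ((sinhat (p n) (q n) w - g2 w) ^+ 2)%:E)%E.
    by apply: eq_integral => w _; rewrite sinhat_coshat.
  by rewrite (funext E).
have L2N : (\int[mu]_w ((sinhat (q n) (fun y => - 1 * p n y) w - - 1 * g1 w) ^+ 2)%:E)%E
    @[n --> \oo] --> 0%E.
  have E n : (\int[mu]_w ((sinhat (q n) (fun y => - 1 * p n y) w - - 1 * g1 w) ^+ 2)%:E =
      \int[mu]_w ((coshat (p n) (q n) w - g1 w) ^+ 2)%:E)%E.
    by apply: eq_integral => w _; rewrite swap -mulrBr mulN1r sqrrN.
  by rewrite (funext E).
have [psi [psi0 Hpsi [C2 HC2]]] :=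
  real_inversion s0 Iq IqN cI mg2 mg1N IfI Ig2 Ig1N suppN LI L1N L2N.
exists phi, psi; split=> //; exists (`|C1| + `|C2|) => n x.
have sn : 0 <= sigma ^+ n by rewrite exprn_ge0 // ltW.
rewrite sE in HC1 HC2; split.
  by apply: le_trans (HC1 n x) _; rewrite ler_wpM2r // (le_trans (ler_norm _)) // lerDl.
by apply: le_trans (HC2 n x) _; rewrite ler_wpM2r // (le_trans (ler_norm _)) // lerDr.
Qed.

Lemma is_derive_restriction F x : entire F ->
  is_derive x 1 (fun t : R => Re (F t%:C)) (Re (derive1 F x%:C)) /\
  is_derive x 1 (fun t : R => Im (F t%:C)) (Im (derive1 F x%:C)).
Proof.
move=> HF; have /derivableP/is_derive_cderiv H := HF x%:C.
rewrite derive1E; have {}H := cderiv_Re_Im (y0 := 0) H.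
split; apply: is_derive_le => e /H [d d0 {}H]; exists d => // h hd.
  have := H (x + h) 0; rewrite subrr normr0 (addrC x h) addrK => /(_ hd d0) [+ _].
  by rewrite addr0 mulr0 subr0.
have := H (x + h) 0; rewrite subrr normr0 (addrC x h) addrK => /(_ hd d0) [_ +].
by rewrite addr0 mulr0 addr0.
Qed.

Theorem M2_ge (sigma : R) F : 0 < sigma -> paley_wiener sigma F -> F <> cst 0 ->
  ((2 * pi / sigma)%:E <= M2 F)%E.
Proof.
move=> sg0 PW F0; rewrite leNgt; apply/negP => M2lt; apply: F0.
have HF : entire F by case: PW.
have T0 : 0 < 2 * pi / sigma by rewrite divr_gt0 // mulr_gt0 // pi_gt0.
set T := 2 * pi / sigma in M2lt T0.
have [D1 [D10 D1T MD1]] : exists D1 : R, [/\ 0 < D1, D1 < T & (M2 F < D1%:E)%E].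
  move: M2lt; case: (M2 F) => [m|//|_]; last by exists (T / 2); split; [lra|lra|exact: ltNyr].
  rewrite lte_fin => mT; exists (Num.max ((m + T) / 2) (T / 2)).
  rewrite lt_max gt_max lte_fin lt_max; split.
  - by apply/orP; right; lra.
  - by apply/andP; lra.
  - by apply/orP; left; lra.
(* The open interval from [x + e] to [x + D] has length [D1 > M2 F], so it contains a double zero;
   [e > 0] forces progress from node to node, and [D < T] keeps the inequality strict. *)
pose D := (D1 + T) / 2; pose e := D - D1.
have e0 : 0 < e by rewrite /e /D; lra.
have sD : sigma * D < 2 * pi.
  have <- : sigma * T = 2 * pi by rewrite /T mulrC divfK ?gt_eqF.
  by rewrite ltr_pM2l // /D; lra.
have nodes x : exists y, [/\ x + e < y, y < x + D & F y%:C = 0 /\ derive1 F y%:C = 0].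
  apply: contrapT => nex; move: MD1; rewrite ltNge => /negP; apply.
  apply: ereal_sup_ubound; exists (x + e), (x + D); split.
  - by rewrite /e; lra.
  - move=> y; rewrite in_itv /= => /andP[y1 y2] Fy; apply: nex; by exists y.
  - by congr (_ %:E); rewrite /e; ring.
have [phi [psi [phi0 psi0 Hphi Hpsi [C HC]]]] := paley_wiener_smooth sg0 PW.
have phi1 x : phi 1%N x = Re (derive1 F x%:C).
  apply: is_derive_unique (Hphi 0%N x) _; rewrite (funext phi0).
  by case: (is_derive_restriction x HF).
have psi1 x : psi 1%N x = Im (derive1 F x%:C).
  apply: is_derive_unique (Hpsi 0%N x) _; rewrite (funext psi0).
  by case: (is_derive_restriction x HF).
have phiz : forall x, phi 0%N x = 0.
  apply: (@clamped_vanish _ phi C sigma D e) => // [n x|x]; first by case: (HC n x).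
  have [y [y1 y2 [Fy dFy]]] := nodes x.
  by exists y; rewrite phi0 phi1 Fy dFy.
have psiz : forall x, psi 0%N x = 0.
  apply: (@clamped_vanish _ psi C sigma D e) => // [n x|x]; first by case: (HC n x).
  have [y [y1 y2 [Fy dFy]]] := nodes x.
  by exists y; rewrite psi0 psi1 Fy dFy.
apply: (entire_identity HF) => x.
by move: (phi0 x) (psi0 x); rewrite phiz psiz; case: (F _) => a b /= <- <-.
Qed.

End PaleyWiener.

(** * The upper bound *)

Section ComplexSine.
Context {R : realType}.
Implicit Types (x y t : R) (z h : R[i]).

Definition ch y : R := (expR y + expR (- y)) / 2.
Definition sh y : R := (expR y - expR (- y)) / 2.

Lemma ch0 : ch 0 = 1. Proof. by rewrite /ch oppr0 expR0; field. Qed.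
Lemma sh0 : sh 0 = 0. Proof. by rewrite /sh oppr0 subrr mul0r. Qed.

Lemma chD x y : ch (x + y) = ch x * ch y + sh x * sh y.
Proof. by rewrite /ch /sh opprD !expRD; field. Qed.

Lemma shD x y : sh (x + y) = sh x * ch y + ch x * sh y.
Proof. by rewrite /ch /sh opprD !expRD; field. Qed.

Let is_derive_expN y : is_derive y 1 (fun t => expR (- t)) (- expR (- y)).
Proof.
have N : is_derive y 1 (fun t : R => - t) (- 1).
  exact: is_deriveN (is_derive_id y 1).
by apply: is_derive_congr (@is_derive_compf _ expR (fun t => - t) y _ _ (is_derive_expR _) N) _; rewrite mulrN1.
Qed.

Lemma is_derive_ch y : is_derive y 1 ch (sh y).
Proof.
have -> : ch = fun t => 2^-1 * (expR t + expR (- t)).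
  by apply/funext => t; rewrite /ch mulrC.
by apply: is_derive_congr (is_derive_scalef _ (is_derive_addf (is_derive_expR y) (is_derive_expN y))) _; rewrite /sh mulrC.
Qed.

Lemma is_derive_sh y : is_derive y 1 sh (ch y).
Proof.
have -> : sh = fun t => 2^-1 * (expR t - expR (- t)).
  by apply/funext => t; rewrite /sh mulrC.
by apply: is_derive_congr (is_derive_scalef _ (is_derive_subf (is_derive_expR y) (is_derive_expN y))) _; rewrite /ch mulrC opprK.
Qed.

(** It bounds [ch] on [[-1, 1]], and [derive_bound0] hands the same constant down to all the
    remainders below. *)
Let K : R := expR 1.
Let K0 : 0 < K. Proof. exact: expR_gt0. Qed.

Let ch_le y : `|y| <= 1 -> `|ch y| <= K.
Proof.
rewrite ler_norml => /andP[y1 y2].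
have h1 : expR y <= K by rewrite ler_expR.
have h2 : expR (- y) <= K by rewrite ler_expR; lra.
by rewrite ger0_norm /ch ?divr_ge0 ?addr_ge0 ?expR_ge0 //; lra.
Qed.

Let sh_le y : `|y| <= 1 -> `|sh y| <= K * `|y|.
Proof.
move=> y1; rewrite -[X in _ * X]expr1; apply: (derive_bound0 is_derive_sh sh0 _ y1) => t t1.
by rewrite expr0 mulr1 ch_le.
Qed.

Let ch1_le y : `|y| <= 1 -> `|ch y - 1| <= K * `|y| ^+ 2.
Proof.
have D t : is_derive t 1 (fun t => ch t - 1) (sh t - 0) by exact: is_derive_subf (is_derive_ch t) (is_derive_constf 1 t).
have D0 : ch 0 - 1 = 0 by rewrite ch0 subrr.
by apply: (derive_bound0 D D0) => t t1; rewrite subr0 expr1 sh_le.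
Qed.

Let shy_le y : `|y| <= 1 -> `|sh y - y| <= K * `|y| ^+ 3.
Proof.
have D t : is_derive t 1 (fun t => sh t - t) (ch t - 1) by exact: is_derive_subf (is_derive_sh t) (is_derive_id t 1).
have D0 : sh 0 - 0 = 0 by rewrite sh0 subrr.
by apply: (derive_bound0 D D0) => t t1; rewrite ch1_le.
Qed.

Definition csin (z : R[i]^o) : R[i]^o :=
  (sin (Re z) * ch (Im z)) +i* (cos (Re z) * sh (Im z)).
Definition ccos (z : R[i]^o) : R[i]^o :=
  (cos (Re z) * ch (Im z)) +i* (- (sin (Re z) * sh (Im z))).

Lemma csinD z h : csin (z + h) = csin z * ccos h + ccos z * csin h.
Proof.
case: z h => a b [c d]; rewrite /csin /ccos /= sinD cosD chD shD.
by simpc; congr (_ +i* _); ring.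
Qed.

Lemma csin_real x : csin x%:C = (sin x)%:C.
Proof. by rewrite /csin /= ch0 sh0 mulr1 mulr0. Qed.

Lemma normc_small z : normc z <= 1 -> `|Re z| <= 1 /\ `|Im z| <= 1.
Proof. by move=> z1; split; [apply: le_trans (Re_le_normc z) z1|apply: le_trans (Im_le_normc z) z1]. Qed.

(** The cubic order matters: after division by [z] a quadratic error is left, which gives [csinc]
    the derivative 0 at 0. *)
Lemma csin_sub_le : exists2 C : R, 0 < C & forall z, normc z <= 1 -> normc (csin z - z) <= C * normc z ^+ 3.
Proof.
exists (4 * K) => [|z z1]; first by rewrite mulr_gt0.
have [x1 y1] := normc_small z1.
have n0 := normc_ge0 z; have xn := Re_le_normc z; have yn := Im_le_normc z.
apply: le_trans (normc_le _) _.
have -> : Re (csin z - z) = sin (Re z) * ch (Im z) - Re z by case: (z).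
have -> : Im (csin z - z) = cos (Re z) * sh (Im z) - Im z by case: (z).
move: (Re z) (Im z) (normc z) x1 y1 n0 xn yn => x y n x1 y1 n0 xn yn.
have pw (a b : R) k : 0 <= a -> a <= b -> a ^+ k <= b ^+ k.
  by move=> a0 ab; rewrite lerXn2r ?nnegrE // (le_trans a0).
have e1 : sin x * ch y - x = (sin x - x) * ch y + x * (ch y - 1) by ring.
have e2 : cos x * sh y - y = (cos x - 1) * sh y + (sh y - y) by ring.
have b1 : `|(sin x - x) * ch y| <= n ^+ 3 * K.
  rewrite normrM; apply: ler_pM => //; last exact: ch_le.
  by apply: le_trans (norm_sin_sub_le x) _; exact: pw.
have b2 : `|x * (ch y - 1)| <= n * (K * n ^+ 2).
  rewrite normrM; apply: ler_pM => //; apply: le_trans (ch1_le y1) _.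
  by rewrite ler_wpM2l ?pw // ltW.
have b3 : `|(cos x - 1) * sh y| <= n ^+ 2 * (K * n).
  rewrite normrM; apply: ler_pM => //.
    by apply: le_trans (norm_cos1_le x) _; rewrite -(real_normK (num_real x)) pw.
  by apply: le_trans (sh_le y1) _; rewrite ler_wpM2l // ltW.
have b4 : `|sh y - y| <= K * n ^+ 3.
  by apply: le_trans (shy_le y1) _; rewrite ler_wpM2l ?pw // ltW.
rewrite e1 e2; apply: le_trans (lerD (ler_normD _ _) (ler_normD _ _)) _.
have -> : 4 * K * n ^+ 3 = n ^+ 3 * K + n * (K * n ^+ 2) + (n ^+ 2 * (K * n) + K * n ^+ 3) by ring.
by rewrite !lerD.
Qed.

Lemma ccos_sub_le : exists2 C : R, 0 < C & forall z, normc z <= 1 -> normc (ccos z - 1) <= C * normc z ^+ 2.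
Proof.
exists (3 * K) => [|z z1]; first by rewrite mulr_gt0.
have [x1 y1] := normc_small z1.
have n0 := normc_ge0 z; have xn := Re_le_normc z; have yn := Im_le_normc z.
apply: le_trans (normc_le _) _.
have -> : Re (ccos z - 1) = cos (Re z) * ch (Im z) - 1 by case: (z).
have -> : Im (ccos z - 1) = - (sin (Re z) * sh (Im z)) - 0 by case: (z).
move: (Re z) (Im z) (normc z) x1 y1 n0 xn yn => x y n x1 y1 n0 xn yn.
have pw (a b : R) k : 0 <= a -> a <= b -> a ^+ k <= b ^+ k.
  by move=> a0 ab; rewrite lerXn2r ?nnegrE // (le_trans a0).
have e1 : cos x * ch y - 1 = (cos x - 1) * ch y + (ch y - 1) by ring.
have b1 : `|(cos x - 1) * ch y| <= n ^+ 2 * K.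
  rewrite normrM; apply: ler_pM => //; last exact: ch_le.
  by apply: le_trans (norm_cos1_le x) _; rewrite -(real_normK (num_real x)) pw.
have b2 : `|ch y - 1| <= K * n ^+ 2.
  by apply: le_trans (ch1_le y1) _; rewrite ler_wpM2l ?pw // ltW.
have b3 : `|- (sin x * sh y) - 0| <= n * (K * n).
  rewrite subr0 normrN normrM; apply: ler_pM => //.
    by apply: le_trans (norm_sin_le x) _.
  by apply: le_trans (sh_le y1) _; rewrite ler_wpM2l // ltW.
rewrite e1; apply: le_trans (lerD (ler_normD _ _) b3) _.
have -> : 3 * K * n ^+ 2 = n ^+ 2 * K + K * n ^+ 2 + n * (K * n) by ring.
by rewrite !lerD.
Qed.

(** The addition formula reduces the claim at [z] to the expansions of [csin] and [ccos] at 0. *)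
Lemma cderiv_csin z : cderiv csin z (ccos z).
Proof.
have [C1 C10 H1] := csin_sub_le. have [C2 C20 H2] := ccos_sub_le.
move=> e e0; pose M := normc (csin z) * C2 + normc (ccos z) * C1 + 1.
have M0 : 0 < M by rewrite ltr_wpDl // addr_ge0 // mulr_ge0 ?normc_ge0 // ltW.
exists (Num.min 1 (e / M)); first by rewrite lt_min ltr01 divr_gt0.
move=> h; rewrite lt_min => /andP[/ltW h1 hM].
have n0 := normc_ge0 h.
have -> : csin (z + h) - csin z - ccos z * h =
   csin z * (ccos h - 1) + ccos z * (csin h - h) by rewrite csinD; ring.
apply: le_trans (le_normcD _ _) _; rewrite !ComplexField.Normc.normcM.
have b1 : normc (csin z) * normc (ccos h - 1) <= normc (csin z) * (C2 * normc h ^+ 2).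
  by rewrite ler_wpM2l ?normc_ge0 // H2.
have b2 : normc (ccos z) * normc (csin h - h) <= normc (ccos z) * (C1 * normc h ^+ 2).
  rewrite ler_wpM2l ?normc_ge0 //; apply: le_trans (H1 h h1) _.
  rewrite ler_pM2l // exprSr ler_piMr //; exact: exprn_ge0.
apply: le_trans (lerD b1 b2) _.
apply: le_trans (_ : M * normc h * normc h <= _); last first.
  rewrite ler_wpM2r // mulrC -ler_pdivlMr //; exact: ltW.
have -> : normc (csin z) * (C2 * normc h ^+ 2) + normc (ccos z) * (C1 * normc h ^+ 2)
  = (M - 1) * normc h * normc h by rewrite /M; ring.
rewrite !mulrBl mul1r gerBl; exact: mulr_ge0.
Qed.

Lemma entire_csin : entire csin.
Proof. by move=> z; have /is_derive_cderiv[] := cderiv_csin z. Qed.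

Definition csinc (z : R[i]^o) : R[i]^o := if z == 0 then 1 else csin z / z.

Lemma csinc_real x : csinc x%:C = (sinc x)%:C.
Proof.
rewrite /csinc /sinc; have -> : (x%:C == 0 :> R[i]) = (x == 0).
  by rewrite eq_complex /= eqxx andbT.
case: eqP => // _; by rewrite csin_real -fmorphV -rmorphM.
Qed.

Lemma entire_csinc : entire csinc.
Proof.
move=> z; have [->|z0] := eqVneq z 0.
  have [C1 C10 H1] := csin_sub_le.
  suff /is_derive_cderiv[] : cderiv csinc 0 0 by [].
  move=> e e0; exists (Num.min 1 (e / C1)); first by rewrite lt_min ltr01 divr_gt0.
  move=> h; rewrite lt_min => /andP[/ltW h1 hM].
  rewrite add0r mul0r subr0 /csinc eqxx; case: eqP => [->|/eqP h0].
    by rewrite subrr ComplexField.Normc.normc0 mulr0.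
  have -> : csin h / h - 1 = (csin h - h) / h by rewrite mulrBl mulfV.
  have hp : 0 < normc h.
    rewrite lt_neqAle normc_ge0 andbT eq_sym; apply: contra h0 => /eqP.
    by move/ComplexField.Normc.eq0_normc ->.
  rewrite ComplexField.Normc.normcM ComplexField.Normc.normcV ler_pdivrMr //.
  apply: le_trans (H1 h h1) _; rewrite exprSr mulrA ler_pM2r // expr2 mulrA ler_pM2r //.
  rewrite mulrC -ler_pdivlMr //; exact: ltW.
have D : derivable (fun w : R[i]^o => csin w * w^-1) z 1.
  by apply: derivableM; [exact: entire_csin|apply: derivableV => //; exact: derivable_id].
apply: near_eq_derivable D; near=> w.
rewrite /csinc ifF //; apply/negbTE.
near: w; exists `|z|; first by rewrite /= normr_gt0.
move=> w; rewrite /ball_ /= => zw; apply/eqP => w0.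
by move: zw; rewrite w0 subr0 ltxx.
Unshelve. all: by end_near. Qed.

End ComplexSine.

(** * The functions that approach the infimum *)

Section Extremal.
Context {R : realType}.
Notation mu := (@lebesgue_measure R).
Notation itg f := (mu.-integrable setT (EFin \o f)).
Implicit Types (x y w t : R).

Lemma Lfun2_sqr_integrable (f : R -> R) : measurable_fun setT f ->
  itg (fun x => f x ^+ 2) -> f \in Lfun mu 2%:E.
Proof.
move=> mf If; rewrite inE; apply/andP; split; rewrite inE //=.
rewrite /finite_norm unlock poweR_lty //=.
under eq_integral do rewrite powR_mulrn // -normrX.
by have /integrableP[] := If.
Qed.

Lemma Lfun2_0 : (fun _ : R => 0 : R) \in Lfun mu 2%:E.
Proof.
apply: Lfun2_sqr_integrable; first exact: measurable_cst.
by rewrite (_ : (fun _ => _) = fun=> 0); [exact: integrable0|apply/funext => y; rewrite expr0n].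
Qed.

(** Both factors are O(h) near [z], so their product is O(h^2). *)
Lemma derive1_mul_zero (u v : R[i]^o -> R[i]^o) (z : R[i]^o) : entire u -> entire v ->
  u z = 0 -> v z = 0 -> derive1 (fun z0 : R[i]^o => u z0 * v z0 : R[i]^o) z = 0.
Proof.
move=> Hu Hv uz vz.
have lip (w : R[i]^o -> R[i]^o) : entire w -> w z = 0 ->
    exists K d : R, [/\ 0 < K, 0 < d & forall h, normc h < d -> normc (w (z + h)) <= K * normc h].
  move=> Hw wz; have /derivableP/is_derive_cderiv := Hw z.
  move=> /(_ 1 ltr01)[d d0 H]; exists (normc ('D_1 w z) + 1), d; split=> //.
    by rewrite ltr_wpDl // normc_ge0.
  move=> h hd; have := H h hd; rewrite wz subr0 mul1r => {}H.
  have -> : w (z + h) = (w (z + h) - 'D_1 w z * h) + 'D_1 w z * h by rewrite subrK.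
  apply: le_trans (le_normcD _ _) _.
  by rewrite ComplexField.Normc.normcM mulrDl mul1r addrC lerD2l.
have [K1 [d1 [K10 d10 H1]]] := lip u Hu uz.
have [K2 [d2 [K20 d20 H2]]] := lip v Hv vz.
suff /is_derive_cderiv[_] : cderiv (fun z0 : R[i]^o => u z0 * v z0 : R[i]^o) z 0.
  by rewrite derive1E.
move=> e e0; have K0 : 0 < K1 * K2 by exact: mulr_gt0.
exists (Num.min (Num.min d1 d2) (e / (K1 * K2))).
  by rewrite !lt_min d10 d20 divr_gt0.
move=> h; rewrite !lt_min => /andP[/andP[h1 h2] h3].
rewrite uz mul0r subr0 mul0r subr0 ComplexField.Normc.normcM.
have n0 := normc_ge0 h.
apply: le_trans (_ : (K1 * normc h) * (K2 * normc h) <= _).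
  by apply: ler_pM; rewrite ?normc_ge0 ?H1 ?H2.
rewrite (_ : K1 * normc h * (K2 * normc h) = normc h * (K1 * K2) * normc h); last by ring.
by rewrite ler_wpM2r // -ler_pdivlMr // ltW.
Qed.

Section Construction.
Variables a b : R.
Hypothesis (a0 : 0 < a) (b0 : 0 < b).

(** Bracketed as a product of two entire functions, each with the factor [csin (a z)], to fit
    [derive1_mul_zero]. *)
Definition extremal (z : R[i]^o) : R[i]^o :=
  csin (a%:C * z) * (csin (a%:C * z) * csinc (b%:C * z) ^+ 2).

Definition extremal_real x : R := sin (a * x) ^+ 2 * sincsq (b * x).

Lemma extremalE x : extremal x%:C = (extremal_real x)%:C.
Proof.
rewrite /extremal -!rmorphM /= !csin_real csinc_real -rmorphXn -!rmorphM /=.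
by rewrite /extremal_real /sincsq expr2 mulrA.
Qed.

Let lin_entire (c : R[i]) : entire (fun z : R[i]^o => c * z).
Proof. exact: (entireM (@entire_cst R c) entire_id). Qed.

Lemma entire_extremal : entire extremal.
Proof.
have Hs : entire (fun z : R[i]^o => csin (a%:C * z)).
  exact: (@entire_comp R csin (fun z => a%:C * z) entire_csin (@lin_entire _)).
have Hc : entire (fun z : R[i]^o => csinc (b%:C * z)).
  exact: (@entire_comp R csinc (fun z => b%:C * z) entire_csinc (@lin_entire _)).
exact: (entireM Hs (entireM Hs (@entireX R _ 2 Hc))).
Qed.

Let mulc_cts (c : R) : continuous (fun x : R => c * x).
Proof. by apply: continuous_scalef => z; exact: cvg_id. Qed.

Let cts_sqsin : continuous (fun x => sin (a * x) ^+ 2).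
Proof.
apply: continuous_expf => x; apply: (@continuous_comp _ _ _ (fun x => a * x) sin); first exact: mulc_cts.
exact: continuous_sin.
Qed.

Let cts_dil : continuous (fun x : R => sincsq (b * x)).
Proof.
move=> x; apply: (@continuous_comp _ _ _ (fun x => b * x) sincsq); first exact: mulc_cts.
exact: continuous_sincsq.
Qed.

Let cts_E : continuous extremal_real. Proof. exact: continuous_mulf. Qed.

Let sqsin01 x : 0 <= sin (a * x) ^+ 2 <= 1.
Proof. by rewrite sqr_ge0 -(real_normK (num_real _)) exprn_ile1 ?sin_max. Qed.

Let E_bound x : 0 <= extremal_real x <= sincsq (b * x).
Proof.
have /andP[s0 s1] := sqsin01 x; rewrite mulr_ge0 ?sincsq_ge0 //=.
by rewrite ler_piMl ?sincsq_ge0.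
Qed.

Let itg_E : itg extremal_real.
Proof.
apply: (integrableT_le (continuous_measurable cts_E) _ (integrable_dilated_sincsq b0)) => x.
by have /andP[h0 h1] := E_bound x; rewrite ger0_norm.
Qed.

Let itg_E2 : itg (fun x => extremal_real x ^+ 2).
Proof.
apply: (integrableT_le _ _ (integrable_dilated_sincsq b0)) => [|x].
  by apply: continuous_measurable; exact: continuous_expf.
have /andP[h0 h1] := E_bound x; rewrite ger0_norm ?sqr_ge0 // expr2.
apply: le_trans (_ : extremal_real x * 1 <= _); last by rewrite mulr1.
by rewrite ler_wpM2l // (le_trans h1) // sincsq_le1.
Qed.

Lemma tri_dilated_out w : 2 * b <= 2 * pi * `|w| -> fejer b w = 0.
Proof.
have pi0 := pi_gt0 R; move=> bw; rewrite /fejer tri_out ?mulr0 //.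
rewrite normrM ger0_norm; last by rewrite divr_ge0 ?ltW // mulr_gt0.
by rewrite mulrAC ler_pdivlMr.
Qed.

(** As [sin (a y)^2 = (1 - cos (2 a y))/2], the transform combines the values of [fejer b] at [w],
    [w + a/pi] and [w - a/pi]; under the hypothesis all three points lie outside its support or on
    the boundary. *)
Lemma coshat_extremal w : 2 * a + 2 * b <= 2 * pi * `|w| ->
  coshat extremal_real (fun=> 0) w = 0.
Proof.
move=> wab; have pi0 := pi_gt0 R.
have IS := integrable_dilated_sincsq b0.
have I t := integrableT_mulcos t IS.
(* The frequency shift due to [cos (2 a y) = cos (2 pi d y)]. *)
pose d := a / pi.
have pd : 2 * pi * d = 2 * a by rewrite /d mulrA mulrAC mulfK ?gt_eqF.
have E y : extremal_real y * cos (2 * pi * w * y) + 0 * sin (2 * pi * w * y) =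
  2^-1 * (sincsq (b * y) * cos (2 * pi * w * y)) -
  4^-1 * (sincsq (b * y) * cos (2 * pi * (w + d) * y) +
          sincsq (b * y) * cos (2 * pi * (w - d) * y)).
  have c1 : cos (2 * pi * (w + d) * y) + cos (2 * pi * (w - d) * y) =
      2 * cos (2 * pi * w * y) * (1 - 2 * sin (a * y) ^+ 2).
    have -> : 2 * pi * (w + d) * y = 2 * pi * w * y + 2 * (a * y).
      by rewrite mulrDr pd mulrDl -(mulrA 2 a).
    have -> : 2 * pi * (w - d) * y = 2 * pi * w * y - 2 * (a * y).
      by rewrite mulrBr pd mulrBl -(mulrA 2 a).
    rewrite cosD cosB [2 * (a * y)]mulr_natl cos_mulr2n cos2sin2.
    by rewrite -(mulr_natl (1 - _)); ring.
  by rewrite -mulrDr c1 /extremal_real; field.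
rewrite /coshat (eq_RintegralT E) RintegralT_sub; [|exact: integrableT_scale|by apply: integrableT_scale; exact: integrableT_add].
rewrite !RintegralT_scale //; last exact: integrableT_add.
rewrite RintegralT_add // !Rintegral_dilated_sincsq_cos //.
have pdn : 2 * pi * `|d| = 2 * a by rewrite ger0_norm // divr_ge0 // ltW.
have p20 : 0 <= 2 * pi :> R by rewrite mulr_ge0 // ltW.
have D0 : 2 * b <= 2 * pi * `|w|.
  by rewrite (le_trans _ wab) // lerDr mulr_ge0 // ltW.
have lin (X Y : R) : 2 * a + 2 * b <= X -> X <= Y + 2 * a -> 2 * b <= Y by lra.
have D1 : 2 * b <= 2 * pi * `|w + d|.
  apply: lin wab _; rewrite -pdn -mulrDr ler_wpM2l //.
  by rewrite (le_trans _ (ler_normB _ _)) // addrK.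
have D2 : 2 * b <= 2 * pi * `|w - d|.
  apply: lin wab _; rewrite -pdn -mulrDr ler_wpM2l //.
  by rewrite (le_trans _ (ler_normD _ _)) // subrK.
by rewrite (tri_dilated_out D0) (tri_dilated_out D1) (tri_dilated_out D2); ring.
Qed.

Lemma sinhat_extremal w : sinhat extremal_real (fun=> 0) w = 0.
Proof.
have I : itg (fun y => 0 * cos (2 * pi * w * y) - extremal_real y * sin (2 * pi * w * y)).
  apply: integrableT_sub (integrableT_mulsin _ itg_E).
  by rewrite (_ : (fun y => _) = fun=> 0); [exact: integrable0|apply/funext => y; rewrite mul0r].
have [_ H] := integrableT_reflection I.
have : sinhat extremal_real (fun=> 0) w = - 1 * sinhat extremal_real (fun=> 0) w.
  rewrite {1}/sinhat -H -RintegralT_scale //; apply: eq_RintegralT => y.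
  by rewrite /extremal_real !mulrN !sinN sqrrN sincsqN; ring.
lra.
Qed.

Let s : R := (2 * a + 2 * b) / (2 * pi).

Let pi2 : 0 < 2 * pi :> R. Proof. by rewrite mulr_gt0 // pi_gt0. Qed.

Let f (x : R) : R[i] := extremal x%:C.

Let fRe : (fun x => Re (f x)) = extremal_real.
Proof. by apply/funext => x; rewrite /f extremalE. Qed.

Let fIm : (fun x => Im (f x)) = fun=> 0.
Proof. by apply/funext => x; rewrite /f extremalE. Qed.

Let cLfun1_f : cLfun 1%E f.
Proof.
split; apply/Lfun1_integrable; first by rewrite fRe.
by rewrite fIm; exact: integrable0.
Qed.

Let cLfun2_f : cLfun 2%:E f.
Proof.
split; last by rewrite fIm; exact: Lfun2_0.
by rewrite fRe; apply: Lfun2_sqr_integrable => //; exact: continuous_measurable.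
Qed.

Let fourier_f w : fourier1 f w = (coshat extremal_real (fun=> 0) w)%:C.
Proof. by rewrite fourier1E fRe fIm sinhat_extremal. Qed.

Let cts_hat : continuous (coshat extremal_real (fun=> 0)).
Proof. by apply: continuous_coshat => //; exact: integrable0. Qed.

Let hat_out w : s < `|w| -> coshat extremal_real (fun=> 0) w = 0.
Proof.
move=> sw; apply: coshat_extremal.
by rewrite -ler_pdivrMl // mulrC ltW.
Qed.

Let cLfun2_hat : cLfun 2%:E (fourier1 f).
Proof.
have -> : fourier1 f = fun w => (coshat extremal_real (fun=> 0) w)%:C.
  by apply/funext => w; exact: fourier_f.
split; last exact: Lfun2_0.
apply: Lfun2_sqr_integrable; first exact: continuous_measurable.
have I0 : itg (fun _ : R => 0 : R) by exact: integrable0.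
pose M := \int[mu]_y (`|extremal_real y| + `|(0 : R)|).
have hM w : `|coshat extremal_real (fun=> 0) w| <= M := coshat_bound w itg_E I0.
pose A : set R := [set` `[- s, s]].
have IA : itg (\1_A : R -> R) := integrable_indic_itv _ _ _ _.
apply: (integrableT_le _ _ (integrableT_scale (M ^+ 2) IA)).
  by apply: measurable_funX; exact: continuous_measurable.
move=> w; rewrite ger0_norm ?sqr_ge0 // indicE.
have [ws|ws] := ltP s `|w|.
  by rewrite hat_out // expr0n mulr_ge0 ?sqr_ge0.
rewrite mem_set /A /= ?in_itv /= -?ler_norml // mulr1.
by rewrite -(real_normK (num_real (coshat _ _ _))) lerXn2r ?nnegrE // (le_trans _ (hM w)).
Qed.

Lemma paley_wiener_extremal : paley_wiener (2 * a + 2 * b) extremal.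
Proof.
split; first exact: entire_extremal.
(* [f] is integrable and square integrable, so the constant sequence [f] witnesses that its integral
   transform is its L^2 transform. *)
exists (fourier1 f).
  split=> //; exists (fun=> f); split=> //.
    rewrite /cvgL2 (_ : (fun _ => _) = fun=> 0%E); first exact: cvg_cst.
    apply/funext => n; rewrite integral0_eq // => x _.
    by rewrite subrr ComplexField.Normc.normc0 expr0n.
  rewrite /cvgL2 (_ : (fun _ => _) = fun=> 0%E); first exact: cvg_cst.
  apply/funext => n; rewrite integral0_eq // => x _.
  by rewrite subrr ComplexField.Normc.normc0 expr0n.
move=> x /= supp; rewrite in_itv /= -ler_norml leNgt; apply/negP => sx.
apply: supp; exists [set y | s < `|y|]; last first.
  by apply/aeW => y sy; rewrite fourier_f hat_out.
split=> //; apply: (@open_comp _ _ (fun y : R => `|y|) [set t | s < t]); last exact: open_gt.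
by move=> y _; exact: norm_continuous.
Qed.

Lemma extremal_neq0 : extremal <> cst 0.
Proof.
have ab : 0 < a + b by rewrite addr_gt0.
(* Then [a x] and [b x] lie in (0, 1), where the sine is positive. *)
pose x := (a + b)^-1.
have pos (c : R) : 0 < c -> c <= a + b -> 0 < sin (c * x).
  move=> c0 cab; apply: sin_gt0_pi; rewrite mulr_gt0 ?invr_gt0 //=.
  apply: le_lt_trans (_ : 1 < pi); first by rewrite ler_pdivrMr ?mul1r.
  by apply: lt_le_trans (pi_ge2 R); lra.
move=> /(congr1 (fun F => Re (F x%:C))); rewrite extremalE /= => /eqP.
apply/negP; rewrite gt_eqF // /extremal_real mulr_gt0 ?exprn_gt0 ?pos ?lerDl ?(ltW b0) //.
have bx : 0 < b * x by rewrite mulr_gt0 ?invr_gt0.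
rewrite /sinc gt_eqF // divr_gt0 // pos // lerDr; exact: ltW.
Qed.

Lemma sin_intmul_pi (m : int) : sin (m%:~R * pi) = 0 :> R.
Proof.
have nat_case (n : nat) : sin (n%:R * pi) = 0 :> R.
  elim: n => [|n IH]; first by rewrite mul0r sin0.
  by rewrite -natr1 mulrDl mul1r sinD IH sinpi mul0r mulr0 addr0.
case: m => n; first exact: nat_case.
by rewrite NegzE mulrNz mulNr sinN nat_case oppr0.
Qed.

Lemma extremal_double_zero x : sin (a * x) = 0 ->
  extremal x%:C = 0 /\ derive1 extremal x%:C = 0.
Proof.
move=> sx; have sz : csin (a%:C * x%:C) = 0 by rewrite -rmorphM csin_real sx.
split; first by rewrite /extremal sz mul0r.
pose u (z : R[i]^o) : R[i]^o := csin (a%:C * z).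
pose v (z : R[i]^o) : R[i]^o := u z * csinc (b%:C * z) ^+ 2.
have Hu : entire u := @entire_comp R csin (fun z => a%:C * z) entire_csin (@lin_entire _).
have Hc := @entire_comp R csinc (fun z => b%:C * z) entire_csinc (@lin_entire _).
have Hv : entire v := entireM Hu (@entireX R _ 2 Hc).
have uz : u x%:C = 0 := sz.
have vz : v x%:C = 0 by rewrite /v uz mul0r.
exact: (derive1_mul_zero Hu Hv uz vz).
Qed.

Lemma M2_extremal : (M2 extremal <= (pi / a)%:E)%E.
Proof.
apply: ge_ereal_sup => _ [c [d [cd nz ->]]]; rewrite lee_fin leNgt; apply/negP => long.
have pi0 := pi_gt0 R.
(* [x] is the first multiple of [pi/a] strictly to the right of [c], hence at most [c + pi/a]. *)
pose k : int := Num.floor (a * c / pi) + 1.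
pose x : R := k%:~R * pi / a.
have sx : sin (a * x) = 0.
  by rewrite /x mulrC divfK ?gt_eqF // sin_intmul_pi.
have lo : a * c / pi < k%:~R by exact: floorD1_gt.
have hi : k%:~R <= a * c / pi + 1 by rewrite /k intrD lerD2r; exact: floor_le.
have cx : c < x.
  by rewrite /x ltr_pdivlMr // mulrC -ltr_pdivrMr.
have xd : x < d.
  apply: le_lt_trans (_ : c + pi / a < d); last by rewrite -ltrBrDl.
  rewrite /x ler_pdivrMr // mulrDl divfK ?gt_eqF //.
  move: hi; rewrite -(ler_pM2r pi0) mulrDl divfK ?gt_eqF // mul1r.
  by rewrite (mulrC c).
by apply: (nz x); [rewrite in_itv /= cx xd|exact: extremal_double_zero].
Qed.

End Construction.
End Extremal.

Theorem corollary3p2 (R : realType) (sigma : R) (hsigma : 0 < sigma) :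
  d2 sigma = (2 * pi / sigma)%:E.
Proof.
apply/eqP; rewrite eq_le; apply/andP; split; last first.
  by apply: le_ereal_inf_tmp => _ [F [PW F0] <-]; exact: M2_ge.
apply/lee_addgt0Pr => e e0.
have pi0 := pi_gt0 R.
pose T := 2 * pi / sigma; have T0 : 0 < T by rewrite divr_gt0 // mulr_gt0.
(* The spacing [pi/a] of the double zeros is [T + e], and [a < pi/T = sigma/2] leaves room for
   [b > 0]. *)
pose a := pi / (T + e); pose b := sigma / 2 - a.
have Te : 0 < T + e by rewrite addr_gt0.
have a0 : 0 < a by rewrite divr_gt0.
have sT : sigma * T = 2 * pi by rewrite /T mulrC divfK ?gt_eqF.
have b0 : 0 < b.
  have sT2 : sigma / 2 * T = pi by rewrite mulrAC sT (mulrC 2) mulfK.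
  by rewrite subr_gt0 ltr_pdivrMr // mulrDr sT2 ltrDl mulr_gt0 // divr_gt0.
have ab : 2 * a + 2 * b = sigma by rewrite /b; field.
apply: le_trans (_ : M2 (extremal a b) <= _)%E.
  apply: ereal_inf_lbound; exists (extremal a b) => //; split.
    by rewrite -ab; exact: paley_wiener_extremal.
  exact: extremal_neq0.
apply: le_trans (@M2_extremal R a b a0) _.
by rewrite -EFinD lee_fin /a invf_div mulrCA mulfV ?gt_eqF // mulr1.
Qed.
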